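(* Let $Y$ be a Young set and $H$ a finite group, and let $\mathcal B=\mathcal B_{Y,H}$ and $\mathcal M=\mathcal M_{Y,H}$ be the graded algebras, with maps $\Delta_{\mathcal B},\delta_{\mathcal B},\epsilon_{\mathcal B}$ and $\Delta_{\mathcal M},\delta_{\mathcal M},\epsilon_{\mathcal M}$, defined in the context. The map $$\operatorname{reg}:\mathcal B\to\mathcal M,\qquad \pi_F\mapsto\operatorname{reg}_{\operatorname{Aut}F}$$ is an embedding of unital graded algebras, and it satisfies $$\Delta_{\mathcal M}\operatorname{reg}=(\operatorname{reg}\otimes\operatorname{reg})\Delta_{\mathcal B},\qquad \delta_{\mathcal M}\operatorname{reg}=(\operatorname{reg}\otimes\operatorname{reg})\delta_{\mathcal B},\qquad \epsilon_{\mathcal M}\operatorname{reg}=\epsilon_{\mathcal B}.$$ Thus the comultiplication maps $\Delta_{\mathcal B}$ and $\delta_{\mathcal B}$ each equip $\mathcal B$ with the structure of a connected, commutative and cocommutative graded Hopf algebra.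
   Context: Young sets. $\mathrm{Set}^{\mathrm{inj}}$ is the category of finite sets and injective maps, $\mathrm{Set}^\times$ the groupoid of finite sets and bijections. A Young set is a functor $Y:\mathrm{Set}^{\mathrm{inj}}\to\mathrm{Set}^{\mathrm{inj}}$, $N\mapsto Y_N$, with $Y_\emptyset=\emptyset$ and $Y_K\cap Y_L=Y_{K\cap L}$ for all subsets $K,L$ of the same finite set $N$; for $K\subseteq N$, $Y_K$ is regarded as a subset of $Y_N$ via the injection induced by inclusion. For an injection $w$ we write $w$ also for $Y_w$. For $N=K\sqcup L$ put $Y_{K,L}=Y_K\sqcup Y_L\subseteq Y_N$. For $K\subseteq N$, $K^c=N\setminus K$. Representations. $\Bbbk$ is an algebraically closed field of characteristic zero; representations are finite-dimensional over $\Bbbk$; $R(G)$ is the Grothendieck group of $\operatorname{Rep}(G)$, free abelian on $\operatorname{Irr}(G)$, and $R(G)\otimes_{\mathbb Z}R(G')\cong R(G\times G')$. $\operatorname{reg}_G$ is the regular representation of $G$. $\operatorname{Fun}(Y_N,H)$ is the group of functions $Y_N\to H$ (pointwise product). $\widehat H$ is a fixed set of representatives of the isomorphism classes of irreducible representations of $H$, $\operatorname{triv}_H\in\widehat H$ the trivial one; $V_\sigma$ is the space of $\sigma$. For $F\in\operatorname{Fun}(Y_N,\widehat H)$ (a function $Y_N\to\widehat H$), $\operatorname{supp}F=\{y:F(y)\ne\operatorname{triv}_H\}$, and for $Y'\subseteq Y_N$, $\pi_{F|_{Y'}}$ is the irreducible representation of $\operatorname{Fun}(Y',H)$ on $\bigotimes_{y\in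 Y'}V_{F(y)}$ given by $f\mapsto\bigotimes_yF(y)(f(y))$; $\pi_F=\pi_{F|_{Y_N}}$. The $\pi_F$ are, up to isomorphism, exactly the irreducible representations of $\operatorname{Fun}(Y_N,H)$. For a bijection $w:N\to M$, $(wF)(y)=F(w^{-1}y)$; $\operatorname{Aut}F=\{w\in S_N:wF=F\}$, $S_N$ being the symmetric group of $N$. Given $F_K\in\operatorname{Fun}(Y_K,\widehat H)$, $F_L\in\operatorname{Fun}(Y_L,\widehat H)$, $F_K\sqcup F_L\in\operatorname{Fun}(Y_{K\sqcup L},\widehat H)$ equals $F_K$ on $Y_K$, $F_L$ on $Y_L$, and $\operatorname{triv}_H$ elsewhere. $F_\emptyset$ is the empty function on $Y_\emptyset$. The algebra $\mathcal B$. $\mathcal B=\big(\bigoplus_NR(\operatorname{Fun}(Y_N,H))\big)_{\mathrm{Set}^\times}$, the sum being over finite sets $N$ and the subscript meaning that one imposes $\pi=\operatorname{Ad}_w\pi$ (transport of structure) for all bijections $w:N\to M$; it is free abelian on the classes of the $\pi_F$, with $\pi_F=\pi_{wF}$, and $R(\operatorname{Fun}(Y_N,H))$ is in degree $\#N$. Multiplication: $\pi_{F_K}\cdot\pi_{F_L}=\pi_{F_K\sqcup F_L}$; unit $\pi_{F_\emptyset}$; counit $\epsilon_{\mathcal B}(\pi_{F_\emptyset})=1$ and $\epsilon_{\mathcal B}(\pi_F)=0$ for all other $F$. For $F\in\operatorname{Fun}(Y_N,\widehat H)$, $$\Delta_{\mathcal B}\pi_F=\sum_{K\subseteq N}\Big(\prod_{y\in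 Y_N\setminus Y_{K,K^c}}\dim F(y)\Big)\pi_{F|_{Y_K}}\otimes\pi_{F|_{Y_{K^c}}},\qquad \delta_{\mathcal B}\pi_F=\sum_{K\subseteq N,\ \operatorname{supp}F\subseteq Y_{K,K^c}}\pi_{F|_{Y_K}}\otimes\pi_{F|_{Y_{K^c}}}.$$ The algebra $\mathcal M$. $\mathcal M=\big(\bigoplus_{N,\,F\in\operatorname{Fun}(Y_N,\widehat H)}R(\operatorname{Aut}F)\big)_{\mathrm{Set}^\times}$, imposing $\gamma=\operatorname{Ad}_w\gamma$, where for a bijection $w:N\to M$, $\operatorname{Ad}_w:R(\operatorname{Aut}F)\to R(\operatorname{Aut}wF)$, $\gamma\mapsto\gamma(w^{-1}\cdot w)$; $R(\operatorname{Aut}F)$ is in degree $\#N$. Multiplication: sum of $R(\operatorname{Aut}F_K)\otimes R(\operatorname{Aut}F_L)\cong R(\operatorname{Aut}F_K\times\operatorname{Aut}F_L)\xrightarrow{\operatorname{ind}}R(\operatorname{Aut}(F_K\sqcup F_L))$; unit: trivial representation of $\operatorname{Aut}F_\emptyset$. For $K\subseteq N$, $(\operatorname{Aut}F)_K=\{w\in\operatorname{Aut}F:wK=K\}$, embedded in $A_K:=\operatorname{Aut}(F|_{Y_K})\times\operatorname{Aut}(F|_{Y_{K^c}})$ by $w\mapsto(w|_K,w|_{K^c})$. For a representation $\gamma$ of $\operatorname{Aut}F$, $$\Delta_{\mathcal M}\gamma=\sum_{K}\operatorname{ind}_{(\operatorname{Aut}F)_K}^{A_K}\big((\operatorname{res}^{\operatorname{Aut}F}_{(\operatorname{Aut}F)_K}\gamma)\otimes_{\Bbbk}\pi_{F|_{Y_N\setminus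 Y_{K,K^c}}}\big),\qquad \delta_{\mathcal M}\gamma=\sum_{K:\ \operatorname{supp}F\subseteq Y_{K,K^c}}\operatorname{ind}_{(\operatorname{Aut}F)_K}^{A_K}\operatorname{res}^{\operatorname{Aut}F}_{(\operatorname{Aut}F)_K}\gamma,$$ with $K$ running over representatives of the $\operatorname{Aut}F$-orbits of subsets of $N$, $(\operatorname{Aut}F)_K$ acting on $\bigotimes_{y\in Y_N\setminus Y_{K,K^c}}V_{F(y)}$ by permuting tensor factors ($w\bigotimes_yv_y=\bigotimes_yv_{w^{-1}y}$), and summands viewed in $R(\operatorname{Aut}F|_{Y_K})\otimes R(\operatorname{Aut}F|_{Y_{K^c}})$. $\epsilon_{\mathcal M}$ sends the trivial representation of $\operatorname{Aut}F_\emptyset$ to $1$ and is zero on $R(\operatorname{Aut}F)$ for $F\in\operatorname{Fun}(Y_N,\widehat H)$, $N\ne\emptyset$. Connected means that the unit is an isomorphism from $\mathbb Z$ onto the degree $0$ part. *)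

(* Defs.v *)
From HB Require Import structures.
From mathcomp Require Import all_boot all_order all_fingroup all_algebra.
From mathcomp Require Import all_solvable all_character.
From mathcomp Require Import boolp.
From mathcomp Require Import freeg.

Set Implicit Arguments.
Unset Strict Implicit.
Unset Printing Implicit Defensive.

Import GroupScope GRing.Theory.
Local Open Scope ring_scope.

(* The additive map satisfying P. It is only used for specifications P that
   prescribe the values on a set of generators, so that there is at most one
   such map; should there be none, the result is the zero map. *)
Definition the_additive (A C : zmodType) (P : (A -> C) -> Prop) :
    {additive A -> C} :=
  match pselect (exists f : {additive A -> C}, P f) with
  | left h => projT1 (cid h)
  | right _ => \0
  end.

Lemma the_additiveP (A C : zmodType) (P : (A -> C) -> Prop) :
  (exists f : {additive A -> C}, P f) -> P (the_additive P).
Proof. by rewrite /the_additive; case: pselect => // h _; case: (cid h). Qed.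

Definition zspan (A : zmodType) (S : A -> Prop) (x : A) : Prop :=
  forall G : zmodClosed A, (forall s, S s -> s \in G) -> x \in G.

Section Presentation.
Variables (T : choiceType) (R : {freeg T} -> Prop).

Definition relators : {pred {freeg T}} := fun x => `[< zspan R x >].

Fact relators_zmod_closed : zmod_closed relators.
Proof.
split; first by apply/asboolP => G _; rewrite rpred0.
move=> x y /asboolP hx /asboolP hy; apply/asboolP => G hG.
by rewrite rpredB ?hx ?hy.
Qed.
HB.instance Definition _ :=
  GRing.isZmodClosed.Build {freeg T} relators relators_zmod_closed.

(* The abelian group with generators T and relations r = 0, r in R. *)
Definition pres : zmodType := Quotient.quot relators.

Definition fgen (t : T) : {freeg T} := [freeg [:: (1, t)]].
Definition gen (t : T) : pres := \pi_(pres)%qT (fgen t).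

Let eq0I (x y : {freeg T}) :
  \pi_(pres)%qT x = \pi_(pres)%qT y -> x - y \in relators.
Proof. by move=> h; rewrite Quotient.idealrBE; apply/eqP. Qed.

Lemma pres_lift (C : zmodType) (f : T -> C) :
    (forall g : {additive {freeg T} -> C},
       (forall t, g (fgen t) = f t) -> forall r, R r -> g r = 0) ->
  exists phi : {additive pres -> C}, forall t, phi (gen t) = f t.
Proof.
move=> hR.
pose g0 := fglift (f : T -> zmodule C).
have g0B : zmod_morphism (g0 : {freeg T} -> C) by exact: (@lift_is_additive _ T (zmodule C) f).
pose ga : {additive {freeg T} -> C} :=
  HB.pack g0 (GRing.isZmodMorphism.Build _ _ _ g0B).
have gaE t : ga (fgen t) = f t.
  by rewrite /= /g0 /fgen liftU scale1r.
have ga0 x : x \in relators -> ga x = 0.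
  move=> /asboolP hx.
  have kc : zmod_closed (fun x => ga x == 0 : bool).
    split=> [|a b /eqP ha /eqP hb]; first by apply/eqP; exact: raddf0.
    by apply/eqP; rewrite raddfB ha hb subrr.
  pose K : zmodClosed {freeg T} :=
    HB.pack (fun x => ga x == 0) (GRing.isZmodClosed.Build _ _ kc).
  apply/eqP; apply: (hx K) => r /(hR ga gaE) /eqP; by [].
pose phi (x : pres) : C := ga (generic_quotient.repr x).
have phiE x : phi (\pi_(pres)%qT x) = ga x.
  apply/eqP; rewrite -subr_eq0 -raddfB; apply/eqP/ga0.
  by apply: eq0I; rewrite reprK.
have phiB : zmod_morphism phi.
  move=> x y; rewrite -[x]reprK -[y]reprK -raddfB !phiE; exact: raddfB.
pose phia : {additive pres -> C} :=
  HB.pack phi (GRing.isZmodMorphism.Build _ _ _ phiB).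
by exists phia => t /=; rewrite phiE gaE.
Qed.

Lemma gen_rel (r : {freeg T}) : R r -> \pi_(pres)%qT r = 0 :> pres.
Proof.
move=> hr; rewrite -(raddf0 (\pi_(pres)%qT)); apply/eqP.
rewrite -Quotient.idealrBE subr0; apply/asboolP => G; exact.
Qed.

End Presentation.

Reserved Notation "x ⊗ y" (at level 40, left associativity).

Section Tensor.
Variables A B : zmodType.

Variant tensor_rel : {freeg (A * B)%type} -> Prop :=
| TensorDl a a' b : tensor_rel (fgen (a + a', b) - fgen (a, b) - fgen (a', b))
| TensorDr a b b' : tensor_rel (fgen (a, b + b') - fgen (a, b) - fgen (a, b')).

Definition tensor : zmodType := pres tensor_rel.
Definition tens (a : A) (b : B) : tensor := gen tensor_rel (a, b).

Lemma tensor_lift (C : zmodType) (f : A -> B -> C) :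
    (forall a a' b, f (a + a') b = f a b + f a' b) ->
    (forall a b b', f a (b + b') = f a b + f a b') ->
  exists phi : {additive tensor -> C}, forall a b, phi (tens a b) = f a b.
Proof.
move=> fDl fDr.
have [|phi phiE] := @pres_lift _ tensor_rel C (fun p => f p.1 p.2); last first.
  by exists phi => a b; rewrite phiE.
move=> g gE r; case=> [a a' b|a b b'].
  by rewrite !raddfB !gE /= fDl addrAC addrK subrr.
by rewrite !raddfB !gE /= fDr addrAC addrK subrr.
Qed.

Lemma tensDl a a' b : tens (a + a') b = tens a b + tens a' b.
Proof.
have := gen_rel (TensorDl a a' b); rewrite !raddfB /=.
by move/subr0_eq/(canRL (subrK _)) => e; rewrite [RHS]addrC; exact: e.
Qed.

Lemma tensDr a b b' : tens a (b + b') = tens a b + tens a b'.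
Proof.
have := gen_rel (TensorDr a b b'); rewrite !raddfB /=.
by move/subr0_eq/(canRL (subrK _)) => e; rewrite [RHS]addrC; exact: e.
Qed.

End Tensor.

Notation "x ⊗ y" := (tens x y) : ring_scope.

Definition tensor_map (A A' B B' : zmodType) (f : A -> A') (g : B -> B') :
    {additive tensor A B -> tensor A' B'} :=
  the_additive (fun phi => forall a b, phi (a ⊗ b) = f a ⊗ g b).

Lemma tensor_mapE (A A' B B' : zmodType)
    (f : {additive A -> A'}) (g : {additive B -> B'}) a b :
  tensor_map f g (a ⊗ b) = f a ⊗ g b.
Proof.
move: a b; pose P (phi : tensor A B -> tensor A' B') :=
  forall a b, phi (a ⊗ b) = f a ⊗ g b.
apply: (@the_additiveP _ _ P).
apply: (@tensor_lift _ _ _ (fun a b => f a ⊗ g b)) => *.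
  by rewrite raddfD tensDl.
by rewrite raddfD tensDr.
Qed.

Definition tensor_assoc (A B C : zmodType) :
    {additive tensor (tensor A B) C -> tensor A (tensor B C)} :=
  the_additive (fun phi => forall a b c, phi (a ⊗ b ⊗ c) = a ⊗ (b ⊗ c)).

Definition tensor_swap (A B : zmodType) : {additive tensor A B -> tensor B A} :=
  the_additive (fun phi => forall a b, phi (a ⊗ b) = b ⊗ a).

Record graded_algebra := GradedAlgebra {
  galg :> zmodType;
  gdeg : nat -> galg -> Prop;
  aone : galg;
  amul : {additive tensor galg galg -> galg}
}.
Arguments aone {g}.
Arguments amul {g}.

Section GradedHopf.
Variable A : graded_algebra.

Definition is_grading : Prop :=
  [/\ forall d, gdeg d (0 : A) /\ (forall x y : A, gdeg d x -> gdeg d y -> gdeg d (x - y)),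
      forall x : A, exists n (c : nat -> A),
        (forall i, gdeg i (c i)) /\ x = \sum_(i < n) c i
    & forall n (c : nat -> A), (forall i, gdeg i (c i)) ->
        \sum_(i < n) c i = 0 -> forall i, (i < n)%N -> c i = 0].

Definition is_graded_algebra : Prop :=
  [/\ is_grading,
      [/\ gdeg 0 (aone : A) &
          forall i j (x y : A), gdeg i x -> gdeg j y -> gdeg (i + j) (amul (x ⊗ y))],
      forall x y z : A, amul (amul (x ⊗ y) ⊗ z) = amul (x ⊗ amul (y ⊗ z))
    & forall x : A, amul (aone ⊗ x) = x /\ amul (x ⊗ aone) = x].

Definition commutative_algebra : Prop :=
  forall x y : A, amul (x ⊗ y) = amul (y ⊗ x).

Definition tensor_deg (d : nat) : tensor A A -> Prop :=
  zspan (fun t => exists i j (x y : A),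
          [/\ (i + j)%N = d, gdeg i x, gdeg j y & t = x ⊗ y]).

Definition tensor_mul : {additive tensor (tensor A A) (tensor A A) -> tensor A A} :=
  the_additive (fun phi => forall a b c d : A,
    phi ((a ⊗ b) ⊗ (c ⊗ d)) = amul (a ⊗ c) ⊗ amul (b ⊗ d)).

Variables (D : {additive A -> tensor A A}) (eps : {additive A -> int}).

Definition is_graded_coalgebra : Prop :=
  [/\ forall d (x : A), gdeg d x -> tensor_deg d (D x),
      forall d (x : A), gdeg d x -> d != 0%N -> eps x = 0,
      forall x, tensor_assoc A A A (tensor_map D idfun (D x)) =
                tensor_map idfun D (D x)
    & forall x, tensor_map eps idfun (D x) = 1 ⊗ x /\
                tensor_map idfun eps (D x) = x ⊗ 1].

Definition cocommutative_coalgebra : Prop :=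
  forall x, tensor_swap A A (D x) = D x.

Definition is_bialgebra : Prop :=
  [/\ D aone = aone ⊗ aone,
      forall x y, D (amul (x ⊗ y)) = tensor_mul (D x ⊗ D y),
      eps aone = 1
    & forall x y, eps (amul (x ⊗ y)) = eps x * eps y].

Definition has_antipode : Prop :=
  exists S : {additive A -> A},
    [/\ forall d (x : A), gdeg d x -> gdeg d (S x),
        forall x, amul (tensor_map S idfun (D x)) = aone *~ eps x
      & forall x, amul (tensor_map idfun S (D x)) = aone *~ eps x].

Definition is_graded_hopf_algebra : Prop :=
  [/\ is_graded_algebra, is_graded_coalgebra, is_bialgebra & has_antipode].

Definition connected_algebra : Prop :=
  injective (fun n : int => (aone : A) *~ n) /\
  forall x : A, gdeg 0 x <-> exists n : int, x = aone *~ n.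

End GradedHopf.

Definition graded_algebra_embedding (A A' : graded_algebra)
    (f : {additive A -> A'}) : Prop :=
  [/\ injective f,
      f aone = aone,
      forall x y : A, f (amul (x ⊗ y)) = amul (f x ⊗ f y)
    & forall d (x : A), gdeg d x -> gdeg d (f x)].

Record finj (N M : finType) :=
  FInj { finj_val :> {ffun N -> M}; _ : injectiveb finj_val }.

Definition mk_finj (N M : finType) (f : N -> M) (f_inj : injective f) : finj N M.
Proof.
by exists (finfun f); apply/injectiveP => x y; rewrite !ffunE; apply: f_inj.
Defined.

Lemma finjP (N M : finType) (f : finj N M) : injective f.
Proof. by case: f => f /= /injectiveP. Qed.

Lemma mk_finjE (N M : finType) (f : N -> M) (f_inj : injective f) x :
  mk_finj f_inj x = f x.
Proof. by rewrite ffunE. Qed.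

Lemma finj_eq (N M : finType) (f g : finj N M) : f =1 g -> f = g.
Proof.
case: f g => [f hf] [g hg] /= /ffunP e; rewrite {}e in hf *.
by rewrite (bool_irrelevance hf hg).
Qed.

Definition finj_id (N : finType) : finj N N := mk_finj (@inj_id N).
Definition finj_comp (N M P : finType) (g : finj M P) (f : finj N M) : finj N P :=
  mk_finj (inj_comp (@finjP _ _ g) (@finjP _ _ f)).

Lemma finj_idE (N : finType) x : finj_id N x = x.
Proof. exact: mk_finjE. Qed.
Lemma finj_compE (N M P : finType) (g : finj M P) (f : finj N M) x :
  finj_comp g f x = g (f x).
Proof. exact: mk_finjE. Qed.

Record fiso (N M : finType) := FIso {
  fwd : finj N M;
  bwd : finj M N;
  fwdK : cancel fwd bwd;
  bwdK : cancel bwd fwd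
}.

Definition subft (N : finType) (K : {set N}) : finType := {x : N | x \in K}.
Definition incl (N : finType) (K : {set N}) : finj (subft K) N :=
  mk_finj (@val_inj _ _ (subft K)).

Section PermIso.
Variables (N : finType) (w : {perm N}).

Fact perm_fwdK : cancel (mk_finj (@perm_inj N w)) (mk_finj (@perm_inj N w^-1)).
Proof. by move=> x; rewrite !mk_finjE permK. Qed.
Fact perm_bwdK : cancel (mk_finj (@perm_inj N w^-1)) (mk_finj (@perm_inj N w)).
Proof. by move=> x; rewrite !mk_finjE permKV. Qed.

Definition perm_iso : fiso N N := FIso perm_fwdK perm_bwdK.
End PermIso.

Section EnumIso.
Variable N : finType.

Fact enum_fwdK :
  cancel (mk_finj (@enum_rank_inj N)) (mk_finj (@enum_val_inj N N)).
Proof. by move=> x; rewrite !mk_finjE enum_rankK. Qed.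
Fact enum_bwdK :
  cancel (mk_finj (@enum_val_inj N N)) (mk_finj (@enum_rank_inj N)).
Proof. by move=> x; rewrite !mk_finjE enum_valK. Qed.

Definition enum_iso : fiso N 'I_#|N| := FIso enum_fwdK enum_bwdK.
End EnumIso.

Record young_set := YoungSet {
  yobj :> finType -> finType;
  ymap : forall N M : finType, finj N M -> finj (yobj N) (yobj M);
  ymap_id : forall N, ymap (finj_id N) = finj_id (yobj N);
  ymap_comp : forall (N M P : finType) (g : finj M P) (f : finj N M),
    ymap (finj_comp g f) = finj_comp (ymap g) (ymap f);
  yobj_void : #|yobj void| = 0%N;
  yobj_setI : forall (N : finType) (K L : {set N}),
    [set ymap (incl K) y | y in yobj (subft K)]
      :&: [set ymap (incl L) y | y in yobj (subft L)]
    = [set ymap (incl (K :&: L)) y | y in yobj (subft (K :&: L))]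
}.

Section YoungSet.
Variables (Y : young_set) (N : finType).

(* Y_K as a subset of Y_N *)
Definition yset (K : {set N}) : {set Y N} := [set ymap Y (incl K) y | y in Y (subft K)].

(* Y_{K, K^c} as a subset of Y_N *)
Definition yset2 (K : {set N}) : {set Y N} := yset K :|: yset (~: K).

End YoungSet.

Record ghom (aT rT : finGroupType) (D : {group aT}) (G : {group rT}) := GHom {
  gfun :> aT -> rT;
  ghomM : {in D &, {morph gfun : x y / (x * y)%g}};
  ghom_in : {in D, forall x, gfun x \in G}
}.

Section Pullback.
Variables (k : fieldType) (aT rT : finGroupType) (D : {group aT}) (G : {group rT}).
Variables (phi : ghom D G) (n : nat) (V : mx_representation k G n).

Fact pull_mx_repr : mx_repr D (V \o phi).
Proof.
have phi1 : phi 1%g = 1%g.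
  by apply: (mulgI (phi 1%g)); rewrite -ghomM ?group1 // !mulg1.
split=> [|x y xD yD] /=; first by rewrite phi1 repr_mx1.
by rewrite ghomM // repr_mxM ?(ghom_in phi).
Qed.
Definition pull_repr := MxRepresentation pull_mx_repr.
End Pullback.

(* The representation of G induced along an injective homomorphism phi : D -> G.
   Row vectors carry the action v g := v *m V g, and the space is the direct sum
   of copies V x of V, for x in a transversal of the right cosets of phi(D);
   for x g = phi(d) x', the element g maps (v x) to (v d) x'. *)
Section Induction.
Variables (k : fieldType) (aT rT : finGroupType) (D : {group aT}) (G : {group rT}).
Variables (phi : ghom D G) (phi_inj : {in D &, injective phi}).
Variables (n : nat) (V : mx_representation k D n).

Local Notation m := #|rcosets (phi @: D) G|.

Definition ind_rep (i : 'I_m) : rT := fingroup.repr (enum_val i).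

Definition ind_block (g : rT) (i j : 'I_m) : 'M[k]_n :=
  if [pick d in D | phi d == ind_rep i * g * (ind_rep j)^-1]%g is Some d
  then V d else 0.

Definition ind_mx (g : rT) : 'M[k]_(\sum_(i < m) n) :=
  \mxblock_(i < m, j < m) ind_block g i j.

Let im : {group rT} := (Morphism (ghomM phi) @* D)%G.
Let imE : im = phi @: D :> {set rT}.
Proof. by rewrite /im /= morphimEdom. Qed.

Let ind_repP i : ind_rep i \in G /\ enum_val i = im :* ind_rep i.
Proof.
have /rcosetsP[x xG ei] : enum_val i \in rcosets (phi @: D) G by apply: enum_valP.
rewrite /ind_rep ei -imE; have xi : x \in im :* x by rewrite rcoset_refl.
have /rcosetP[y yi ->] := mem_repr x xi; split; last by rewrite rcosetM (rcoset_id yi).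
rewrite groupM //; move: yi; rewrite imE => /imsetP[d dD ->].
exact: (ghom_in phi).
Qed.

Let ind_rep_ex y : y \in G -> exists j, (y * (ind_rep j)^-1)%g \in im.
Proof.
move=> yG; have yc : im :* y \in rcosets (phi @: D) G.
  by rewrite -imE; apply/rcosetsP; exists y.
exists (enum_rank_in yc (im :* y)).
have [_] := ind_repP (enum_rank_in yc (im :* y)).
by rewrite enum_rankK_in // => e; rewrite -mem_rcoset -e rcoset_refl.
Qed.

Let ind_rep_inj i j :
  (ind_rep i * (ind_rep j)^-1)%g \in im -> i = j.
Proof.
move=> h; apply: enum_val_inj.
have [_ ->] := ind_repP i; have [_ ->] := ind_repP j.
by apply/rcoset_eqP; rewrite mem_rcoset.
Qed.

Let ind_blockE g i j d : d \in D ->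
  phi d = (ind_rep i * g * (ind_rep j)^-1)%g -> ind_block g i j = V d.
Proof.
move=> dD de; rewrite /ind_block; case: pickP => [d' /andP[d'D /eqP]|/(_ d)].
  by rewrite -de => /(phi_inj d'D dD) ->.
by rewrite /= dD de eqxx.
Qed.

Let ind_block0 g i j :
  (ind_rep i * g * (ind_rep j)^-1)%g \notin im -> ind_block g i j = 0.
Proof.
move=> h; rewrite /ind_block; case: pickP => // d /andP[dD /eqP de].
by case/negP: h; rewrite -de imE imset_f.
Qed.

Fact ind_mx_repr : mx_repr G ind_mx.
Proof.
split=> [|g h gG hG].
  rewrite -mxdiagZ; apply: eq_mxblock => i j; case: eqP => [<-|nij].
    rewrite conform_mx_id (@ind_blockE _ _ _ 1%g) ?group1 ?repr_mx1 //.
    rewrite mulg1 mulgV; apply: (mulgI (phi 1%g)).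
    by rewrite -(ghomM phi) ?group1 // !mulg1.
  rewrite ind_block0 // mulg1; apply/negP => /ind_rep_inj; exact: nij.
rewrite /ind_mx mul_mxblock; apply: eq_mxblock => i l.
have [xiG _] := ind_repP i.
have [j ij] := ind_rep_ex (groupM xiG gG).
have [d dD de] : exists2 d, d \in D & (ind_rep i * g * (ind_rep j)^-1)%g = phi d.
  by move: ij; rewrite imE => /imsetP.
rewrite (bigD1 j) //= big1 ?addr0 => [|j' j'j]; last first.
  rewrite ind_block0 ?mul0mx //; apply/negP => ij'; case/eqP: j'j.
  apply: ind_rep_inj; have := groupM (groupVr ij') ij.
  by rewrite !invMg !mulgA invgK mulgKV mulgKV.
rewrite (ind_blockE dD (esym de)).
have e : (ind_rep i * (g * h) * (ind_rep l)^-1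
          = phi d * (ind_rep j * h * (ind_rep l)^-1))%g.
  by rewrite -de !mulgA mulgKV.
have [jl|jl] := boolP ((ind_rep j * h * (ind_rep l)^-1)%g \in im).
  have [d' d'D d'e] : exists2 d', d' \in D &
      (ind_rep j * h * (ind_rep l)^-1)%g = phi d'.
    by move: jl; rewrite imE => /imsetP.
  rewrite (ind_blockE d'D (esym d'e)) -repr_mxM //.
  by apply: ind_blockE; rewrite ?groupM // e d'e (ghomM phi).
rewrite (ind_block0 jl) mulmx0 ind_block0 // e groupMl //.
by rewrite -de.
Qed.

Definition ind_repr := MxRepresentation ind_mx_repr.
End Induction.

Section ExternalTensor.
Variables (k : fieldType) (gT1 gT2 : finGroupType).
Variables (G1 : {group gT1}) (G2 : {group gT2}).

Fact fst_ghomM : {in setX G1 G2 &, {morph fst : x y / (x * y)%g}}.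
Proof. by []. Qed.
Fact fst_ghom_in : {in setX G1 G2, forall x, x.1 \in G1}.
Proof. by case=> x y /setXP[]. Qed.
Definition fst_ghom : ghom (setX_group G1 G2) G1 := GHom fst_ghomM fst_ghom_in.

Fact snd_ghomM : {in setX G1 G2 &, {morph snd : x y / (x * y)%g}}.
Proof. by []. Qed.
Fact snd_ghom_in : {in setX G1 G2, forall x, x.2 \in G2}.
Proof. by case=> x y /setXP[]. Qed.
Definition snd_ghom : ghom (setX_group G1 G2) G2 := GHom snd_ghomM snd_ghom_in.

Definition box_repr n1 n2
    (V : mx_representation k G1 n1) (W : mx_representation k G2 n2) :
    mx_representation k (setX_group G1 G2) (n1 * n2) :=
  prod_repr (pull_repr fst_ghom V) (pull_repr snd_ghom W).
End ExternalTensor.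

Section TrivialRepr.
Variables (k : fieldType) (gT : finGroupType) (G : {group gT}).
Fact triv_mx_repr : mx_repr G (fun _ => 1%:M : 'M[k]_1).
Proof. by split=> // x y _ _; rewrite mulmx1. Qed.
Definition triv_repr := MxRepresentation triv_mx_repr.
End TrivialRepr.

Section Grothendieck.
Variables (k : fieldType) (gT : finGroupType) (G : {group gT}).

Definition mrep := {n : nat & mx_representation k G n}.
HB.instance Definition _ := gen_eqMixin mrep.
HB.instance Definition _ := gen_choiceMixin mrep.

Definition mk_mrep n (V : mx_representation k G n) : mrep := existT _ n V.

Variant grothendieck_rel : {freeg mrep} -> Prop :=
| GrothendieckIso n (V : mx_representation k G n)
      m (W : mx_representation k G m) of mx_rsim V W :
    grothendieck_rel (fgen (mk_mrep V) - fgen (mk_mrep W))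
| GrothendieckExact n (V : mx_representation k G n) (U : 'M_n)
      (Umod : mxmodule V U) :
    grothendieck_rel (fgen (mk_mrep V) - fgen (mk_mrep (submod_repr Umod))
                                      - fgen (mk_mrep (factmod_repr Umod))).

Definition Rgrp : zmodType := pres grothendieck_rel.
Definition clsR n (V : mx_representation k G n) : Rgrp := gen _ (mk_mrep V).
End Grothendieck.

Record irr_reps (k : fieldType) (H : finGroupType) := IrrReps {
  hat :> finType;
  hdim : hat -> nat;
  hrep : forall s, mx_representation k [set: H]%G (hdim s);
  hrep_irr : forall s, mx_irreducible (hrep s);
  hrep_inj : forall s t, mx_rsim (hrep s) (hrep t) -> s = t;
  hrep_all : forall n (V : mx_representation k [set: H]%G n),
    mx_irreducible V -> exists s, mx_rsim V (hrep s);
  htriv : hat;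
  htrivP : mx_rsim (hrep htriv) (triv_repr k [set: H]%G)
}.

Lemma dffun_distr (R : comNzRingType) (I : finType) (T_ : I -> finType)
    (P : forall i, T_ i -> R) :
  \prod_i \sum_(j : T_ i) P i j
  = \sum_(f : {dffun forall i, T_ i}) \prod_i P i (f i).
Proof.
pose P_ i : {ffun T_ i -> R} := [ffun j => P i j].
transitivity (\sum_(t : fprod T_) \prod_(i in I) P_ i (t i)).
  rewrite big_fprod.
  rewrite -(bigA_distr_big_dep (fun i => tagged_with T_ i) (fun i => untag 0 (P_ i))).
  apply: eq_bigr => i _; rewrite (eq_bigr (P_ i)) => [|j _]; last by rewrite ffunE.
  exact: (big_tag (fun i => P_ i)).
rewrite (reindex (@fprod_of_dffun I T_)) /=.
  apply: eq_bigr => f _; apply: eq_bigr => i _; by rewrite fprodE ffunE.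
by exists (@dffun_of_fprod I T_) => ? _; rewrite ?fprodK ?dffun_of_fprodK ?fprod_of_dffunK.
Qed.

Section TensorRepr.
Variables (k : fieldType) (H : finGroupType) (X : irr_reps k H).
Variables (Z : finType) (F : {ffun Z -> X}).

Definition Fun : finGroupType := {dffun forall _ : Z, H}.

(* The basis of the tensor product of the V_{F(y)} that consists of the tensor
   products of standard basis vectors is indexed by tens_idx. *)
Definition tens_idx : finType := {dffun forall y : Z, 'I_(hdim (F y))}.
Definition tens_at (i : 'I_#|tens_idx|) : {dffun forall y : Z, 'I_(hdim (F y))} :=
  enum_val i.

Definition pi_mx (f : Fun) : 'M[k]_#|tens_idx| :=
  \matrix_(i, j) \prod_y hrep (F y) (f y) (tens_at i y) (tens_at j y).

Fact pi_mx_repr : mx_repr [set: Fun]%G pi_mx.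
Proof.
split=> [|f g _ _]; apply/matrixP => i j; rewrite !mxE.
  under eq_bigr do rewrite ffunE repr_mx1 mxE.
  have [<-|nij] := eqVneq i j; first by rewrite big1 // => y _; rewrite eqxx.
  have [y hy] : exists y, tens_at i y != tens_at j y.
    apply/existsP; apply: contraNT nij; rewrite negb_exists => /forallP e.
    apply/eqP/enum_val_inj/ffunP => y; apply/eqP; move: (e y).
    by rewrite negbK.
  by rewrite (bigD1 y) //= (negPf hy) mul0r.
under eq_bigr do rewrite ffunE repr_mxM ?inE // mxE.
rewrite dffun_distr (reindex tens_at) /=.
  apply: eq_bigr => l _; rewrite !mxE -big_split /=; exact: eq_bigr.
by apply: onW_bij; apply: enum_val_bij.
Qed.

Definition pi_repr := MxRepresentation pi_mx_repr.
End TensorRepr.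

Definition pullR (k : fieldType) (aT rT : finGroupType) (D : {group aT})
    (G : {group rT}) (phi : ghom D G) : {additive Rgrp k G -> Rgrp k D} :=
  the_additive (fun f => forall n (V : mx_representation k G n),
    f (clsR V) = clsR (pull_repr phi V)).

Lemma pullRE (k : fieldType) (aT rT : finGroupType) (D : {group aT})
    (G : {group rT}) (phi : ghom D G) n (V : mx_representation k G n) :
  pullR k phi (clsR V) = clsR (pull_repr phi V).
Proof.
move: n V; pose P (f : Rgrp k G -> Rgrp k D) := forall n
  (V : mx_representation k G n), f (clsR V) = clsR (pull_repr phi V).
apply: (@the_additiveP _ _ P).
have [|f fE] := @pres_lift _ (@grothendieck_rel k rT G) (Rgrp k D)
  (fun V => clsR (pull_repr phi (projT2 V))); last by exists f => n V; apply: fE.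
have iso n (V : mx_representation k D n) m (W : mx_representation k D m) :
    mx_rsim V W -> clsR V = clsR W.
  by move/GrothendieckIso/gen_rel; rewrite raddfB /= => /subr0_eq.
move=> g gE r; case=> [n V m W VW | n V U Umod]; rewrite !raddfB !gE /=.
  apply/eqP; rewrite subr_eq0; apply/eqP/iso.
  case: VW => B nm fB hB; exists B => // x xD.
  by rewrite /= hB // (ghom_in phi).
have Umod' : mxmodule (pull_repr phi V) U.
  apply/mxmoduleP => x xD /=; exact: (mxmoduleP Umod) (ghom_in phi xD).
have := gen_rel (GrothendieckExact Umod'); rewrite !raddfB /=.
have -> : \pi_(Rgrp k D)%qT (fgen (mk_mrep (submod_repr Umod')))
        = clsR (pull_repr phi (submod_repr Umod)).
  by apply: iso; exists 1%:M; rewrite ?row_free_unit ?unitmx1 // => x xD;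
     rewrite mulmx1 mul1mx.
have -> : \pi_(Rgrp k D)%qT (fgen (mk_mrep (factmod_repr Umod')))
        = clsR (pull_repr phi (factmod_repr Umod)).
  by apply: iso; exists 1%:M; rewrite ?row_free_unit ?unitmx1 // => x xD;
     rewrite mulmx1 mul1mx.
by [].
Qed.

(* Inverse of the isomorphism R(G1) ⊗ R(G2) -> R(G1 x G2). *)
Definition unboxR (k : fieldType) (gT1 gT2 : finGroupType)
    (G1 : {group gT1}) (G2 : {group gT2}) :
    {additive Rgrp k (setX_group G1 G2) -> tensor (Rgrp k G1) (Rgrp k G2)} :=
  the_additive (fun f => forall n1 n2
      (V : mx_representation k G1 n1) (W : mx_representation k G2 n2),
    f (clsR (box_repr V W)) = clsR V ⊗ clsR W).

Section Colorings.
Variables (Y : young_set) (X : finType).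

Definition transp (N M : finType) (w : fiso N M) (F : {ffun Y N -> X}) :
    {ffun Y M -> X} :=
  [ffun y => F (ymap Y (bwd w) y)].

(* The product v * w of permutations is the function w \o v. A matrix
   representation V of a group of permutations is therefore a left module for the
   composition of functions when w acts on row vectors by u |-> u *m V w. *)
Definition aut_set (N : finType) (F : {ffun Y N -> X}) : {set {perm N}} :=
  [set w | transp (perm_iso w) F == F].

Definition pinj (N : finType) (w : {perm N}) : finj N N := fwd (perm_iso w).

Lemma pinjE (N : finType) (w : {perm N}) x : pinj w x = w x.
Proof. exact: mk_finjE. Qed.

Lemma pinjM (N : finType) (v w : {perm N}) :
  pinj (v * w) = finj_comp (pinj w) (pinj v).
Proof. by apply: finj_eq => x; rewrite finj_compE !pinjE permM. Qed.

Lemma pinj1 (N : finType) : pinj 1 = finj_id N.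
Proof. by apply: finj_eq => x; rewrite pinjE finj_idE perm1. Qed.

Lemma ymapM (N M P : finType) (g : finj M P) (f : finj N M) y :
  ymap Y (finj_comp g f) y = ymap Y g (ymap Y f y).
Proof. by rewrite ymap_comp finj_compE. Qed.

Lemma ymap1 (N : finType) (y : Y N) : ymap Y (finj_id N) y = y.
Proof. by rewrite ymap_id finj_idE. Qed.

Lemma aut_setP (N : finType) (F : {ffun Y N -> X}) (w : {perm N}) :
  reflect (forall y, F (ymap Y (pinj w) y) = F y) (w \in aut_set F).
Proof.
have bE : bwd (perm_iso w) = pinj w^-1 by [].
rewrite inE; apply: (iffP eqP) => [e y|e].
  by rewrite -{1}e ffunE bE -ymapM -pinjM mulgV pinj1 ymap1.
by apply/ffunP => y; rewrite ffunE bE -e -ymapM -pinjM mulVg pinj1 ymap1.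
Qed.

Fact aut_group_set (N : finType) (F : {ffun Y N -> X}) : group_set (aut_set F).
Proof.
apply/group_setP; split; first by apply/aut_setP => y; rewrite pinj1 ymap1.
move=> v w /aut_setP hv /aut_setP hw; apply/aut_setP => y.
by rewrite pinjM ymapM hw hv.
Qed.
Definition AutF (N : finType) (F : {ffun Y N -> X}) : {group {perm N}} :=
  Group (aut_group_set F).

(* w^-1 g w *)
Definition conj_perm (N M : finType) (w : fiso N M) (g : {perm M}) : {perm N} :=
  perm (@finjP _ _ (finj_comp (bwd w) (finj_comp (pinj g) (fwd w)))).

Lemma conj_pinj (N M : finType) (w : fiso N M) (g : {perm M}) :
  pinj (conj_perm w g) = finj_comp (bwd w) (finj_comp (pinj g) (fwd w)).
Proof. by apply: finj_eq => x; rewrite pinjE permE. Qed.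

Lemma ymap_fwdK (N M : finType) (w : fiso N M) y :
  ymap Y (bwd w) (ymap Y (fwd w) y) = y.
Proof.
rewrite -ymapM -[RHS]ymap1; congr (ymap Y _ y).
by apply: finj_eq => x; rewrite finj_compE finj_idE fwdK.
Qed.

Section AutTransport.
Variables (N M : finType) (w : fiso N M) (F : {ffun Y N -> X}).

Fact aut_ad_morph :
  {in AutF (transp w F) &, {morph conj_perm w : g h / (g * h)%g}}.
Proof.
move=> g h _ _; apply/permP => x.
by rewrite permM !permE !finj_compE !pinjE bwdK permM.
Qed.

Fact aut_ad_in : {in AutF (transp w F), forall g, conj_perm w g \in AutF F}.
Proof.
move=> g /aut_setP hg; apply/aut_setP => y.
have := hg (ymap Y (fwd w) y).
by rewrite !ffunE ymap_fwdK conj_pinj !ymapM.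
Qed.

(* g |-> w^-1 g w, so that Ad_w is the pullback along aut_ad *)
Definition aut_ad : ghom (AutF (transp w F)) (AutF F) := GHom aut_ad_morph aut_ad_in.
End AutTransport.

Definition frestr (N : finType) (F : {ffun Y N -> X}) (K : {set N}) :
    {ffun Y (subft K) -> X} :=
  [ffun y => F (ymap Y (incl K) y)].

(* w|_K, for a permutation w with w K = K *)
Definition perm_restr (N : finType) (K : {set N}) (w : {perm N}) : {perm subft K} :=
  odflt 1%g [pick u : {perm subft K} | [forall x, val (u x) == w (val x)]].

(* (Aut F)_K *)
Definition aut_stab (N : finType) (F : {ffun Y N -> X}) (K : {set N}) :
    {group {perm N}} := 'N_(AutF F)(K | 'P)%G.

Lemma perm_restrE (N : finType) (K : {set N}) (w : {perm N}) x :
  w \in 'N(K | 'P) -> val (perm_restr K w x) = w (val x).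
Proof.
move=> wK; rewrite /perm_restr; case: pickP => [u /forallP/(_ x)/eqP //|].
have hK (z : subft K) : w (val z) \in K.
  by have := astabs_act (val z) wK => /= ->; exact: valP.
pose f (z : subft K) : subft K := Sub (w (val z)) (hK z).
have f_inj : injective f.
  by move=> y z /(congr1 val) /= /perm_inj/val_inj.
by move/(_ (perm f_inj))/forallP; case=> z; rewrite permE.
Qed.

Lemma aut_stab_setC (N : finType) (F : {ffun Y N -> X}) (K : {set N}) w :
  w \in aut_stab F K ->
  [/\ w \in AutF F, w \in 'N(K | 'P) & w \in 'N(~: K | 'P)].
Proof. by case/setIP=> wF wK; split=> //; rewrite astabsC. Qed.

Section AutRestr.
Variables (N : finType) (F : {ffun Y N -> X}) (K : {set N}).

Let D := aut_stab F K.
Let AK := setX_group (AutF (frestr F K)) (AutF (frestr F (~: K))).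

Definition restr2 (w : {perm N}) : {perm subft K} * {perm subft (~: K)} :=
  (perm_restr K w, perm_restr (~: K) w).

Let perm_restrM (L : {set N}) v w : v \in 'N(L | 'P) -> w \in 'N(L | 'P) ->
  perm_restr L (v * w) = (perm_restr L v * perm_restr L w)%g.
Proof.
move=> hv hw; apply/permP => x; apply: val_inj.
by rewrite permM !perm_restrE ?groupM // permM.
Qed.

Let perm_restr_in (L : {set N}) w : w \in AutF F -> w \in 'N(L | 'P) ->
  perm_restr L w \in AutF (frestr F L).
Proof.
move=> /aut_setP wF wL; apply/aut_setP => y; rewrite !ffunE -ymapM.
rewrite -[RHS]wF -ymapM; congr (F (ymap Y _ y)); apply: finj_eq => x.
by rewrite !finj_compE !pinjE !mk_finjE perm_restrE.
Qed.

Fact restr2_morph : {in D &, {morph restr2 : v w / (v * w)%g}}.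
Proof.
move=> v w /aut_stab_setC[_ v1 v2] /aut_stab_setC[_ w1 w2].
by rewrite /restr2 !perm_restrM.
Qed.

Fact restr2_in : {in D, forall w, restr2 w \in AK}.
Proof.
by move=> w /aut_stab_setC[wF w1 w2]; rewrite inE /= !perm_restr_in.
Qed.

Definition aut_restr : ghom D AK := GHom restr2_morph restr2_in.

Fact aut_restr_inj : {in D &, injective aut_restr}.
Proof.
move=> v w /aut_stab_setC[_ v1 v2] /aut_stab_setC[_ w1 w2] [e1 e2].
apply/permP => x; have [xK|xK] := boolP (x \in K).
  have := congr1 (fun u : {perm subft K} => val (u (Sub x xK))) e1.
  by rewrite /= !perm_restrE.
have xK' : x \in ~: K by rewrite inE.
have := congr1 (fun u : {perm subft (~: K)} => val (u (Sub x xK'))) e2.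
by rewrite /= !perm_restrE.
Qed.

End AutRestr.

Section Join.
Variable x0 : X.
Variables (K L : finType) (FK : {ffun Y K -> X}) (FL : {ffun Y L -> X}).

Definition inlj : finj K (K + L)%type := mk_finj (@inl_inj K L).
Definition inrj : finj L (K + L)%type := mk_finj (@inr_inj K L).

Definition fjoin : {ffun Y (K + L)%type -> X} :=
  [ffun y => if [pick u | ymap Y inlj u == y] is Some u then FK u
             else if [pick v | ymap Y inrj v == y] is Some v then FL v
             else x0].

Definition perm_sum_fun (p : {perm K} * {perm L}) (s : K + L) : K + L :=
  match s with inl x => inl (p.1 x) | inr x => inr (p.2 x) end.

Fact perm_sum_inj p : injective (perm_sum_fun p).
Proof. by case=> x [] y //= [] /perm_inj ->. Qed.

Definition perm_sum p : {perm (K + L)%type} := perm (@perm_sum_inj p).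

Let D := setX_group (AutF FK) (AutF FL).

Fact perm_sum_morph : {in D &, {morph perm_sum : p q / (p * q)%g}}.
Proof.
by move=> p q _ _; apply/permP => -[] x; rewrite permM !permE /= permM.
Qed.

Let yl (p : {perm K} * {perm L}) a :
  ymap Y (pinj (perm_sum p)) (ymap Y inlj a) = ymap Y inlj (ymap Y (pinj p.1) a).
Proof.
rewrite -!ymapM; congr (ymap Y _ a); apply: finj_eq => x.
by rewrite !finj_compE !pinjE !mk_finjE permE.
Qed.

Let yr (p : {perm K} * {perm L}) b :
  ymap Y (pinj (perm_sum p)) (ymap Y inrj b) = ymap Y inrj (ymap Y (pinj p.2) b).
Proof.
rewrite -!ymapM; congr (ymap Y _ b); apply: finj_eq => x.
by rewrite !finj_compE !pinjE !mk_finjE permE.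
Qed.

Let perm_sumK p y :
  ymap Y (pinj (perm_sum (p.1^-1, p.2^-1)%g)) (ymap Y (pinj (perm_sum p)) y) = y.
Proof.
rewrite -ymapM -[RHS]ymap1; congr (ymap Y _ y); apply: finj_eq => -[] x;
by rewrite finj_compE finj_idE !pinjE !permE /= permK.
Qed.

Fact perm_sum_in : {in D, forall p, perm_sum p \in AutF fjoin}.
Proof.
move=> [u v] /setXP[/= /aut_setP uF /aut_setP vF]; apply/aut_setP => y.
rewrite !ffunE; case: pickP => [a /eqP ea|na].
  case: pickP => [a' /eqP ea'|/(_ (ymap Y (pinj u^-1) a))].
    by move: ea; rewrite -ea' yl => /finjP ->; rewrite uF.
  by rewrite -[y](perm_sumK (u, v)) -ea yl /= eqxx.
case: (pickP (fun c => ymap Y inlj c == y)) => [a /eqP ea|na'].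
  by have := na (ymap Y (pinj u) a); rewrite -ea yl eqxx.
case: pickP => [b /eqP eb|nb].
  case: pickP => [b' /eqP eb'|/(_ (ymap Y (pinj v^-1) b))].
    by move: eb; rewrite -eb' yr => /finjP ->; rewrite vF.
  by rewrite -[y](perm_sumK (u, v)) -eb yr /= eqxx.
case: pickP => // b /eqP eb.
by have := nb (ymap Y (pinj v) b); rewrite -eb yr eqxx.
Qed.

Definition aut_sum : ghom D (AutF fjoin) := GHom perm_sum_morph perm_sum_in.

Fact aut_sum_inj : {in D &, injective aut_sum}.
Proof.
move=> [u v] [u' v'] _ _ /permP e; congr pair; apply/permP => x.
  by have := e (inl x); rewrite !permE /= => -[].
by have := e (inr x); rewrite !permE /= => -[].
Qed.

End Join.
End Colorings.

Section PermTensor.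
Variables (Y : young_set) (k : fieldType) (H : finGroupType) (X : irr_reps k H).
Variables (N : finType) (F : {ffun Y N -> X}) (K : {set N}).

(* F restricted to Y_N \ Y_{K, K^c} *)
Definition restr_out : {ffun subft (~: yset2 Y K) -> X} := [ffun y => F (val y)].

(* The action of (Aut F)_K by permutation of the tensor factors V_{F(y)}, for y
   outside of Y_{K, K^c}: w maps the basis vector indexed by b to the one
   indexed by b' with b'(w y) = b(y), where V_{F(w y)} = V_{F(y)}. *)
Definition tperm_mx (w : {perm N}) : 'M[k]_#|tens_idx restr_out| :=
  \matrix_(i, j) [forall y, forall z, (val z == ymap Y (pinj w) (val y)) ==>
                    (tens_at j z == tens_at i y :> nat)]%:R.

Let D := aut_stab F K.
Let Z := subft (~: yset2 Y K).

Let yset_stab (L : {set N}) w y : w \in 'N(L | 'P) ->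
  y \in yset Y L -> ymap Y (pinj w) y \in yset Y L.
Proof.
move=> wL /imsetP[u _ ->]; apply/imsetP.
exists (ymap Y (pinj (perm_restr L w)) u) => //.
rewrite -!ymapM; congr (ymap Y _ u); apply: finj_eq => x.
by rewrite !finj_compE !pinjE !mk_finjE perm_restrE.
Qed.

Let out_stab w (y : Z) : w \in D -> ymap Y (pinj w) (val y) \in ~: yset2 Y K.
Proof.
move=> wD; have := valP y; rewrite !in_setC; apply: contra; rewrite !in_setU => h.
have [_ w1 w2] := aut_stab_setC (groupVr wD).
have -> : val y = ymap Y (pinj w^-1) (ymap Y (pinj w) (val y)).
  by rewrite -ymapM -pinjM mulgV pinj1 ymap1.
by case/orP: h => h; rewrite (yset_stab _ h) ?orbT.
Qed.

Let yact w (wD : w \in D) (y : Z) : Z :=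
  exist (fun x => x \in ~: yset2 Y K) (ymap Y (pinj w) (val y)) (out_stab y wD).

Let yactK w (wD : w \in D) (z : Z) : yact wD (yact (groupVr wD) z) = z.
Proof.
by apply: val_inj; rewrite /= -ymapM -pinjM mulVg pinj1 ymap1.
Qed.

Let tperm_mxE w (wD : w \in D) i j :
  tperm_mx w i j = [forall y, tens_at j (yact wD y) == tens_at i y :> nat]%:R.
Proof.
rewrite mxE; congr (nat_of_bool _)%:R; apply/forallP/forallP => h y.
  by move/forallP: (h y) => /(_ (yact wD y)); rewrite eqxx.
apply/forallP => z; apply/implyP => /eqP e.
by rewrite (_ : z = yact wD y) //; apply: val_inj.
Qed.

Let restr_outE w (wD : w \in D) z :
  hdim (restr_out (yact (groupVr wD) z)) = hdim (restr_out z).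
Proof.
have [/groupVr/aut_setP wF _ _] := aut_stab_setC wD.
by rewrite !ffunE /= wF.
Qed.

Let tidx w (wD : w \in D) (i : 'I_#|tens_idx restr_out|) :
    'I_#|tens_idx restr_out| :=
  enum_rank ([ffun z => cast_ord (restr_outE wD z)
                          (tens_at i (yact (groupVr wD) z))] : tens_idx restr_out).

Let tidxE w (wD : w \in D) i z :
  nat_of_ord (tens_at (tidx wD i) z) = tens_at i (yact (groupVr wD) z).
Proof.
by rewrite /tens_at enum_rankK; apply: (congr1 (@nat_of_ord _) (ffunE _ _)).
Qed.

Let tens_at_eq (i j : 'I_#|tens_idx restr_out|) :
  (forall z, tens_at i z = tens_at j z :> nat) -> i = j.
Proof.
by move=> e; apply: enum_val_inj; apply/ffunP => z; apply: val_inj; apply: e.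
Qed.

Let tperm_mx_tidx w (wD : w \in D) i j : tperm_mx w i j = (j == tidx wD i)%:R.
Proof.
rewrite (tperm_mxE wD); congr (nat_of_bool _)%:R; apply/forallP/eqP => [h|->].
  apply: tens_at_eq => z; rewrite tidxE.
  by have /eqP := h (yact (groupVr wD) z); rewrite yactK.
move=> y; rewrite tidxE; apply/eqP.
suff -> : yact (groupVr wD) (yact wD y) = y by [].
by apply: val_inj; rewrite /= -ymapM -pinjM mulgV pinj1 ymap1.
Qed.

Fact tperm_mx_repr : mx_repr D tperm_mx.
Proof.
split=> [|v w vD wD]; apply/matrixP => i j.
  rewrite (tperm_mxE (group1 D)) mxE; congr (nat_of_bool _)%:R.
  have y1 y : yact (group1 D) y = y by apply: val_inj; rewrite /= pinj1 ymap1.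
  apply/forallP/eqP => [h|-> y]; last by rewrite y1.
  by apply: tens_at_eq => y; have /eqP := h y; rewrite y1.
have vwD := groupM vD wD.
rewrite (tperm_mx_tidx vwD) mxE (bigD1 (tidx vD i)) //= big1 ?addr0; last first.
  by move=> l li; rewrite (tperm_mx_tidx vD) (negPf li) mul0r.
rewrite (tperm_mx_tidx vD) eqxx mul1r (tperm_mx_tidx wD).
congr (_ == _)%:R; apply: tens_at_eq => z; rewrite !tidxE.
suff -> : yact (groupVr vwD) z = yact (groupVr vD) (yact (groupVr wD) z) by [].
by apply: val_inj; rewrite /= -ymapM -pinjM invMg.
Qed.

Definition tperm_repr := MxRepresentation tperm_mx_repr.
End PermTensor.

Section Algebras.
Variables (k : closedFieldType) (H : finGroupType) (X : irr_reps k H).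
Variable Y : young_set.

Section FunTransport.
Variables (N M : finType) (w : fiso N M).

Definition fun_ad_fun (f : Fun H (Y M)) : Fun H (Y N) :=
  [ffun y => f (ymap Y (fwd w) y)].

Fact fun_ad_morph :
  {in [set: Fun H (Y M)]%G &, {morph fun_ad_fun : f g / (f * g)%g}}.
Proof. by move=> f g _ _; apply/ffunP => y; rewrite !ffunE. Qed.

Fact fun_ad_in :
  {in [set: Fun H (Y M)]%G, forall f, fun_ad_fun f \in [set: Fun H (Y N)]%G}.
Proof. by move=> f _; rewrite inE. Qed.

Definition fun_ad : ghom [set: Fun H (Y M)]%G [set: Fun H (Y N)]%G :=
  GHom fun_ad_morph fun_ad_in.
End FunTransport.

Definition empty_fun : {ffun Y void -> X} := [ffun=> htriv X].

Definition RFun (N : finType) : zmodType := Rgrp k [set: Fun H (Y N)]%G.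

(* B is generated by the pairs (n, x), x in R(Fun(Y_{'I_n}, H)), subject to
   additivity in x (direct sum over the sets 'I_n) and to (m, Ad_w x) = (n, x)
   for all bijections w : 'I_n -> 'I_m. The direct sum over all finite types
   would not be a zmodType for universe reasons, but the sets 'I_n are a skeleton
   of the groupoid of finite sets; clsB maps R(Fun(Y_N, H)) to B for every finite
   set N, by transport along the enumeration of N. *)
Definition Bgen : choiceType := {n : nat & RFun 'I_n}.
Definition mk_Bgen n (x : RFun 'I_n) : Bgen := existT _ n x.

Variant B_rel : {freeg Bgen} -> Prop :=
| BAdd n (x y : RFun 'I_n) :
    B_rel (fgen (mk_Bgen (x + y)) - fgen (mk_Bgen x) - fgen (mk_Bgen y))
| BAd n m (w : fiso 'I_n 'I_m) (x : RFun 'I_n) :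
    B_rel (fgen (mk_Bgen (pullR k (fun_ad w) x : RFun 'I_m)) - fgen (mk_Bgen x)).

Definition Bcar : zmodType := pres B_rel.

Definition clsB (N : finType) (x : RFun N) : Bcar :=
  gen B_rel (mk_Bgen (pullR k (fun_ad (enum_iso N)) x)).

Definition piB (N : finType) (F : {ffun Y N -> X}) : Bcar := clsB (clsR (pi_repr F)).

Definition degB (d : nat) : Bcar -> Prop :=
  zspan (fun b => exists (N : finType) (x : RFun N), #|N| = d /\ b = clsB x).

Definition mulB : {additive tensor Bcar Bcar -> Bcar} :=
  the_additive (fun phi =>
    forall (K L : finType) (FK : {ffun Y K -> X}) (FL : {ffun Y L -> X}),
    phi (piB FK ⊗ piB FL) = piB (fjoin (htriv X) FK FL)).

Definition algB : graded_algebra := GradedAlgebra degB (piB empty_fun) mulB.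

Definition epsB : {additive algB -> int} :=
  the_additive (fun phi =>
    phi (piB empty_fun) = 1 /\
    forall (N : finType) (F : {ffun Y N -> X}), #|N| != 0%N -> phi (piB F) = 0).

Definition DeltaB : {additive algB -> tensor algB algB} :=
  the_additive (fun phi => forall (N : finType) (F : {ffun Y N -> X}),
    phi (piB F) =
    \sum_(K : {set N})
      (piB (frestr F K) ⊗ piB (frestr F (~: K)))
        *+ (\prod_(y in ~: yset2 Y K) hdim (F y))).

Definition supp (N : finType) (F : {ffun Y N -> X}) : {set Y N} :=
  [set y | F y != htriv X].

Definition deltaB : {additive algB -> tensor algB algB} :=
  the_additive (fun phi => forall (N : finType) (F : {ffun Y N -> X}),
    phi (piB F) =
    \sum_(K : {set N} | supp F \subset yset2 Y K)
      piB (frestr F K) ⊗ piB (frestr F (~: K))).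

Definition coloring : choiceType := {n : nat & {ffun Y 'I_n -> X}}.
Definition RAut (N : finType) (F : {ffun Y N -> X}) : zmodType := Rgrp k (AutF F).

Definition Mgen : choiceType := {c : coloring & RAut (tagged c)}.
Definition mk_Mgen n (F : {ffun Y 'I_n -> X}) (x : RAut F) : Mgen :=
  existT (fun c : coloring => RAut (tagged c)) (existT _ n F) x.

(* As for B, with a generator (n, F, x) for every x in R(Aut F). *)
Variant M_rel : {freeg Mgen} -> Prop :=
| MAdd n (F : {ffun Y 'I_n -> X}) (x y : RAut F) :
    M_rel (fgen (mk_Mgen (x + y)) - fgen (mk_Mgen x) - fgen (mk_Mgen y))
| MAd n m (w : fiso 'I_n 'I_m) (F : {ffun Y 'I_n -> X}) (x : RAut F) :
    M_rel (fgen (mk_Mgen (pullR k (aut_ad w F) x : RAut (transp w F)))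
           - fgen (mk_Mgen x)).

Definition Mcar : zmodType := pres M_rel.

Definition clsM (N : finType) (F : {ffun Y N -> X}) (x : RAut F) : Mcar :=
  gen M_rel (mk_Mgen (pullR k (aut_ad (enum_iso N) F) x : RAut (transp (enum_iso N) F))).

Definition degM (d : nat) : Mcar -> Prop :=
  zspan (fun b => exists (N : finType) (F : {ffun Y N -> X}) (x : RAut F),
                   #|N| = d /\ b = clsM x).

Definition mulM : {additive tensor Mcar Mcar -> Mcar} :=
  the_additive (fun phi =>
    forall (K L : finType) (FK : {ffun Y K -> X}) (FL : {ffun Y L -> X})
      m (V : mx_representation k (AutF FK) m)
      n (W : mx_representation k (AutF FL) n),
    phi (clsM (clsR V) ⊗ clsM (clsR W)) =
    @clsM _ (fjoin (htriv X) FK FL)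
      (clsR (ind_repr (@aut_sum_inj _ _ (htriv X) _ _ FK FL) (box_repr V W)))).

Definition algM : graded_algebra :=
  GradedAlgebra degM (@clsM _ empty_fun (clsR (triv_repr k (AutF empty_fun)))) mulM.

Definition epsM : {additive algM -> int} :=
  the_additive (fun phi =>
    phi (@clsM _ empty_fun (clsR (triv_repr k (AutF empty_fun)))) = 1 /\
    forall (N : finType) (F : {ffun Y N -> X}) (x : RAut F),
      #|N| != 0%N -> phi (clsM x) = 0).

Definition res_stab (N : finType) (F : {ffun Y N -> X}) (K : {set N})
    n (V : mx_representation k (AutF F) n) : mx_representation k (aut_stab F K) n :=
  subg_repr V (subsetIl (AutF F) 'N(K | 'P)).

(* Element of M ⊗ M defined by a representation W of (Aut F)_K: W is induced to
   A_K, and its class is viewed in R(Aut F|_{Y_K}) ⊗ R(Aut F|_{Y_{K^c}}). *)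
Definition ind_stab (N : finType) (F : {ffun Y N -> X}) (K : {set N})
    n (W : mx_representation k (aut_stab F K) n) : tensor Mcar Mcar :=
  tensor_map (@clsM _ (frestr F K)) (@clsM _ (frestr F (~: K)))
    (unboxR k _ _ (clsR (ind_repr (@aut_restr_inj _ _ _ F K) W))).

Definition orbit_reps (N : finType) (F : {ffun Y N -> X}) : {set {set N}} :=
  orbit_transversal 'P^* (AutF F) [set: {set N}].

Definition DeltaM : {additive algM -> tensor algM algM} :=
  the_additive (fun phi => forall (N : finType) (F : {ffun Y N -> X})
      n (V : mx_representation k (AutF F) n),
    phi (clsM (clsR V)) =
    \sum_(K in orbit_reps F) ind_stab (prod_repr (res_stab K V) (tperm_repr F K))).

Definition deltaM : {additive algM -> tensor algM algM} :=
  the_additive (fun phi => forall (N : finType) (F : {ffun Y N -> X})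
      n (V : mx_representation k (AutF F) n),
    phi (clsM (clsR V)) =
    \sum_(K in orbit_reps F | supp F \subset yset2 Y K) ind_stab (res_stab K V)).

Definition regBM : {additive algB -> algM} :=
  the_additive (fun phi => forall (N : finType) (F : {ffun Y N -> X}),
    phi (piB F) = @clsM _ F (clsR (regular_repr k (AutF F)))).

End Algebras.

(* Main.v *)
From HB Require Import structures.
From mathcomp Require Import all_boot all_order all_fingroup all_algebra all_character.
From mathcomp Require Import all_solvable boolp freeg ring.
Require Import Defs.

Set Implicit Arguments.
Unset Strict Implicit.
Unset Printing Implicit Defensive.

Import GRing.Theory.
Local Open Scope ring_scope.

(** Everything is reduced to characters. Over an algebraically closed field of
    characteristic 0 the irreducible representations form a basis of R(G)
    (matrix_units_basis), and a class in R(G) is determined by its character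
    (charR_inj). Both follow from the existence of matrix units: elements of the group
    algebra that act on the irreducible V_i as the elementary matrices and on
    the other irreducibles by zero. Schur orthogonality provides them, and products of
    matrix units are matrix units for a product of groups; thus the external products
    are a basis of R(G1 x G2) (kron_units) and the pi_F one of R(Fun(Y_N, H))
    (pi_units). An operation on representations whose effect on characters is additive
    extends to R(G) (charR_lift). This covers external products, restriction, twisting
    by a fixed representation and, by Frobenius' formula, induction.

    Call a function F from Y_N to the set X of irreducible representations of H a
    colouring of N. As the pi_F are bases, B is free on the isomorphism classes of
    colourings (B_lift, B_free), so its structure maps are determined by, and can be
    prescribed on, colourings. Both coproducts of B are of the form
      D pi_F = sum_K (prod_y phi(F y)) pi_{F|K} ⊗ pi_{F|K^c},
    where y runs over the complement of Y_{K, K^c} and phi is a function with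
    phi(triv) = 1: the dimension for DeltaB, the indicator function of triv for deltaB.
    For every such phi one gets a graded Hopf algebra (coproduct_hopf). The two sides of
    coassociativity are sums over ordered partitions of N in three pieces P, Q, R,
    weighted by the product of phi(F y) over the y outside Y_P, Y_Q and Y_R;
    multiplicativity holds since a subset of K + L is a pair of subsets, and a join is
    trivial outside Y_K and Y_L; the antipode is constructed by recursion on the degree.

    A map out of M is a family of additive maps on the R(Aut F) that is compatible with
    isomorphisms of colourings (M_lift). The product and coproducts of M are of this
    kind, since induction is compatible with isomorphisms of groups (ind_transport) and
    the summand of K in a coproduct depends only on the orbit of K.

    The character of a regular representation is supported at the identity. So is then
    the character that results from restricting reg of Aut F to (Aut F)_K, twisting it by
    a representation Q and inducing to A_K; a comparison of degrees shows that the
    result is dim Q times the index of (Aut F)_K in Aut F times the regular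
    representation (indstab_regular). This index is the size of the orbit of K, so the
    sum over orbit representatives in the coproducts of M becomes the sum over all K in
    those of B (regBM_coproduct). Finally, the dimension defines a map from M to B that
    sends reg pi_F to #|Aut F| pi_F, and since B is free, reg is injective (regBM_inj). *)

(** * Presented abelian groups and tensor products *)

Section Span.
Variables (A : zmodType) (S : A -> Prop).

Lemma zspan_ind (P : A -> Prop) :
    P 0 -> (forall x y, P x -> P y -> P (x - y)) -> (forall s, S s -> P s) ->
  forall x, zspan S x -> P x.
Proof.
move=> P0 PB PS x hx.
have cl : zmod_closed (fun y => `[< P y >]).
  split=> [|y z /asboolP hy /asboolP hz]; apply/asboolP; first exact: P0.
  exact: PB.
pose G : zmodClosed A :=
  HB.pack (fun y => `[< P y >]) (GRing.isZmodClosed.Build _ _ cl).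
by apply/asboolP; apply: (hx G) => s /PS ?; apply/asboolP.
Qed.

Lemma zspan_base s : S s -> zspan S s.
Proof. by move=> Ss G; apply. Qed.

Lemma zspan0 : zspan S 0.
Proof. by move=> G _; rewrite rpred0. Qed.

Lemma zspanB x y : zspan S x -> zspan S y -> zspan S (x - y).
Proof. by move=> hx hy G hG; rewrite rpredB ?hx ?hy. Qed.

Lemma zspanN x : zspan S x -> zspan S (- x).
Proof. by move=> hx G hG; rewrite rpredN hx. Qed.

Lemma zspanMn x n : zspan S x -> zspan S (x *+ n).
Proof. by move=> hx G hG; rewrite rpredMn ?hx. Qed.

Lemma zspanMz x n : zspan S x -> zspan S (x *~ n).
Proof.
by move=> hx; case: n => n; [rewrite -pmulrn|rewrite NegzE mulrNz; apply: zspanN];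
  apply: zspanMn.
Qed.

Lemma zspan_sum I (r : seq I) (P : pred I) (F : I -> A) :
  (forall i, P i -> zspan S (F i)) -> zspan S (\sum_(i <- r | P i) F i).
Proof. by move=> h G hG; apply: rpred_sum => i /h; apply. Qed.

Lemma eq_on_zspan (C : zmodType) (f g : {additive A -> C}) :
  (forall s, S s -> f s = g s) -> forall x, zspan S x -> f x = g x.
Proof.
move=> e; apply: zspan_ind; rewrite ?raddf0 // => x y ex ey.
by rewrite !raddfB ex ey.
Qed.

End Span.

Lemma zspan_mono (A : zmodType) (S S' : A -> Prop) :
  (forall s, S s -> zspan S' s) -> forall x, zspan S x -> zspan S' x.
Proof. by move=> h x hx G hG; apply: hx => s Ss; apply: (h s Ss). Qed.

Section PresentationMaps.
Variables (T : choiceType) (R : {freeg T} -> Prop).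

Lemma pres_span x : zspan (fun y => exists t, y = gen R t) x.
Proof.
rewrite -[x]reprK -[generic_quotient.repr x]freeg_sumE raddf_sum.
apply: zspan_sum => t _ /=; set c := coeff _ _.
have -> : << c *g t >> = fgen t *~ c by rewrite /fgen freeg_mulz intz.
by rewrite raddfMz; apply: zspanMz; apply: zspan_base; exists t.
Qed.

Lemma pres_eqf (C : zmodType) (f g : {additive pres R -> C}) :
  (forall t, f (gen R t) = g (gen R t)) -> f =1 g.
Proof.
by move=> e x; apply: (eq_on_zspan _ (pres_span x)) => _ [t ->]; apply: e.
Qed.

End PresentationMaps.

Section TensorMaps.

Lemma tens_span (A B : zmodType) (x : tensor A B) :
  zspan (fun y => exists a b, y = a ⊗ b) x.
Proof.
by apply: zspan_mono (pres_span x) => _ [[a b] ->]; apply: zspan_base; exists a, b.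
Qed.

Lemma tens_eqf (A B C : zmodType) (f g : {additive tensor A B -> C}) :
  (forall a b, f (a ⊗ b) = g (a ⊗ b)) -> f =1 g.
Proof. by move=> e; apply: pres_eqf => -[a b]; apply: e. Qed.

Section OneSided.
Variables A B : zmodType.

Fact tensl_zmod (b : B) : zmod_morphism (fun a : A => a ⊗ b).
Proof.
by move=> a a'; apply/(canRL (addrK _)); rewrite -tensDl subrK.
Qed.
Fact tensr_zmod (a : A) : zmod_morphism (tens a : B -> tensor A B).
Proof.
by move=> b b'; apply/(canRL (addrK _)); rewrite -tensDr subrK.
Qed.
HB.instance Definition _ a := GRing.isZmodMorphism.Build _ _ (tens a : B -> _) (tensr_zmod a).
Definition tensl (b : B) (a : A) := a ⊗ b.
HB.instance Definition _ b := GRing.isZmodMorphism.Build _ _ (tensl b) (tensl_zmod b).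

Lemma tensMnl (a : A) (b : B) n : (a *+ n) ⊗ b = (a ⊗ b) *+ n.
Proof. exact: (raddfMn (tensl b)). Qed.
Lemma tensMnr (a : A) (b : B) n : a ⊗ (b *+ n) = (a ⊗ b) *+ n.
Proof. exact: (raddfMn (tens a)). Qed.
Lemma tensMzl (a : A) (b : B) n : (a *~ n) ⊗ b = (a ⊗ b) *~ n.
Proof. exact: (raddfMz (tensl b) n). Qed.
Lemma tensMzr (a : A) (b : B) n : a ⊗ (b *~ n) = (a ⊗ b) *~ n.
Proof. exact: (raddfMz (tens a) n). Qed.
Lemma tensBl (a a' : A) (b : B) : (a - a') ⊗ b = a ⊗ b - a' ⊗ b.
Proof. exact: (raddfB (tensl b)). Qed.
Lemma tens0l (b : B) : (0 : A) ⊗ b = 0.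
Proof. exact: (raddf0 (tensl b)). Qed.
Lemma tens0r (a : A) : a ⊗ (0 : B) = 0.
Proof. exact: (raddf0 (tens a)). Qed.
Lemma tens_suml I r (P : pred I) (F : I -> A) (b : B) :
  (\sum_(i <- r | P i) F i) ⊗ b = \sum_(i <- r | P i) (F i ⊗ b).
Proof. exact: (raddf_sum (tensl b)). Qed.
Lemma tens_sumr I r (P : pred I) (F : I -> B) (a : A) :
  a ⊗ (\sum_(i <- r | P i) F i) = \sum_(i <- r | P i) (a ⊗ F i).
Proof. exact: (raddf_sum (tens a)). Qed.
End OneSided.

(** The universal property, applied twice: for each a the map of (c, d) factors
    through tensor C D, and the result is additive in a since it is so on the
    generators c ⊗ d. *)
Lemma tensor_lift_curry (A B C D : zmodType) (L : C -> D -> {additive A -> B}) :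
    (forall c c' d a, L (c + c') d a = L c d a + L c' d a) ->
    (forall c d d' a, L c (d + d') a = L c d a + L c d' a) ->
  exists phi : {additive tensor A (tensor C D) -> B},
    forall a c d, phi (a ⊗ (c ⊗ d)) = L c d a.
Proof.
move=> LDl LDr.
have /choice [M ME] (a : A) : exists m : {additive tensor C D -> B},
    forall c d, m (c ⊗ d) = L c d a.
  by apply: tensor_lift => *; [apply: LDl|apply: LDr].
have [a a' t|a t t'|phi phiE] := @tensor_lift A (tensor C D) B (fun a t => M a t).
- move: t; apply: (@tens_eqf _ _ _ (M (a + a')) (M a \+ M a')) => c d /=.
  by rewrite !ME raddfD.
- by rewrite raddfD.
by exists phi => a c d; rewrite phiE ME.
Qed.

Variables A B C D : zmodType.

Lemma tensor_swapE a b : tensor_swap A B (a ⊗ b) = b ⊗ a.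
Proof.
move: a b; pose P (f : tensor A B -> tensor B A) := forall a b, f (a ⊗ b) = b ⊗ a.
apply: (@the_additiveP _ _ P).
by apply: (@tensor_lift _ _ _ (fun a b => b ⊗ a)) => *; rewrite (tensDl, tensDr).
Qed.

Lemma tensor_assocE a b c : tensor_assoc A B C (a ⊗ b ⊗ c) = a ⊗ (b ⊗ c).
Proof.
move: a b c; pose P (f : tensor (tensor A B) C -> tensor A (tensor B C)) :=
  forall a b c, f (a ⊗ b ⊗ c) = a ⊗ (b ⊗ c).
apply: (@the_additiveP _ _ P).
have /choice [M ME] (c : C) : exists m : {additive tensor A B -> tensor A (tensor B C)},
    forall a b, m (a ⊗ b) = a ⊗ (b ⊗ c).
  by apply: tensor_lift => *; rewrite !(tensDl, tensDr).
have [t t' c|t c c'|phi phiE] := @tensor_lift _ _ _ (fun t c => M c t).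
- by rewrite raddfD.
- move: t; apply: (@tens_eqf _ _ _ (M (c + c')) (M c \+ M c')) => a b /=.
  by rewrite !ME !tensDr.
by exists phi => a b c; rewrite phiE ME.
Qed.

End TensorMaps.

Lemma tensor_mulE (A : graded_algebra) (a b c d : A) :
  tensor_mul A ((a ⊗ b) ⊗ (c ⊗ d)) = amul (a ⊗ c) ⊗ amul (b ⊗ d).
Proof.
move: a b c d; pose P (f : tensor (tensor A A) (tensor A A) -> tensor A A) :=
  forall a b c d : A, f ((a ⊗ b) ⊗ (c ⊗ d)) = amul (a ⊗ c) ⊗ amul (b ⊗ d).
apply: (@the_additiveP _ _ P).
have /choice [L LE] (cd : A * A) : exists m : {additive tensor A A -> tensor A A},
    forall a b, m (a ⊗ b) = amul (a ⊗ cd.1) ⊗ amul (b ⊗ cd.2).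
  by apply: tensor_lift => *; rewrite tensDl raddfD !(tensDl, tensDr).
have [c c' d t|c d d' t|phi phiE] :=
  @tensor_lift_curry (tensor A A) (tensor A A) A A (fun c d => L (c, d)).
- move: t; apply: (@tens_eqf _ _ _ (L (c + c', d)) (L (c, d) \+ L (c', d))) => a b /=.
  by rewrite !LE /= tensDr raddfD tensDl.
- move: t; apply: (@tens_eqf _ _ _ (L (c, d + d')) (L (c, d) \+ L (c, d'))) => a b /=.
  by rewrite !LE /= tensDr raddfD tensDr.
by exists phi => a b c d; rewrite phiE LE.
Qed.

(** * Grothendieck groups and characters *)

Section RepresentationRing.
Variables (k : fieldType) (gT : finGroupType) (G : {group gT}).
Local Notation rep := (mx_representation k G).

Lemma clsR_iso n (V : rep n) m (W : rep m) : mx_rsim V W -> clsR V = clsR W.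
Proof. by move/GrothendieckIso/gen_rel; rewrite raddfB /= => /subr0_eq. Qed.

Lemma clsR_exact n (V : rep n) (U : 'M_n) (Umod : mxmodule V U) :
  clsR V = clsR (submod_repr Umod) + clsR (factmod_repr Umod).
Proof.
have := gen_rel (GrothendieckExact Umod); rewrite !raddfB /= => /eqP.
by rewrite subr_eq add0r subr_eq addrC => /eqP.
Qed.

Lemma clsR_dim0 n (V : rep n) : n = 0%N -> clsR V = 0.
Proof.
have iso0 m1 m2 (V1 : rep m1) (V2 : rep m2) : m1 = 0%N -> m2 = 0%N -> mx_rsim V1 V2.
  move=> e1 e2; subst m1 m2; exists 0 => // [|g _]; first by rewrite -row_leq_rank.
  by apply/matrixP => -[].
move=> n0; have mod0 : mxmodule V (0 : 'M_n) by apply/mxmoduleP => g _; rewrite mul0mx sub0mx.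
have r0 : \rank (cokermx (0 : 'M[k]_n)) = 0%N by rewrite mxrank_coker mxrank0 n0.
apply: (addrI (clsR V)); rewrite addr0 {3}(clsR_exact mod0); congr (_ + _); apply/clsR_iso/iso0 => //.
exact: mxrank0.
Qed.

Lemma R_lift (C : zmodType) (f : forall n, rep n -> C) :
    (forall n (V : rep n) m (W : rep m), mx_rsim V W -> f n V = f m W) ->
    (forall n (V : rep n) (U : 'M_n) (Umod : mxmodule V U),
       f n V = f _ (submod_repr Umod) + f _ (factmod_repr Umod)) ->
  exists phi : {additive Rgrp k G -> C}, forall n (V : rep n), phi (clsR V) = f n V.
Proof.
move=> fiso fex.
have [|phi phiE] := @pres_lift _ (@grothendieck_rel k gT G) C
   (fun V => f _ (projT2 V)); last by exists phi => n V; rewrite phiE.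
move=> g gE r; case=> [n V m W VW|n V U Umod]; rewrite !raddfB !gE /=.
  by rewrite (fiso _ _ _ _ VW) subrr.
by rewrite (fex _ _ _ Umod) addrAC addrK subrr.
Qed.

Lemma R_span (x : Rgrp k G) : zspan (fun y => exists n (V : rep n), y = clsR V) x.
Proof.
by apply: zspan_mono (pres_span x) => _ [[n V] ->]; apply: zspan_base; exists n, V.
Qed.

Lemma R_ind (P : Rgrp k G -> Prop) :
    P 0 -> (forall x y, P x -> P y -> P (x - y)) ->
    (forall n (V : rep n), P (clsR V)) ->
  forall x, P x.
Proof. by move=> P0 PB PV x; apply: zspan_ind (R_span x) => // _ [n [V ->]]. Qed.

Lemma R_eqf (C : zmodType) (f g : {additive Rgrp k G -> C}) :
  (forall n (V : rep n), f (clsR V) = g (clsR V)) -> f =1 g.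
Proof. by move=> e; apply: pres_eqf => -[n V]; apply: e. Qed.

(** For g outside G the trace of V g need not be additive on submodules and quotients,
    so charR g is only meaningful for g in G. *)
Definition charR (g : gT) : {additive Rgrp k G -> k} :=
  the_additive (fun phi => forall n (V : rep n), phi (clsR V) = \tr (V g)).

Lemma charRE g n (V : rep n) : g \in G -> charR g (clsR V) = \tr (V g).
Proof.
move=> gG; move: n V; pose P (f : Rgrp k G -> k) :=
  forall n (V : rep n), f (clsR V) = \tr (V g).
apply: (@the_additiveP _ _ P); apply: R_lift => [n V m W VW|n V U Umod].
  exact: mxtrace_rsim VW _ gG.
by rewrite mxtrace_sub_fact_mod.
Qed.

Lemma charRJ x g h : g \in G -> h \in G -> charR (h * g * h^-1)%g x = charR g x.
Proof.
move=> gG hG; move: x; apply: R_eqf => n V.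
rewrite !charRE ?groupM ?groupV // !repr_mxM ?groupM ?groupV //.
by rewrite mxtrace_mulC mulmxA -repr_mxM ?groupV // mulVg repr_mx1 mul1mx.
Qed.

(** How the element of the group algebra with coefficients a acts on V. *)
Definition gact n (V : rep n) (a : gT -> k) : 'M[k]_n := \sum_(g in G) a g *: V g.

Lemma gact_mulr n (V : rep n) a g : g \in G ->
  gact V a *m V g = gact V (fun h => a (h * g^-1)%g).
Proof.
move=> gG; rewrite /gact mulmx_suml (reindex_inj (mulIg g^-1%g)) /=.
apply: eq_big => [h|h hG]; first by rewrite groupMr ?groupV.
have hG' : h \in G by move: hG; rewrite groupMr ?groupV.
by rewrite -scalemxAl -repr_mxM // mulgKV.
Qed.

Lemma gact_tr n (V : rep n) a : \tr (gact V a) = \sum_(g in G) a g * charR g (clsR V).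
Proof.
by rewrite /gact raddf_sum; apply: eq_bigr => g gG /=; rewrite mxtraceZ charRE.
Qed.

Lemma gact_rsim n (V : rep n) m (W : rep m) (B : 'M_(n, m)) a :
    {in G, forall g, V g *m B = B *m W g} -> gact V a *m B = B *m gact W a.
Proof.
move=> hB; rewrite /gact mulmx_suml mulmx_sumr; apply: eq_bigr => g gG.
by rewrite -scalemxAl -scalemxAr hB.
Qed.

End RepresentationRing.

(** * Matrix units in group algebras *)

Lemma mx_entry_neq0 (F : fieldType) m n (A : 'M[F]_(m, n)) :
  A != 0 -> exists i j, A i j != 0.
Proof.
move=> nz; suff /existsP[[i j] /= h] : [exists p, A p.1 p.2 != 0] by exists i, j.
apply: contraNT nz; rewrite negb_exists => /forallP h.
by apply/eqP/matrixP => i j; have := h (i, j); rewrite negbK mxE => /eqP.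
Qed.

(** If A = C R is a full rank factorization of an idempotent, then R C = 1, and
    tr (C R) = tr (R C). *)
Lemma tr_idempotent (F : fieldType) n (A : 'M[F]_n) :
  A *m A = A -> \tr A = (\rank A)%:R.
Proof.
have split r (C : 'M[F]_(n, r)) (R : 'M_(r, n)) C' R' : C' *m C = 1%:M ->
    R *m R' = 1%:M -> (C *m R) *m (C *m R) = C *m R -> R *m C = 1%:M.
  move=> C'C RR' e; have := congr1 (fun B => C' *m B *m R') e.
  by rewrite /= -!mulmxA RR' !mulmx1 mulmxA C'C mul1mx.
move=> AA; have /row_fullP[C' C'C] := col_base_full A.
have /row_freeP[R' RR'] := row_base_free A.
by rewrite -{1}[A]mulmx_base mxtrace_mulC (split _ _ _ _ _ C'C RR') ?mxtrace1 ?mulmx_base.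
Qed.

Section Char0.
Variables (k : closedFieldType) (k0 : [pchar k] =i pred0).

Lemma char0_natr_eq0 n : (n%:R == 0 :> k) = (n == 0)%N.
Proof. by move/pcharf0P: k0. Qed.

Lemma char0_natr_inj : injective (fun n : nat => n%:R : k).
Proof.
have le m n : (m <= n)%N -> m%:R = n%:R :> k -> m = n.
  move=> mn /eqP; rewrite eq_sym -subr_eq0 -natrB // char0_natr_eq0 subn_eq0 => nm.
  by apply/eqP; rewrite eqn_leq mn nm.
by move=> m n e; case/orP: (leq_total m n) => h; [apply: le|apply/esym/le].
Qed.

Lemma char0_intr_eq0 (z : int) : (z%:~R == 0 :> k) = (z == 0).
Proof.
case: z => n; first by rewrite -pmulrn char0_natr_eq0.
by rewrite NegzE mulrNz oppr_eq0 -pmulrn char0_natr_eq0.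
Qed.

Section Units.
Variables (gT : finGroupType) (G : {group gT}).
Local Notation rep := (mx_representation k G).

(** Elements E i p q of the group algebra that are carried by V j to the matrix
    unit (p, q) if j = i and to 0 otherwise; the second field says that, for
    fixed p, the E i p q transform under right translation as the basis of V i
    does, and the third one that their diagonal elements sum to 1. Being a
    condition on coefficients, it passes to products of groups. *)
Record matrix_units (I : finType) (d : I -> nat) (V : forall i, rep (d i))
    (E : forall i, 'I_(d i) -> 'I_(d i) -> gT -> k) : Prop := MatrixUnits {
  mu_gt0 : forall i, (0 < d i)%N;
  mu_right : forall i p q g h, g \in G -> h \in G ->
    E i p q (h * g^-1)%g = \sum_l V i g q l * E i p l h;
  mu_sum : forall h, h \in G -> \sum_i \sum_p E i p p h = (h == 1%g)%:R;
  mu_val : forall i p q j r s, gact (V j) (E i p q) r s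
    = [&& i == j, p == r :> nat & q == s :> nat]%:R
}.

Section Decomposition.
Variables (I : finType) (d : I -> nat) (V : forall i, rep (d i)).
Variable E : forall i, 'I_(d i) -> 'I_(d i) -> gT -> k.
Hypothesis EP : matrix_units V E.

Let p0 i : 'I_(d i) := Ordinal (mu_gt0 EP i).

Let mu_mulg n (W : rep n) i p q g : g \in G ->
  gact W (E p q) *m W g = \sum_l V i g q l *: gact W (E p l).
Proof.
move=> gG; rewrite gact_mulr // /gact.
transitivity (\sum_(h in G) \sum_l (V i g q l * E p l h) *: W h).
  by apply: eq_bigr => h hG; rewrite (mu_right EP) // scaler_suml.
rewrite exchange_big; apply: eq_bigr => l _; rewrite scaler_sumr.
by apply: eq_bigr => h _; rewrite scalerA.
Qed.

Let mu_mul n (W : rep n) i p q j r s :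
  gact W (@E i p q) *m gact W (@E j r s)
  = ([&& j == i & r == q :> nat]%:R) *: gact W (@E i p (insubd q (val s))).
Proof.
rewrite {2}/gact mulmx_sumr.
transitivity (\sum_(g in G) \sum_l (E r s g * V i g q l) *: gact W (@E i p l)).
  apply: eq_bigr => g gG; rewrite -scalemxAr mu_mulg // scaler_sumr.
  by apply: eq_bigr => l _; rewrite scalerA.
rewrite exchange_big /=.
transitivity (\sum_l gact (V i) (E r s) q l *: gact W (@E i p l)).
  apply: eq_bigr => l _; rewrite -scaler_suml; congr (_ *: _).
  by rewrite /gact summxE; apply: eq_bigr => g _; rewrite mxE.
rewrite (bigD1 (insubd q (val s))) //= big1 ?addr0 => [|l lE].
  rewrite (mu_val EP); case: eqP => [e|_] //=.
  have sl : (val s < d i)%N by rewrite -e ltn_ord.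
  by rewrite val_insubd sl eqxx andbT.
rewrite (mu_val EP); case: eqP => [e|_] /=; last by rewrite scale0r.
have sl : (val s < d i)%N by rewrite -e ltn_ord.
have -> : (s == l :> nat) = false.
  apply/negP => /eqP sE; case/eqP: lE; apply: val_inj.
  by rewrite val_insubd sl; exact: esym.
by rewrite andbF scale0r.
Qed.

Let idem i n (W : rep n) :
  gact W (E (p0 i) (p0 i)) *m gact W (E (p0 i) (p0 i)) = gact W (E (p0 i) (p0 i)).
Proof.
rewrite mu_mul !eqxx scale1r; congr (gact _ (E _ _)); apply: val_inj.
by rewrite val_insubd ltn_ord.
Qed.

(** The sum of the diagonal units is the identity of the group algebra. *)
Lemma unit_neq0 n (W : rep n) : (0 < n)%N -> exists i p, gact W (@E i p p) != 0.
Proof.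
move=> n0; have e1 : \sum_i \sum_p gact W (@E i p p) = 1%:M.
  transitivity (\sum_(g in G) (\sum_i \sum_p @E i p p g) *: W g).
    rewrite (eq_bigr (fun i => \sum_(g in G) \sum_p @E i p p g *: W g)).
      rewrite exchange_big; apply: eq_bigr => g _ /=; rewrite scaler_suml.
      by apply: eq_bigr => i _; rewrite scaler_suml.
    by move=> i _; rewrite exchange_big.
  rewrite (bigD1 1%g) //= (mu_sum EP) // eqxx scale1r repr_mx1 big1 ?addr0 //.
  by move=> g /andP[gG /negPf g1]; rewrite (mu_sum EP) // g1 scale0r.
have : ~~ [forall i, forall p, gact W (@E i p p) == 0].
  apply/negP => /forallP h; suff: 1%:M = 0 :> 'M[k]_n.
    by move/matrixP/(_ (Ordinal n0) (Ordinal n0)); rewrite !mxE /= => /eqP; rewrite oner_eq0.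
  rewrite -e1; apply: big1 => i _; apply: big1 => p _.
  by apply/eqP; move/forallP: (h i) => /(_ p).
by rewrite negb_forall => /existsP[i]; rewrite negb_forall => /existsP[p]; exists i, p.
Qed.

(** For a row v of W(E p p), the vectors v E(p, q) transform under the group as the
    basis of V i does, so they define a homomorphism from V i. It is injective if
    v <> 0, because the E(q, p) move any nonzero coordinate to position p. *)
Lemma unit_hom n (W : rep n) i p : gact W (@E i p p) != 0 ->
  exists2 B : 'M_(d i, n), row_free B & {in G, forall g, V i g *m B = B *m W g}.
Proof.
move=> nz.
have [r [s nzrs]] := mx_entry_neq0 nz.
pose B : 'M_(d i, n) := \matrix_(q, t) gact W (E p q) r t.
have Brow q : row q B = row r (gact W (E p q)) by apply/rowP => t; rewrite !mxE.
have Bhom : {in G, forall g, V i g *m B = B *m W g}.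
  move=> g gG; apply/row_matrixP => q; rewrite [RHS]row_mul Brow -[RHS]row_mul mu_mulg //.
  apply/rowP => t; rewrite !mxE summxE; apply: eq_bigr => l _.
  by rewrite !mxE.
exists B => //; apply/row_freeP/row_freeP; rewrite -kermx_eq0.
apply/negPn/negP => /rowV0Pn[u /sub_kermxP uB nzu].
have [z [q uq]] := mx_entry_neq0 nzu; rewrite [z]ord1 in uq.
have : u *m gact (V i) (E q p) *m B = 0.
  by rewrite -mulmxA (gact_rsim _ Bhom) mulmxA uB mul0mx.
have -> : u *m gact (V i) (E q p) = u 0 q *: delta_mx 0 p.
  apply/rowP => l; rewrite !mxE (bigD1 q) //= big1 ?addr0 => [|j jq].
    by rewrite (mu_val EP) !eqxx /= eq_sym.
  by rewrite (mu_val EP) eqxx /= [_ == _](negPf _) ?mulr0 // eq_sym.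
rewrite -scalemxAl -rowE Brow => /rowP/(_ s); rewrite !mxE => /eqP.
by rewrite mulf_eq0 (negPf uq) (negPf nzrs).
Qed.

(** The rank of an idempotent is its trace, a combination of character values; hence
    it is additive in W and takes integral values at the same time. *)
Lemma R_rank (e : gT -> k) :
    (forall n (W : rep n), gact W e *m gact W e = gact W e) ->
  exists r : {additive Rgrp k G -> int},
    (forall n (W : rep n), r (clsR W) = (\rank (gact W e))%:R) /\
    forall x, (r x)%:~R = \sum_(g in G) e g * charR k G g x.
Proof.
move=> ee.
have trE n (W : rep n) : (\rank (gact W e))%:R = \sum_(g in G) e g * charR k G g (clsR W).
  by rewrite -gact_tr tr_idempotent.
have rkinj (m n : nat) : m%:R = n%:R :> k -> m%:R = n%:R :> int.
  by move/char0_natr_inj => ->.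
have [n W m W' WW'|n W U Umod|r rE] :=
  @R_lift k gT G int (fun n W => (\rank (gact W e))%:R).
- by apply: rkinj; rewrite !trE (clsR_iso WW').
- rewrite -natrD; apply: rkinj; rewrite natrD !trE (clsR_exact Umod) -big_split /=.
  by apply: eq_bigr => g _; rewrite raddfD mulrDr.
exists r; split=> //; elim/R_ind=> [|x y ex ey|n W].
- by rewrite raddf0 mulr0z big1 // => g _; rewrite raddf0 mulr0.
- rewrite raddfB rmorphB /= ex ey -sumrB; apply: eq_bigr => g _.
  by rewrite raddfB mulrBr.
by rewrite rE -trE rmorph_nat.
Qed.

(** The multiplicity of V i in W is the rank of the idempotent W(E i 0 0), which is
    additive in W since it equals the trace (R_rank). That W is the sum of the
    V i with these multiplicities is shown by induction on the dimension: a
    nonzero W contains some V i by unit_hom, and both sides are additive. *)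
Theorem matrix_units_basis :
  exists m : I -> {additive Rgrp k G -> int},
    [/\ forall i j, m i (clsR (V j)) = (i == j)%:R,
        forall x, x = \sum_i clsR (V i) *~ m i x
      & exists e : I -> gT -> k, forall i x,
          (m i x)%:~R = \sum_(g in G) e i g * charR k G g x].
Proof.
have /choice [m mP] i := R_rank (fun n W => idem i W).
have mE i n (W : rep n) : m i (clsR W) = (\rank (gact W (E (p0 i) (p0 i))))%:R.
  by case: (mP i) => ->.
have mV i j : m i (clsR (V j)) = (i == j)%:R.
  have inj0 (z : int) t : z%:~R = t%:~R :> k -> z = t.
    by move/eqP; rewrite -subr_eq0 -rmorphB char0_intr_eq0 subr_eq0 => /eqP.
  apply: inj0; case: (mP i) => _ ->; rewrite -gact_tr /mxtrace.
  under eq_bigr do rewrite (mu_val EP).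
  have [<-|] /= := eqVneq i j; last by rewrite big1.
  rewrite (bigD1 (p0 i)) //= big1 ?addr0 // => l lp; case: eqP => // l0.
  by case/eqP: lp; apply: val_inj.
exists m; split=> //; last first.
  by exists (fun i => E (p0 i) (p0 i)) => i x; case: (mP i).
elim/R_ind=> [|x y ex ey|n W].
- by rewrite big1 // => i _; rewrite raddf0 mulr0z.
- rewrite {1}ex {1}ey -sumrB; apply: eq_bigr => i _.
  by rewrite raddfB mulrzBr.
have [n' nn'] := ubnP n; elim: n' => // n' IH in n W nn' *.
have [n0|n0] := posnP n.
  rewrite clsR_dim0 // big1 // => i _.
  by rewrite raddf0 mulr0z.
have [i [p /unit_hom[B Bfree Bhom]]] := unit_neq0 W n0.
pose U := <<B>>%MS; have UB : (U :=: B)%MS := genmxE B.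
have Umod : mxmodule W U.
  rewrite (eqmx_module _ UB); apply/mxmoduleP => g gG.
  by rewrite -Bhom // submxMl.
have sim : mx_rsim (V i) (submod_repr Umod).
  exists (in_submod U B); first by rewrite UB (eqP Bfree).
    rewrite /row_free -[X in _ == X](eqP Bfree) -{2}[B](in_submodK (U := U)) ?UB //.
    by rewrite /val_submod /= mxrankMfree ?row_base_free.
  by move=> g gG; rewrite -in_submodJ ?UB // -Bhom // in_submodE mulmxA -in_submodE.
rewrite (clsR_exact Umod) -(clsR_iso sim).
have dimU : \rank U = d i by rewrite UB (eqP Bfree).
rewrite {1}(IH _ (factmod_repr Umod)); last first.
  rewrite mxrank_coker dimU; apply: leq_trans _ (nn' : (n <= n')%N).
  have di := mu_gt0 EP i; have := rank_leq_row U; rewrite dimU => din.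
  by rewrite ltn_subrL di (leq_trans di din).
have -> : clsR (V i) = \sum_j clsR (V j) *~ m j (clsR (V i)).
  rewrite (bigD1 i) //= mV eqxx big1 ?addr0 // => j ji.
  by rewrite mV (negPf ji).
rewrite -big_split; apply: eq_bigr => j _ /=.
rewrite -mulrzDr; congr (_ *~ _); rewrite -raddfD; congr (m j (_ + _)).
rewrite [RHS](bigD1 i) //= mV eqxx big1 ?addr0 // => j' ji.
by rewrite mV (negPf ji).
Qed.

End Decomposition.
End Units.
End Char0.

(** * Schur orthogonality and injectivity of the character *)

Lemma mulmx_delta_mulmx (R : nzRingType) m n m' n' (A : 'M[R]_(m, n))
    (B : 'M_(m', n')) p r q s : (A *m delta_mx p r *m B) q s = A q p * B r s.
Proof.
rewrite mxE (bigD1 r) //= big1 ?addr0 => [|l lr]; rewrite mxE (bigD1 p) //= big1 ?addr0.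
- by rewrite mxE !eqxx mulr1.
- by move=> j jp; rewrite mxE (negPf jp) mulr0.
- by rewrite mxE (negPf lr) andbF mulr0 mul0r.
by move=> j jp; rewrite mxE (negPf jp) mulr0.
Qed.

(** Schur's lemma. *)
Lemma intertwiner_rsim (F : fieldType) (gT : finGroupType) (G : {group gT}) n m
    (V : mx_representation F G n) (W : mx_representation F G m) (S : 'M_(n, m)) :
    mx_irreducible V -> mx_irreducible W ->
    {in G, forall g, V g *m S = S *m W g} -> S != 0 ->
  mx_rsim V W.
Proof.
move=> /mx_irrP[n0 Virr] /mx_irrP[m0 Wirr] hS nzS.
have Sfree : row_free S.
  rewrite -kermx_eq0; apply: contraNT nzS => /Virr h.
  have /h : mxmodule V (kermx S).
    apply/mxmoduleP => g gG; apply/sub_kermxP.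
    by rewrite -mulmxA hS // mulmxA mulmx_ker mul0mx.
  by rewrite -sub1mx => /sub_kermxP; rewrite mul1mx => ->.
have Sfull : row_full S.
  have Smod : mxmodule W <<S>>%MS.
    rewrite (eqmx_module _ (genmxE S)); apply/mxmoduleP => g gG.
    by rewrite -hS // submxMl.
  have : row_full <<S>>%MS by apply: Wirr; rewrite // -mxrank_eq0 genmxE mxrank_eq0.
  by rewrite -!sub1mx genmxE.
by exists S => //; rewrite -(eqP Sfree) (eqP Sfull).
Qed.

Lemma mxtrace_regular_repr (F : fieldType) (gT : finGroupType) (G : {group gT}) g :
  g \in G -> \tr (regular_repr F G g) = if g == 1%g then #|G|%:R else 0.
Proof.
move=> gG; case: eqP => [->|g1]; first by rewrite repr_mx1 mxtrace1.
rewrite /mxtrace big1 // => i _; rewrite /= !mxE eqxx /=.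
case: eqP => // /(congr1 enum_val); rewrite gring_indexK ?groupM ?enum_valP //.
by move/(congr1 (mulg (enum_val i)^-1)); rewrite mulKg mulVg => /esym.
Qed.

Section IrreducibleUnits.
Variables (k : closedFieldType) (k0 : [pchar k] =i pred0).
Variables (gT : finGroupType) (G : {group gT}).
Local Notation rep := (mx_representation k G).

Lemma char0_pgroup : ([pchar k]^'.-group G)%g.
Proof. by apply/pgroupP => p _ _; rewrite inE /= k0. Qed.

Lemma cardG_neq0 : #|G|%:R != 0 :> k.
Proof. by rewrite (char0_natr_eq0 k0) -lt0n cardG_gt0. Qed.

Section Family.
Variables (I : finType) (d : I -> nat) (V : forall i, rep (d i)).
Hypothesis Virr : forall i, mx_irreducible (V i).
Hypothesis Vinj : forall i j, mx_rsim (V i) (V j) -> i = j.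
Hypothesis Vall : forall n (W : rep n), mx_irreducible W -> exists i, mx_rsim W (V i).

Let d_gt0 i : (0 < d i)%N.
Proof. by case/mx_irrP: (Virr i). Qed.

(** By Schur orthogonality the matrix coefficients of the inverse, scaled in this way,
    act as matrix units. *)
Definition irr_unit i (p q : 'I_(d i)) (g : gT) : k :=
  (d i)%:R / #|G|%:R * V i g^-1%g q p.

Let avg i j (M : 'M_(d i, d j)) : 'M_(d i, d j) :=
  \sum_(g in G) V i g^-1%g *m M *m V j g.

Let avg_hom i j (M : 'M_(d i, d j)) :
  {in G, forall g, V i g *m avg M = avg M *m V j g}.
Proof.
move=> g gG; rewrite /avg mulmx_sumr mulmx_suml (reindex_inj (mulIg g)) /=.
apply: eq_big => [h|h]; first by rewrite groupMr.
rewrite groupMr // => hG; rewrite invMg !repr_mxM ?groupV // !mulmxA.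
by rewrite -[V i g *m _]repr_mxM ?groupV // mulgV repr_mx1 mul1mx.
Qed.

(* Averaging over G gives an intertwiner, which is scalar or zero by Schur's lemma;
   the scalar is found by taking the trace. *)
Let avg_val i j (p : 'I_(d i)) (r : 'I_(d j)) : exists2 c : k, (i = j -> c * (d i)%:R = #|G|%:R * (p == r :> nat)%:R) &
  forall q s, avg (delta_mx p r : 'M_(d i, d j)) q s
    = if (i == j) && (q == s :> nat) then c else 0.
Proof.
have [e|ne] := eqVneq i j; last first.
  exists 0 => [/eqP|q s]; first by rewrite (negPf ne).
  have -> : avg (delta_mx p r : 'M_(d i, d j)) = 0.
    apply/eqP; apply: contraNT ne => nz; apply/eqP/Vinj.
    exact: intertwiner_rsim (avg_hom _) nz.
  by rewrite mxE.
subst j; have := avg_hom (delta_mx p r); set S := avg _ => Shom.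
have /is_scalar_mxP[c Sc] : is_scalar_mx S.
  apply: (mx_abs_irr_cent_scalar (group_closure_closed_field (Virr i))).
  by apply/centgmxP => g /Shom.
exists c => [_|q s]; last by rewrite Sc mxE; case: (q =P s) => [->|/eqP/negPf]; rewrite ?eqxx // -val_eqE => ->.
have := mxtrace_scalar (d i) c; rewrite -Sc mulr_natr => <-.
rewrite /S /avg raddf_sum /= (eq_bigr (fun=> (p == r)%:R)) => [|g gG].
  by rewrite sumr_const mulr_natl.
rewrite mxtrace_mulC mulmxA -repr_mxM ?groupV // mulgV repr_mx1 mul1mx.
rewrite /mxtrace (bigD1 p) //= mxE eqxx big1 ?addr0 // => l lp.
by rewrite mxE (negPf lp).
Qed.

(* V i occurs d i times in the regular representation. *)
Let irr_sum h : h \in G ->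
  \sum_i \tr (V i h) *+ d i = if h == 1%g then #|G|%:R else 0.
Proof.
move=> hG; rewrite -(mxtrace_regular_repr k hG).
pose sG : irrType k G := DecSocleType (regular_repr k G).
have sp : group_splitting_field k G by apply: group_closure_closed_field.
have F'G := char0_pgroup.
rewrite (mxtrace_regular_pchar sG F'G sp hG).
have cP i := rsim_irr_comp_pchar sG F'G (Virr i).
have c_inj : injective (fun i => irr_comp sG (V i)).
  move=> i j e; apply: Vinj; have := cP j; rewrite -e => /mx_rsim_sym.
  exact: mx_rsim_trans (cP i).
have c_surj j : exists i, irr_comp sG (V i) == j.
  have [i hi] := Vall (socle_irr j : mx_irreducible (irr_repr j)); exists i; apply/eqP.
  by rewrite -(irr_comp_rsim_pchar sG F'G hi) (irr_reprK_pchar F'G).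
pose b j := xchoose (c_surj j).
have bK : cancel b (fun i => irr_comp sG (V i)).
  by move=> j; apply/eqP; exact: (xchooseP (c_surj j)).
rewrite (reindex (fun i => irr_comp sG (V i))) /=.
  apply: eq_bigr => i _; rewrite (mxtrace_rsim (cP i) hG).
  by congr (_ *+ _); case: (cP i).
by exists b => [i _|j _]; [apply: c_inj; rewrite bK|apply: bK].
Qed.

Lemma irr_matrix_units : matrix_units V irr_unit.
Proof.
split=> // [i p q g h gG hG|h hG|i p q j r s].
- rewrite /irr_unit invMg invgK repr_mxM ?groupV // mxE mulr_sumr.
  by apply: eq_bigr => l _; rewrite mulrCA.
- rewrite -[h == 1%g]invg_eq1.
  rewrite /irr_unit.
  transitivity (#|G|%:R^-1 * \sum_i \tr (V i h^-1%g) *+ d i).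
    rewrite mulr_sumr; apply: eq_bigr => i _; rewrite -mulr_sumr.
    by rewrite -[\tr _ *+ _]mulr_natl mulrA [_^-1 * _]mulrC.
  rewrite irr_sum ?groupV //; case: eqP => _; last by rewrite mulr0.
  by rewrite mulVf // cardG_neq0.
have [c cE avgE] := @avg_val i j p r.
transitivity ((d i)%:R / #|G|%:R * avg (delta_mx p r : 'M_(d i, d j)) q s).
  rewrite /gact /avg !summxE mulr_sumr; apply: eq_bigr => g gG.
  by rewrite mulmx_delta_mulmx mxE /irr_unit !mulrA.
rewrite avgE; case: eqP => [/cE ce|_] /=; last by rewrite mulr0.
case: eqP => _; last by rewrite andbF mulr0.
by rewrite mulrAC [_ * c]mulrC ce mulrAC mulfV ?mul1r ?andbT ?cardG_neq0.
Qed.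

End Family.

(** The irreducible constituents of the regular representation. *)
Theorem irr_basis : exists (I : finType) (d : I -> nat) (V : forall i, rep (d i))
  (E : forall i, 'I_(d i) -> 'I_(d i) -> gT -> k), matrix_units V E.
Proof.
pose sG : irrType k G := DecSocleType (regular_repr k G).
exists sG, _, (@irr_repr _ _ _ sG), (irr_unit (@irr_repr _ _ _ sG)).
have F'G := char0_pgroup.
apply: irr_matrix_units => [i|i j /(irr_comp_rsim_pchar sG F'G)|n W irrW].
- exact: socle_irr.
- by rewrite !irr_reprK_pchar.
by exists (irr_comp sG W); apply: rsim_irr_comp_pchar.
Qed.

(** The coordinates in the basis of irreducible representations are integers, and as
    elements of k they are read off from the character; k has characteristic 0. *)
Theorem charR_inj (x y : Rgrp k G) :
  (forall g, g \in G -> charR k G g x = charR k G g y) -> x = y.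
Proof.
move=> e; have [I [d [V [E /(matrix_units_basis k0)[m [_ mE [u uE]]]]]]] := irr_basis.
rewrite (mE x) (mE y); apply: eq_bigr => i _; congr (_ *~ _).
apply/eqP; rewrite -subr_eq0 -(char0_intr_eq0 k0) rmorphB /= !uE subr_eq0; apply/eqP.
by apply: eq_bigr => g /e ->.
Qed.

End IrreducibleUnits.

(** Exactness of an operation on representations need not be checked on modules: since
    classes are determined by characters, it is enough that the character of the
    result is given by a formula t that is additive in the argument. *)
Lemma charR_lift (k : closedFieldType) (k0 : [pchar k] =i pred0)
    (gT rT : finGroupType) (G : {group gT}) (D : {group rT})
    (T : forall n, mx_representation k G n -> Rgrp k D) (t : rT -> Rgrp k G -> k) :
    (forall g x y, t g (x + y) = t g x + t g y) ->
    (forall g, g \in D -> forall n (V : mx_representation k G n),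
       charR k D g (T n V) = t g (clsR V)) ->
  exists phi : {additive Rgrp k G -> Rgrp k D},
    forall n (V : mx_representation k G n), phi (clsR V) = T n V.
Proof.
move=> tD Tt; apply: R_lift => [n V m W VW|n V U Umod]; apply: (charR_inj k0) => g gD.
  by rewrite !Tt // (clsR_iso VW).
by rewrite raddfD !Tt // (clsR_exact Umod) tD.
Qed.

(** * Irreducible representations of products and powers of groups *)

Lemma prodr_nat_bool (R : comNzRingType) (I : finType) (b : pred I) :
  \prod_i (b i)%:R = [forall i, b i]%:R :> R.
Proof.
have [/forallP h|] := boolP [forall i, b i]; first by rewrite big1 // => i _; rewrite h.
by rewrite negb_forall => /existsP[i /negPf bi]; rewrite (bigD1 i) //= bi mul0r.
Qed.

Section ProductUnits.
Variables (k : closedFieldType) (k0 : [pchar k] =i pred0).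

Section Box.
Variables (gT1 gT2 : finGroupType) (G1 : {group gT1}) (G2 : {group gT2}).
Local Notation G := (setX_group G1 G2).

(** The tensor product of matrices, with rows and columns indexed by pairs. Its
    entries are products of entries, so that conditions on matrix units can be
    checked factor by factor; it is isomorphic to the block-indexed tensor
    product of box_repr by equality of characters. *)
Definition kron_mx m n (A : 'M[k]_m) (B : 'M[k]_n) : 'M[k]_#|{: 'I_m * 'I_n}| :=
  \matrix_(p, q) (A (enum_val p).1 (enum_val q).1 * B (enum_val p).2 (enum_val q).2).

Lemma big_pair_ord m n (f : 'I_m * 'I_n -> k) :
  \sum_(p < #|{: 'I_m * 'I_n}|) f (enum_val p) = \sum_i \sum_j f (i, j).
Proof.
rewrite -(big_enum_val (fun p => f p)) pair_big /=.
by apply: eq_big => [[i j]|[i j] _].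
Qed.

Lemma kron_mx_repr n1 n2 (V : mx_representation k G1 n1) (W : mx_representation k G2 n2) :
  mx_repr G (fun g => kron_mx (V g.1) (W g.2)).
Proof.
split=> [|[g1 g2] [h1 h2] /setXP[g1G g2G] /setXP[h1G h2G]]; apply/matrixP => p q.
  rewrite !mxE !repr_mx1 !mxE -natrM mulnb -(inj_eq enum_val_inj).
  by case: (enum_val p) (enum_val q) => [a b] [c e].
rewrite !mxE /= !repr_mxM // !mxE big_distrlr /= -(big_pair_ord (fun l => V g1 (enum_val p).1 l.1 *
  V h1 l.1 (enum_val q).1 * (W g2 (enum_val p).2 l.2 * W h2 l.2 (enum_val q).2))).
by apply: eq_bigr => l _; rewrite !mxE mulrACA.
Qed.
Definition kron_repr n1 n2 (V : mx_representation k G1 n1) (W : mx_representation k G2 n2) :=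
  MxRepresentation (kron_mx_repr V W).

Lemma tr_kron m n (A : 'M[k]_m) (B : 'M[k]_n) : \tr (kron_mx A B) = \tr A * \tr B.
Proof.
rewrite /mxtrace big_distrlr /= -(big_pair_ord (fun l => A l.1 l.1 * B l.2 l.2)).
by apply: eq_bigr => l _; rewrite mxE.
Qed.

Lemma clsR_box n1 n2 (V : mx_representation k G1 n1) (W : mx_representation k G2 n2) :
  clsR (box_repr V W) = clsR (kron_repr V W).
Proof.
by apply: (charR_inj k0) => g gG; rewrite !charRE //= mxtrace_prod tr_kron.
Qed.

Variables (I1 I2 : finType) (d1 : I1 -> nat) (d2 : I2 -> nat).
Variables (V1 : forall i, mx_representation k G1 (d1 i)).
Variables (V2 : forall i, mx_representation k G2 (d2 i)).
Variables (E1 : forall i, 'I_(d1 i) -> 'I_(d1 i) -> gT1 -> k).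
Variables (E2 : forall i, 'I_(d2 i) -> 'I_(d2 i) -> gT2 -> k).
Hypothesis (EP1 : matrix_units V1 E1) (EP2 : matrix_units V2 E2).

(** Through matrix_units_basis, this is what makes the external products of irreducibles
    of G1 and G2 a basis of R(G1 x G2). *)
Lemma kron_units : matrix_units (fun ij : I1 * I2 => kron_repr (V1 ij.1) (V2 ij.2))
  (fun ij p q g => E1 (enum_val p).1 (enum_val q).1 g.1
                   * E2 (enum_val p).2 (enum_val q).2 g.2).
Proof.
split=> [[i j]|[i j] p q [g1 g2] [h1 h2] /setXP[g1G g2G] /setXP[h1G h2G]|[h1 h2] /setXP[h1G h2G]|].
- rewrite card_prod !card_ord muln_gt0 (mu_gt0 EP1) (mu_gt0 EP2) //.
- rewrite /= (mu_right EP1) // (mu_right EP2) // big_distrlr /=.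
  rewrite -(big_pair_ord (fun l => V1 i g1 (enum_val q).1 l.1 * E1 (enum_val p).1 l.1 h1 *
    (V2 j g2 (enum_val q).2 l.2 * E2 (enum_val p).2 l.2 h2))).
  by apply: eq_bigr => l _; rewrite mxE mulrACA.
- rewrite /= (eq_bigr (fun ij : I1 * I2 => (\sum_p @E1 ij.1 p p h1) * (\sum_p @E2 ij.2 p p h2))).
    rewrite -(pair_big xpredT xpredT (fun i j => (\sum_p @E1 i p p h1) * (\sum_p @E2 j p p h2))) /=.
    by rewrite -big_distrlr /= (mu_sum EP1) // (mu_sum EP2) // -natrM mulnb.
  move=> [i j] _ /=; rewrite big_distrlr /=.
  exact: (big_pair_ord (fun l => E1 l.1 l.1 h1 * E2 l.2 l.2 h2)).
move=> [i j] p q [i' j'] r s.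
transitivity (gact (V1 i') (E1 (enum_val p).1 (enum_val q).1) (enum_val r).1 (enum_val s).1
  * gact (V2 j') (E2 (enum_val p).2 (enum_val q).2) (enum_val r).2 (enum_val s).2).
  rewrite /gact !summxE big_distrlr /= pair_big /=.
  by apply: eq_big => [[x y]|[x y] _]; rewrite ?inE // !mxE /= mulrACA.
rewrite (mu_val EP1) (mu_val EP2) -natrM mulnb xpair_eqE; congr (nat_of_bool _)%:R.
have [e|] /= := eqVneq i i'; last by [].
have [e'|] /= := eqVneq j j'; last by rewrite andbF.
subst i' j'; rewrite !val_eqE -[p == r](inj_eq enum_val_inj) -[q == s](inj_eq enum_val_inj).
case: (enum_val p) (enum_val q) (enum_val r) (enum_val s) => [a b] [a' b'] [c e] [c' e'] /=.
by rewrite !xpair_eqE !andbA; congr (_ && _); rewrite -!andbA; congr (_ && _); rewrite andbC.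
Qed.

End Box.

Section Power.
Variables (H : finGroupType) (X : irr_reps k H) (Z : finType).
Local Notation unitX := (irr_unit (@hrep _ _ X)).

Lemma hrep_units : matrix_units (@hrep _ _ X) unitX.
Proof.
apply: (irr_matrix_units k0); [exact: hrep_irr|exact: hrep_inj|exact: hrep_all].
Qed.

Lemma big_tens (F : {ffun Z -> X}) (f : forall y, 'I_(hdim (F y)) -> k) :
  \sum_(p < #|tens_idx F|) \prod_y f y (tens_at p y) = \prod_y \sum_i f y i.
Proof.
rewrite dffun_distr (big_enum_val (fun p : tens_idx F => \prod_y f y (p y))) /=.
by apply: eq_big.
Qed.

(** The same for powers of H, with one tensor factor for each y; hence the pi_F form a
    basis of R(Fun(Y_N, H)). *)
Lemma pi_units : matrix_units (fun F : {ffun Z -> X} => pi_repr F)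
  (fun F p q f => \prod_y unitX (tens_at p y) (tens_at q y) (f y)).
Proof.
split=> [F|F p q g h _ _|h _|F p q F' r s].
- apply/card_gt0P; pose t : tens_idx F := finfun (fun y => Ordinal (mu_gt0 hrep_units (F y))).
  by exists t.
- transitivity (\prod_y \sum_l hrep (F y) (g y) (tens_at q y) l * unitX (tens_at p y) l (h y)).
    by apply: eq_bigr => y _; rewrite !ffunE (mu_right hrep_units) ?inE.
  rewrite -big_tens; apply: eq_bigr => l _; rewrite mxE -big_split /=.
  exact: eq_bigr.
- rewrite (eq_bigr (fun F : {ffun Z -> X} => \prod_y \sum_(p < hdim (F y)) unitX p p (h y))).
    rewrite -(bigA_distr_bigA (fun y s => \sum_(p < hdim s) unitX p p (h y))).
    rewrite (eq_bigr (fun y => (h y == 1%g)%:R)) => [|y _]; last by rewrite (mu_sum hrep_units) ?inE.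
    have [->|] := eqVneq h 1%g; first by rewrite big1 // => y _; rewrite ffunE eqxx.
    move=> hn1; have [y hy] : exists y, h y != 1%g.
      apply/existsP; apply: contraNT hn1; rewrite negb_exists => /forallP e.
      by apply/eqP/ffunP => y; move: (e y); rewrite negbK ffunE => /eqP.
    by rewrite (bigD1 y) //= (negPf hy) mul0r.
  by move=> F _; rewrite -big_tens.
transitivity (\prod_y gact (hrep (F' y)) (unitX (tens_at p y) (tens_at q y))
                       (tens_at r y) (tens_at s y)).
  rewrite /gact summxE [LHS](eq_bigl xpredT) => [|f]; last by rewrite inE.
  transitivity (\prod_y \sum_(h : H) unitX (tens_at p y) (tens_at q y) h
                  * hrep (F' y) h (tens_at r y) (tens_at s y)); last first.
    apply: eq_bigr => y _; rewrite summxE.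
    by apply: eq_big => [h|h _]; rewrite ?inE ?mxE.
  by rewrite dffun_distr; apply: eq_bigr => f _; rewrite !mxE -big_split.
transitivity (\prod_y [&& F y == F' y, tens_at p y == tens_at r y :> nat
                      & tens_at q y == tens_at s y :> nat]%:R : k).
  apply: eq_bigr => y _.
  exact: (mu_val hrep_units).
rewrite prodr_nat_bool; congr (nat_of_bool _)%:R; apply/forallP/and3P => [h|[/eqP e pr qs] y].
  have e : F = F' by apply/ffunP => y; case/and3P: (h y) => /eqP.
  by subst F'; split=> //; rewrite val_eqE; apply/eqP/enum_val_inj/ffunP => y;
    apply/val_inj/eqP; case/and3P: (h y).
subst F'; move: pr qs; rewrite !val_eqE => /eqP-> /eqP->.
by rewrite !eqxx.
Qed.

End Power.
End ProductUnits.

(** * External products and induction on Grothendieck groups *)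

Lemma tens_basis (A B : zmodType) (I J : finType) (v : I -> A) (w : J -> B)
    (m : I -> A -> int) (n : J -> B -> int) :
    (forall x, x = \sum_i v i *~ m i x) -> (forall y, y = \sum_j w j *~ n j y) ->
  forall x y, x ⊗ y = \sum_i \sum_j (v i ⊗ w j) *~ (m i x * n j y).
Proof.
move=> vE wE x y; rewrite {1}[x]vE tens_suml; apply: eq_bigr => i _.
rewrite {1}[y]wE tens_sumr; apply: eq_bigr => j _.
by rewrite tensMzl tensMzr -mulrzA mulrC.
Qed.

Section Operations.
Variables (k : closedFieldType) (k0 : [pchar k] =i pred0).

Section Pull.
Variables (aT rT : finGroupType) (D : {group aT}) (G : {group rT}) (phi : ghom D G).

Lemma charR_pull x g : g \in D -> charR k D g (pullR k phi x) = charR k G (phi g) x.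
Proof.
move=> gD; move: x.
apply: (@R_eqf _ _ _ _ (charR k D g \o pullR k phi) (charR k G (phi g))) => n V /=.
by rewrite pullRE !charRE ?(ghom_in phi).
Qed.
End Pull.

Lemma charR_regular (gT : finGroupType) (G : {group gT}) g : g \in G ->
  charR k G g (clsR (regular_repr k G)) = if g == 1%g then #|G|%:R else 0.
Proof. by move=> gG; rewrite charRE // mxtrace_regular_repr. Qed.

Section Box.
Variables (gT1 gT2 : finGroupType) (G1 : {group gT1}) (G2 : {group gT2}).
Local Notation G := (setX_group G1 G2).

(** The external product, the inverse of unboxR. *)
Definition boxR : {additive tensor (Rgrp k G1) (Rgrp k G2) -> Rgrp k G} :=
  the_additive (fun phi => forall n1 n2
      (V : mx_representation k G1 n1) (W : mx_representation k G2 n2),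
    phi (clsR V ⊗ clsR W) = clsR (box_repr V W)).

Lemma boxRE n1 n2 (V : mx_representation k G1 n1) (W : mx_representation k G2 n2) :
  boxR (clsR V ⊗ clsR W) = clsR (box_repr V W).
Proof.
move: n1 n2 V W; pose P (f : tensor (Rgrp k G1) (Rgrp k G2) -> Rgrp k G) := forall n1 n2
  (V : mx_representation k G1 n1) (W : mx_representation k G2 n2),
  f (clsR V ⊗ clsR W) = clsR (box_repr V W).
apply: (@the_additiveP _ _ P).
have ex1 (W : mrep k G2) : exists f : {additive Rgrp k G1 -> Rgrp k G},
    forall n (V : mx_representation k G1 n), f (clsR V) = clsR (box_repr V (projT2 W)).
  apply: (charR_lift k0 (t := fun g x => charR k G1 g.1 x * \tr (projT2 W g.2))).
    by move=> g x y; rewrite raddfD mulrDl.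
  move=> [g1 g2] gG n V; rewrite charRE //= mxtrace_prod charRE //.
  by case/setXP: gG.
have [L LE] := choice ex1.
have Lchar W x g : g \in G ->
    charR k G g (L W x) = charR k G1 g.1 x * \tr (projT2 W g.2).
  case: g => g1 g2 gG; have [g1G g2G] := setXP gG; elim/R_ind: x => [|x y ex ey|n V].
  - by rewrite !raddf0 mul0r.
  - by rewrite !raddfB ex ey mulrBl.
  by rewrite LE !charRE //= mxtrace_prod.
have ex2 (x : Rgrp k G1) : exists f : {additive Rgrp k G2 -> Rgrp k G},
    forall n (W : mx_representation k G2 n), f (clsR W) = L (mk_mrep W) x.
  apply: (charR_lift k0 (t := fun g y => charR k G1 g.1 x * charR k G2 g.2 y)).
    by move=> g y z; rewrite raddfD mulrDr.
  move=> [g1 g2] gG n W; rewrite Lchar //= charRE //.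
  by case/setXP: gG.
have [M ME] := choice ex2.
have [x x' y|x y y'|phi phiE] := @tensor_lift _ _ (Rgrp k G) (fun x y => M x y).
- move: y; apply: (@R_eqf _ _ _ _ (M (x + x')) (M x \+ M x')) => n W /=.
  by rewrite !ME raddfD.
- by rewrite raddfD.
by exists phi => n1 n2 V W; rewrite phiE ME LE.
Qed.

Lemma charR_box g1 g2 x y : g1 \in G1 -> g2 \in G2 ->
  charR k G (g1, g2) (boxR (x ⊗ y)) = charR k G1 g1 x * charR k G2 g2 y.
Proof.
move=> g1G g2G; have gG : (g1, g2) \in G by apply/setXP.
elim/R_ind: x => [|x x' ex ex'|n V].
- by rewrite tens0l !raddf0 mul0r.
- by rewrite tensBl !raddfB /= ex ex' mulrBl.
elim/R_ind: y => [|y y' ey ey'|m W].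
- by rewrite tens0r !raddf0 mulr0.
- by rewrite !raddfB /= ey ey' mulrBr.
by rewrite boxRE !charRE //= mxtrace_prod.
Qed.

(** The form in which kron_units gives that boxR is bijective: the v1 i ⊗ v2 j span
    the source, their images form a basis of the target, and the coordinates of
    an external product are the products of coordinates. *)
Lemma box_basis : exists (I1 I2 : finType) (v1 : I1 -> Rgrp k G1) (v2 : I2 -> Rgrp k G2)
    (m1 : I1 -> {additive Rgrp k G1 -> int}) (m2 : I2 -> {additive Rgrp k G2 -> int})
    (m : I1 * I2 -> {additive Rgrp k G -> int}),
  [/\ forall x, x = \sum_i v1 i *~ m1 i x, forall y, y = \sum_j v2 j *~ m2 j y,
      forall z, z = \sum_p boxR (v1 p.1 ⊗ v2 p.2) *~ m p z
    & forall x y p, m p (boxR (x ⊗ y)) = m1 p.1 x * m2 p.2 y].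
Proof.
have [I1 [d1 [V1 [E1 EP1]]]] := irr_basis k0 G1.
have [I2 [d2 [V2 [E2 EP2]]]] := irr_basis k0 G2.
have [m1 [m1V m1E _]] := matrix_units_basis k0 EP1.
have [m2 [m2V m2E _]] := matrix_units_basis k0 EP2.
have [m [mV mE _]] := matrix_units_basis k0 (kron_units EP1 EP2).
exists I1, I2, (fun i => clsR (V1 i)), (fun j => clsR (V2 j)), m1, m2, m; split=> //.
  by move=> z; rewrite {1}[z]mE; apply: eq_bigr => p _; rewrite boxRE (clsR_box k0).
move=> x y p.
have mVV i j : m p (boxR (clsR (V1 i) ⊗ clsR (V2 j))) = (p.1 == i)%:R * (p.2 == j)%:R.
  rewrite boxRE (clsR_box k0) (mV p (i, j)) -natrM mulnb.
  by case: p => a b; rewrite xpair_eqE.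
transitivity (\sum_i \sum_j ((p.1 == i)%:R * (p.2 == j)%:R) * (m1 i x * m2 j y)).
  rewrite (tens_basis m1E m2E) !raddf_sum; apply: eq_bigr => i _.
  by rewrite !raddf_sum; apply: eq_bigr => j _; rewrite !raddfMz mVV mulrzz.
rewrite (bigD1 p.1) //= [X in _ + X]big1 => [|i ip]; last first.
  by apply: big1 => j _; rewrite eq_sym (negPf ip) !mul0r.
rewrite (bigD1 p.2) //= big1 ?addr0 ?eqxx ?mul1r // => j jp.
by rewrite [p.2 == j]eq_sym (negPf jp) mulr0 mul0r.
Qed.

Lemma boxR_surj z : exists t, z = boxR t.
Proof.
have [I1 [I2 [v1 [v2 [m1 [m2 [m [_ _ mE _]]]]]]]] := box_basis.
exists (\sum_p (v1 p.1 ⊗ v2 p.2) *~ m p z); rewrite {1}[z]mE raddf_sum.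
by apply: eq_bigr => p _; rewrite raddfMz.
Qed.

Lemma unboxRE t : unboxR k G1 G2 (boxR t) = t.
Proof.
move: t; pose P (f : Rgrp k G -> tensor (Rgrp k G1) (Rgrp k G2)) := forall n1 n2
      (V : mx_representation k G1 n1) (W : mx_representation k G2 n2),
    f (clsR (box_repr V W)) = clsR V ⊗ clsR W.
have uE : P (unboxR k G1 G2).
  apply: (@the_additiveP _ _ P).
  have [I1 [I2 [v1 [v2 [m1 [m2 [m [m1E m2E mE mM]]]]]]]] := box_basis.
  pose f z := \sum_p (v1 p.1 ⊗ v2 p.2) *~ m p z.
  have fB : zmod_morphism f.
    by move=> z z'; rewrite /f -sumrB; apply: eq_bigr => p _; rewrite raddfB mulrzBr.
  pose fa : {additive Rgrp k G -> tensor (Rgrp k G1) (Rgrp k G2)} :=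
    HB.pack f (GRing.isZmodMorphism.Build _ _ f fB).
  exists fa => n1 n2 V W /=.
  rewrite -boxRE [RHS](tens_basis m1E m2E) [RHS]pair_bigA.
  by apply: eq_bigr => p _; rewrite mM.
apply: (@tens_eqf _ _ _ (unboxR k G1 G2 \o boxR) idfun) => x y /=.
move: x; apply: (@R_eqf _ _ _ _ (unboxR k G1 G2 \o boxR \o tensl y) (tensl y)) => n V /=.
rewrite /tensl; move: y.
apply: (@R_eqf _ _ _ _ (unboxR k G1 G2 \o boxR \o tens (clsR V)) (tens (clsR V))) => m W /=.
by rewrite boxRE uE.
Qed.

End Box.

Section Ind.
Variables (aT rT : finGroupType) (D : {group aT}) (G : {group rT}).
Variables (phi : ghom D G) (phi_inj : {in D &, injective phi}).

Definition indR : {additive Rgrp k D -> Rgrp k G} :=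
  the_additive (fun f => forall n (V : mx_representation k D n),
    f (clsR V) = clsR (ind_repr phi_inj V)).

(** Frobenius' formula. The blocks of the induced representation are indexed by the
    right cosets of phi(D); as the contribution f u of the coset of u depends on
    the coset only, each is counted #|D| times when u runs over G. *)
Lemma tr_ind n (V : mx_representation k D n) g : g \in G ->
  #|D|%:R * \tr (ind_repr phi_inj V g)
  = \sum_(u in G) \sum_(d in D | phi d == (u * g * u^-1)%g) \tr (V d).
Proof.
move=> gG; pose f u := \sum_(d in D | phi d == (u * g * u^-1)%g) \tr (V d).
pose im : {group rT} := (Morphism (ghomM phi) @* D)%G.
have imE : im = phi @: D :> {set rT} by rewrite /im /= morphimEdom.
have imG : im \subset G.
  by rewrite imE; apply/subsetP => _ /imsetP[d dD ->]; apply: (ghom_in phi).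
have f_im e u : e \in D -> f (phi e * u)%g = f u.
  move=> eD; rewrite /f (reindex_inj (conjg_inj e^-1%g)) /=; apply: eq_big => d.
    rewrite groupJr ?groupV //; apply: andb_id2l => dD.
    rewrite conjgE invgK !(ghomM phi) ?groupM ?groupV //.
    have -> : phi e^-1%g = (phi e)^-1%g.
      apply: (mulgI (phi e)); rewrite -(ghomM phi) ?groupV // !mulgV.
      by apply: (mulgI (phi 1%g)); rewrite -(ghomM phi) ?group1 // !mulg1.
    rewrite !invMg !mulgA (inj_eq (mulIg _)) -!mulgA (inj_eq (mulgI _)).
    by rewrite !mulgA.
  rewrite groupJr ?groupV // => /andP[dD _].
  by rewrite -!(charRE V) ?groupJ ?groupV // conjgE invgK mulgA charRJ.
rewrite -/(f _) /= mxtrace_mxblock.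
transitivity (#|D|%:R * \sum_(C in rcosets (phi @: D) G) f (fingroup.repr C)).
  congr (_ * _); rewrite (big_enum_val (fun C => f (fingroup.repr C))).
  apply: eq_bigr => i _; rewrite /ind_block -/(ind_rep i) /f.
  case: pickP => [d /andP[dD /eqP dE]|nod]; last first.
    by rewrite mxtrace0 big1 // => d /andP[dD dE]; move: (nod d); rewrite /= dD dE.
  rewrite (bigD1 d) /= ?dD ?dE ?eqxx // big1 ?addr0 // => d' /andP[/andP[d'D /eqP d'E] d'd].
  by case/eqP: d'd; apply: phi_inj => //; rewrite d'E dE.
rewrite -imE; have /and3P[/eqP covG triv _] := rcosets_partition imG.
rewrite -[in RHS]covG (big_trivIset _ triv) /= mulr_sumr; apply: eq_bigr => C.
case/rcosetsP => u uG ->.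
have fC v : v \in (im :* u)%g -> f v = f u.
  by case/rcosetP => w; rewrite imE => /imsetP[d dD ->] ->; apply: f_im.
rewrite (eq_bigr (fun=> f u)) => [|v /fC //].
rewrite sumr_const fC ?mem_repr_rcoset // card_rcoset imE card_in_imset //.
by rewrite mulr_natl.
Qed.

Lemma indRE n (V : mx_representation k D n) : indR (clsR V) = clsR (ind_repr phi_inj V).
Proof.
move: n V; pose P (f : Rgrp k D -> Rgrp k G) := forall n (V : mx_representation k D n),
  f (clsR V) = clsR (ind_repr phi_inj V).
apply: (@the_additiveP _ _ P).
apply: (charR_lift k0 (t := fun g x => #|D|%:R^-1 *
  \sum_(u in G) \sum_(d in D | phi d == (u * g * u^-1)%g) charR k D d x)) => [g x y|g gG n V].
  rewrite -mulrDr -big_split; congr (_ * _); apply: eq_bigr => u _ /=.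
  by rewrite -big_split; apply: eq_bigr => d _ /=; rewrite raddfD.
apply: (canRL (mulKf (cardG_neq0 k0 D))); rewrite charRE // tr_ind //.
apply: eq_bigr => u _; apply: eq_bigr => d /andP[dD _].
by rewrite charRE.
Qed.

Lemma charR_ind x g : g \in G ->
  #|D|%:R * charR k G g (indR x)
  = \sum_(u in G) \sum_(d in D | phi d == (u * g * u^-1)%g) charR k D d x.
Proof.
move=> gG; elim/R_ind: x => [|x y ex ey|n V].
- rewrite !raddf0 mulr0 big1 // => u _; rewrite big1 // => d _.
  by rewrite raddf0.
- rewrite !raddfB mulrBr ex ey -sumrB; apply: eq_bigr => u _.
  by rewrite -sumrB; apply: eq_bigr => d _; rewrite raddfB.
rewrite indRE charRE // tr_ind //; apply: eq_bigr => u _.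
by apply: eq_bigr => d /andP[dD _]; rewrite charRE.
Qed.

(** Multiples of the regular character are the class functions supported at the
    identity, and conjugation preserves the support, so induction preserves this
    property. *)
Lemma charR_ind_regular x c : charR k D 1%g x = c ->
    (forall d, d \in D -> d != 1%g -> charR k D d x = 0) ->
  forall g, g \in G ->
    #|D|%:R * charR k G g (indR x) = if g == 1%g then #|G|%:R * c else 0.
Proof.
move=> x1 x0 g gG; rewrite charR_ind //.
have phi1 : phi 1%g = 1%g.
  by apply: (mulgI (phi 1%g)); rewrite -(ghomM phi) ?group1 // !mulg1.
have conj1 u : (u * g * u^-1 == 1)%g = (g == 1%g).
  by rewrite -{1}(mulgV u) (inj_eq (mulIg _)) -{2}[u]mulg1 (inj_eq (mulgI _)).
transitivity (\sum_(u in G) if g == 1%g then c else 0).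
  apply: eq_bigr => u _; case: eqP => [g1|/eqP g1].
    rewrite (bigD1 1%g) /=; last by rewrite group1 phi1 eq_sym conj1 g1 eqxx.
    rewrite x1 big1 ?addr0 //.
    by move=> d /andP[/andP[dD _] d1]; rewrite x0.
  apply: big1 => d /andP[dD /eqP dE]; apply: x0 => //; apply: contraNneq g1 => d1.
  by rewrite -(conj1 u) -dE d1 phi1.
by case: eqP => _; rewrite sumr_const ?mul0rn // mulr_natl.
Qed.

End Ind.

(** The isomorphisms a and b carry the data of Frobenius' formula for phi' to those
    for phi. This is why the product and the coproducts of M are compatible with
    the identifications Ad_w. *)
Lemma ind_transport (aT aT' rT rT' : finGroupType)
    (D : {group aT}) (G : {group rT}) (D' : {group aT'}) (G' : {group rT'})
    (phi : ghom D G) (phi_inj : {in D &, injective phi})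
    (phi' : ghom D' G') (phi'_inj : {in D' &, injective phi'})
    (a : ghom D' D) (b : ghom G' G) :
    {in D' &, injective a} -> a @: D' = D -> {in G' &, injective b} -> b @: G' = G ->
    {in D', forall d, b (phi' d) = phi (a d)} ->
  forall x x', (forall d, d \in D' -> charR k D' d x' = charR k D (a d) x) ->
  forall g, g \in G' ->
    charR k G' g (indR phi'_inj x') = charR k G (b g) (indR phi_inj x).
Proof.
move=> a_inj aD b_inj bG sq x x' xx' g gG'.
have cD : #|D'| = #|D| by rewrite -aD card_in_imset.
apply: (mulfI (cardG_neq0 k0 D)); rewrite -{1}cD !charR_ind ?(ghom_in b) //.
rewrite -[in RHS]bG big_imset //=; apply: eq_bigr => u uG'.
rewrite -[in RHS]aD big_imset_cond //=.
rewrite [RHS](eq_bigl (fun d => (d \in D') && (phi' d == (u * g * u^-1)%g))).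
  by apply: eq_bigr => d /andP[dD' _]; rewrite xx'.
move=> d; apply: andb_id2l => dD'; rewrite -sq //.
have bV : b u^-1%g = (b u)^-1%g.
  apply: (mulgI (b u)); rewrite -(ghomM b) ?groupV // !mulgV.
  by apply: (mulgI (b 1%g)); rewrite -(ghomM b) ?group1 // !mulg1.
rewrite -bV -!(ghomM b) ?groupM ?groupV // (inj_in_eq b_inj) ?groupM ?groupV //.
exact: (ghom_in phi').
Qed.

Lemma charR_subg (gT : finGroupType) (S G : {group gT}) (sSG : S \subset G) :
  exists f : {additive Rgrp k G -> Rgrp k S},
    (forall n (V : mx_representation k G n), f (clsR V) = clsR (subg_repr V sSG)) /\
    (forall x s, s \in S -> charR k S s (f x) = charR k G s x).
Proof.
have [||f fE] := charR_lift k0 (T := fun n (V : mx_representation k G n) =>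
  clsR (subg_repr V sSG)) (t := fun g x => charR k G g x).
- by move=> *; rewrite raddfD.
- by move=> g gS n V; rewrite !charRE ?(subsetP sSG).
exists f; split=> // x s sS; move: x.
apply: (@R_eqf _ _ _ _ (charR k S s \o f) (charR k G s)) => n V /=.
by rewrite fE !charRE ?(subsetP sSG).
Qed.

Lemma charR_prod (gT : finGroupType) (G : {group gT}) m (Q : mx_representation k G m) :
  exists f : {additive Rgrp k G -> Rgrp k G},
    (forall n (V : mx_representation k G n), f (clsR V) = clsR (prod_repr V Q)) /\
    (forall x g, g \in G -> charR k G g (f x) = charR k G g x * \tr (Q g)).
Proof.
have [||f fE] := charR_lift k0 (T := fun n (V : mx_representation k G n) =>
  clsR (prod_repr V Q)) (t := fun g x => charR k G g x * \tr (Q g)).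
- by move=> *; rewrite raddfD mulrDl.
- by move=> g gG n V; rewrite !charRE //= mxtrace_prod.
exists f; split=> // x g gG; elim/R_ind: x => [|x y ex ey|n V].
- by rewrite !raddf0 mul0r.
- by rewrite !raddfB ex ey mulrBl.
by rewrite fE !charRE //= mxtrace_prod.
Qed.

End Operations.

(** * Young sets *)

Section YoungSets.
Variable Y : young_set.

Definition mk_fiso (N M : finType) (f : N -> M) (g : M -> N)
    (fK : cancel f g) (gK : cancel g f) : fiso N M.
Proof.
exists (mk_finj (can_inj fK)) (mk_finj (can_inj gK)).
  by move=> x; rewrite !mk_finjE fK.
by move=> x; rewrite !mk_finjE gK.
Defined.

Definition fiso_inv (N M : finType) (w : fiso N M) : fiso M N := FIso (bwdK w) (fwdK w).

Lemma ymap_bwdK (N M : finType) (w : fiso N M) y :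
  ymap Y (fwd w) (ymap Y (bwd w) y) = y.
Proof. exact: (ymap_fwdK (fiso_inv w)). Qed.

Lemma bij_fiso (N M : finType) (f : finj N M) : (forall y, exists x, f x = y) ->
  exists w : fiso N M, fwd w = f.
Proof.
move=> surj; have /fin_all_exists[g gE] := surj.
have gK : cancel g f by [].
have fK : cancel f g by move=> x; apply: (@finjP _ _ f); rewrite gE.
by exists (mk_fiso fK gK); apply: finj_eq => x; rewrite mk_finjE.
Qed.

(** Up to isomorphism an injection is the inclusion of its image, so what is defined
    for subsets applies to injections. *)
Lemma im_fiso (M N : finType) (j : finj M N) :
  exists w : fiso M (subft (j @: setT)), forall x, val (fwd w x) = j x.
Proof.
have jP x : j x \in j @: setT by apply: imset_f.
pose f x : subft (j @: setT) := Sub (j x) (jP x).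
have f_inj : injective f by move=> x y /(congr1 val) /= /finjP.
have [|w wE] := bij_fiso (f := mk_finj f_inj).
  case=> y yj; have /imsetP[x _ e] := yj.
  by exists x; rewrite mk_finjE; apply: val_inj => /=.
by exists w => x; rewrite wE mk_finjE.
Qed.

Section Sets.
Variable N : finType.

Lemma mem_yset_im (M : finType) (j : finj M N) y :
  reflect (exists u, y = ymap Y j u) (y \in yset Y (j @: setT)).
Proof.
have e (w : fiso M (subft (j @: setT))) : (forall x, val (fwd w x) = j x) ->
    forall u, ymap Y (incl (j @: setT)) (ymap Y (fwd w) u) = ymap Y j u.
  move=> wE u; rewrite -ymapM; congr (ymap Y _ u).
  by apply: finj_eq => x; rewrite finj_compE mk_finjE.
apply: (iffP imsetP) => [[u _ ->]|[u ->]]; have [w /e {}e] := im_fiso j.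
  by exists (ymap Y (bwd w) u); rewrite -e ymap_bwdK.
by exists (ymap Y (fwd w) u) => //; rewrite e.
Qed.

Lemma ysetI (K L : {set N}) : yset Y (K :&: L) = yset Y K :&: yset Y L.
Proof. by rewrite /yset yobj_setI. Qed.

Lemma ysetS (K L : {set N}) : K \subset L -> yset Y K \subset yset Y L.
Proof. by move=> /setIidPl <-; rewrite ysetI subsetIr. Qed.

Lemma young_void (M : finType) : #|M| = 0%N -> Y M -> False.
Proof.
move=> M0 y; have no : M -> False by move=> x; move/card0_eq: M0 => /(_ x).
pose f (x : M) : void := match no x with end.
have f_inj : injective f by move=> x; case: (no x).
by have /card0_eq/(_ (ymap Y (mk_finj f_inj) y)) := yobj_void Y.
Qed.

Lemma yset0 : yset Y (set0 : {set N}) = set0.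
Proof.
apply/setP => y; rewrite !inE; apply/imsetP => -[u _ _]; apply: young_void u.
by rewrite card_sub; apply: eq_card0 => x; rewrite !inE.
Qed.

Lemma ysetT : yset Y [set: N] = setT.
Proof.
apply/setP => y; rewrite inE; have <- : finj_id N @: setT = setT.
  by apply/setP => x; rewrite !inE; apply/imsetP; exists x; rewrite // finj_idE.
by apply/mem_yset_im; exists y; rewrite ymap1.
Qed.

Lemma yset2C (K : {set N}) : yset2 Y (~: K) = yset2 Y K.
Proof. by rewrite /yset2 setCK setUC. Qed.

End Sets.

Lemma mem_yset_map (M N : finType) (j : finj M N) (A : {set M}) u :
  (ymap Y j u \in yset Y (j @: A)) = (u \in yset Y A).
Proof.
have -> : j @: A = finj_comp j (incl A) @: setT.
  apply/setP => x; apply/imsetP/imsetP => [[y yA ->]|[y _ ->]].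
    by exists (Sub y yA) => //; rewrite finj_compE mk_finjE.
  by exists (val y); rewrite ?(valP y) // finj_compE mk_finjE.
apply/mem_yset_im/imsetP => [[v e]|[v _ ->]].
  by exists v => //; move: e; rewrite ymapM => /finjP.
by exists v; rewrite ymapM.
Qed.

Lemma mem_yset2_fwd (M N : finType) (w : fiso M N) (A : {set M}) u :
  (ymap Y (fwd w) u \in yset2 Y (fwd w @: A)) = (u \in yset2 Y A).
Proof.
have e : ~: (fwd w @: A) = fwd w @: (~: A).
  apply/setP => y; rewrite -[y](bwdK w) inE !mem_imset ?inE //; exact: finjP.
by rewrite /yset2 !in_setU e !mem_yset_map.
Qed.

(** Y_K and Y_L meet in Y of the empty set, which is empty. *)
Lemma young_disjoint (K L N : finType) (i : finj K N) (j : finj L N) u v :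
  (forall x y, i x <> j y) -> ymap Y i u = ymap Y j v -> False.
Proof.
move=> ij e; have : ymap Y i u \in yset Y (i @: setT) :&: yset Y (j @: setT).
  by rewrite inE {2}e; apply/andP; split; apply/mem_yset_im; [exists u|exists v].
rewrite -ysetI (_ : _ :&: _ = set0) ?yset0 ?inE //.
by apply/setP => x; rewrite !inE; apply/andP => -[/imsetP[a _ ->] /imsetP[b _]] /ij.
Qed.

Section Join.
Variables (X : finType) (x0 : X) (K L : finType) (F : {ffun Y K -> X}) (G : {ffun Y L -> X}).
Local Notation J := (fjoin x0 F G).

Lemma fjoin_inl u : J (ymap Y (inlj K L) u) = F u.
Proof.
rewrite ffunE; case: pickP => [a /eqP /finjP -> //|/(_ u)].
by rewrite eqxx.
Qed.

Lemma fjoin_inr v : J (ymap Y (inrj K L) v) = G v.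
Proof.
rewrite ffunE; case: pickP => [a /eqP e|_].
  by case: (young_disjoint _ e) => x y; rewrite !mk_finjE.
by case: pickP => [a /eqP /finjP -> //|/(_ v)]; rewrite eqxx.
Qed.

Lemma fjoin_out y : (forall u, y <> ymap Y (inlj K L) u) ->
  (forall v, y <> ymap Y (inrj K L) v) -> J y = x0.
Proof.
move=> nl nr; rewrite ffunE; case: pickP => [a /eqP e|_]; first by case: (nl a).
by case: pickP => [a /eqP e|//]; case: (nr a).
Qed.

Lemma mem_imset_inl s :
  (s \in inlj K L @: setT) = (if s is inl _ then true else false).
Proof.
case: s => x; last by apply/imsetP => -[y _]; rewrite mk_finjE.
by apply/imsetP; exists x; rewrite ?mk_finjE.
Qed.

Lemma mem_imset_inr s :
  (s \in inrj K L @: setT) = (if s is inl _ then false else true).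
Proof.
case: s => x; first by apply/imsetP => -[y _]; rewrite mk_finjE.
by apply/imsetP; exists x; rewrite ?mk_finjE.
Qed.

Lemma imset_inr : inrj K L @: setT = ~: (inlj K L @: setT).
Proof. by apply/setP => s; rewrite inE mem_imset_inl mem_imset_inr; case: s. Qed.

Lemma fjoin_supp y : y \notin yset2 Y (inlj K L @: setT) -> J y = x0.
Proof.
rewrite inE -imset_inr negb_or => /andP[/mem_yset_im nl /mem_yset_im nr].
by apply: fjoin_out => [u e|v e]; [apply: nl; exists u|apply: nr; exists v].
Qed.

End Join.
End YoungSets.

(** * The group B and colourings *)

Section Colourings.
Variables (k : closedFieldType) (k0 : [pchar k] =i pred0).
Variables (H : finGroupType) (X : irr_reps k H) (Y : young_set).
Local Notation colour N := {ffun Y N -> X}.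
Local Notation B := (Bcar k H Y).
Local Notation R N := (RFun k H Y N).
Local Notation iso F F' w := (forall y, F' (ymap Y (fwd w) y) = F y).

Definition pullF (M N : finType) (j : finj M N) (F : colour N) : colour M :=
  [ffun y => F (ymap Y j y)].

Lemma transp_iso (N M : finType) (w : fiso N M) (F : colour N) : iso F (transp w F) w.
Proof. by move=> y; rewrite ffunE ymap_fwdK. Qed.

Lemma iso_transp (N M : finType) (w : fiso N M) (F : colour N) (F' : colour M) :
  iso F F' w -> F' = transp w F.
Proof. by move=> e; apply/ffunP => y; rewrite ffunE -e ymap_bwdK. Qed.

Lemma pi_coords (N : finType) : exists m : colour N -> {additive R N -> int},
  (forall F F', m F (clsR (pi_repr F')) = (F == F')%:R) /\
  (forall x, x = \sum_F clsR (pi_repr F) *~ m F x).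
Proof. by have [m [mV mE _]] := matrix_units_basis k0 (pi_units k0 X (Y N)); exists m. Qed.

Lemma RFun_ind (N : finType) (P : R N -> Prop) :
    P 0 -> (forall x y, P x -> P y -> P (x - y)) -> 
    (forall F : colour N, P (clsR (pi_repr F))) ->
  forall x, P x.
Proof.
move=> P0 PB PV x; have [m [_ mE]] := pi_coords N.
apply: (@zspan_ind _ (fun y => exists F : colour N, y = clsR (pi_repr F))) => //.
  by move=> _ [F ->].
by rewrite [x]mE; apply: zspan_sum => F _; apply/zspanMz/zspan_base; exists F.
Qed.

Lemma pull_pi (N M : finType) (w : fiso N M) (F : colour N) :
  pullR k (fun_ad H Y w) (clsR (pi_repr F)) = clsR (pi_repr (transp w F)).
Proof.
have trE (Z : finType) (F' : {ffun Z -> X}) f :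
    \tr (pi_repr F' f) = \prod_y \tr (hrep (F' y) (f y)).
  rewrite /mxtrace -(big_tens (fun y i => hrep (F' y) (f y) i i)).
  by apply: eq_bigr => p _; rewrite mxE.
apply: (charR_inj k0) => f _; rewrite charR_pull ?inE // !charRE ?inE // !trE.
rewrite (reindex (ymap Y (fwd w))) /=.
  by apply: eq_bigr => y _; rewrite transp_iso ffunE.
by exists (ymap Y (bwd w)) => y _; rewrite ?ymap_fwdK ?ymap_bwdK.
Qed.

Local Notation genB x := (gen (@B_rel k H Y) (mk_Bgen x)).

Lemma genB_zmod n : zmod_morphism (fun x : R 'I_n => genB x).
Proof.
move=> x y; apply/(canRL (addrK _)).
have := gen_rel (BAdd (x - y) y); rewrite !raddfB subrK.
by move/subr0_eq/(canRL (subrK _)) => e; rewrite addrC; exact: esym e.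
Qed.

Lemma genB_pull n m (w : fiso 'I_n 'I_m) (x : R 'I_n) :
  genB (pullR k (fun_ad H Y w) x : R 'I_m) = genB x.
Proof. by have := gen_rel (BAd w x); rewrite raddfB /= => /subr0_eq. Qed.

Fact clsB_zmod (N : finType) : zmod_morphism (@clsB k H Y N).
Proof. by move=> x y; rewrite /clsB raddfB genB_zmod. Qed.
HB.instance Definition _ N := GRing.isZmodMorphism.Build _ _ (@clsB k H Y N) (@clsB_zmod N).

Lemma clsB_pull (N M : finType) (w : fiso N M) (x : R N) :
  clsB (pullR k (fun_ad H Y w) x : R M) = clsB x.
Proof.
have vK : cancel (enum_rank \o fwd w \o @enum_val N N) (enum_rank \o bwd w \o @enum_val M M).
  by move=> i; rewrite /= enum_rankK fwdK enum_valK.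
have vK' : cancel (enum_rank \o bwd w \o @enum_val M M) (enum_rank \o fwd w \o @enum_val N N).
  by move=> i; rewrite /= enum_rankK bwdK enum_valK.
rewrite /clsB -(genB_pull (mk_fiso vK vK')); congr (gen _ (mk_Bgen _)).
apply: (charR_inj k0) => f _; rewrite !charR_pull ?inE //; congr (charR k _ _ _).
apply/ffunP => y; rewrite !ffunE -!ymapM; congr (f (ymap Y _ y)).
by apply: finj_eq => z; rewrite !finj_compE !mk_finjE /= enum_rankK.
Qed.

Lemma piB_iso (N M : finType) (w : fiso N M) (F : colour N) (F' : colour M) :
  iso F F' w -> piB F' = piB F.
Proof. by move=> /iso_transp ->; rewrite /piB -pull_pi clsB_pull. Qed.

Lemma genB_clsB n (x : R 'I_n) : genB x = clsB x.
Proof. by rewrite /clsB genB_pull. Qed.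

Lemma B_ind (P : B -> Prop) :
    P 0 -> (forall x y, P x -> P y -> P (x - y)) ->
    (forall (N : finType) (F : colour N), P (piB F)) ->
  forall x, P x.
Proof.
move=> P0 PB PF x; apply: zspan_ind (pres_span x) => // _ [[n y] ->].
rewrite -/(mk_Bgen y) genB_clsB.
elim/RFun_ind: y => [|y z Py Pz|F]; [by rewrite raddf0| |exact: PF].
by rewrite raddfB; apply: PB.
Qed.

Lemma B_eqf (C : zmodType) (f g : {additive B -> C}) :
  (forall (N : finType) (F : colour N), f (piB F) = g (piB F)) -> f =1 g.
Proof.
by move=> e; elim/B_ind=> [|x y ex ey|N F]; rewrite ?raddf0 ?raddfB ?ex ?ey //.
Qed.

(** The universal property of B as the free abelian group on the isomorphism classes
    of colourings: R(Fun(Y_N, H)) is free on the pi_F by pi_coords, and Ad_w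
    permutes these basis elements by pull_pi. *)
Theorem B_lift (C : zmodType) (f : forall N : finType, colour N -> C) :
    (forall (N M : finType) (w : fiso N M) (F : colour N) (F' : colour M),
       iso F F' w -> f M F' = f N F) ->
  exists phi : {additive B -> C}, forall (N : finType) (F : colour N), phi (piB F) = f N F.
Proof.
move=> f_iso.
pose m n := projT1 (cid (pi_coords 'I_n)).
have mP n := projT2 (cid (pi_coords 'I_n)); rewrite -/(m _) in mP.
pose l n (x : R 'I_n) := \sum_F f 'I_n F *~ m n F x.
have lB n : zmod_morphism (l n).
  by move=> x y; rewrite /l -sumrB; apply: eq_bigr => F _; rewrite raddfB mulrzBr.
pose L n : {additive R 'I_n -> C} := HB.pack (l n) (GRing.isZmodMorphism.Build _ _ _ (lB n)).
have LE n (F : colour 'I_n) : L n (clsR (pi_repr F)) = f _ F.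
  have [mF _] := mP n; rewrite /= /l (bigD1 F) //= mF eqxx big1 ?addr0 // => F' FF'.
  by rewrite mF (negPf FF') mulr0z.
have [|phi phiE] := @pres_lift _ (@B_rel k H Y) C (fun t => L (tag t) (tagged t)).
  move=> g gE r [n x y|n n' w x]; rewrite !raddfB !gE.
    by rewrite raddfD addrAC addrK subrr.
  apply/eqP; rewrite subr_eq0; apply/eqP.
  elim/RFun_ind: x => [|x y ex ey|F].
  - by rewrite !raddf0.
  - by rewrite !raddfB ex ey.
  by rewrite pull_pi !LE; apply/f_iso/transp_iso.
exists phi => N F; rewrite /piB /clsB phiE pull_pi LE.
exact/f_iso/transp_iso.
Qed.

Lemma B_lift2 (C : zmodType) (f : forall N M : finType, colour N -> colour M -> C) :
    (forall (N N' M : finType) (w : fiso N N') (F : colour N) (F' : colour N') (G : colour M),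
       iso F F' w -> f N' M F' G = f N M F G) ->
    (forall (N M M' : finType) (w : fiso M M') (F : colour N) (G : colour M) (G' : colour M'),
       iso G G' w -> f N M' F G' = f N M F G) ->
  exists phi : {additive tensor B B -> C},
    forall (N M : finType) (F : colour N) (G : colour M), phi (piB F ⊗ piB G) = f N M F G.
Proof.
move=> fl fr.
have exL (M : finType) (G : colour M) : exists phi : {additive B -> C},
    forall (N : finType) (F : colour N), phi (piB F) = f N M F G.
  by apply: B_lift => N N' w F F' e; apply: fl e.
pose L M G := projT1 (cid (exL M G)).
have LE M G N F : L M G (piB F) = f N M F G by apply: (projT2 (cid (exL M G))).
have exM (x : B) : exists phi : {additive B -> C},
    forall (M : finType) (G : colour M), phi (piB G) = L M G x.
  apply: B_lift => M M' w G G' e; move: x; apply: B_eqf => N F.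
  by rewrite !LE (fr _ _ _ _ _ _ _ e).
have [P PE] := choice exM.
have [x x' y|x y y'|phi phiE] := @tensor_lift B B C (fun x y => P x y).
- move: y; apply: (@B_eqf _ (P (x + x')) (P x \+ P x')) => N F /=.
  by rewrite !PE raddfD.
- by rewrite raddfD.
by exists phi => N M F G; rewrite phiE PE LE.
Qed.

Lemma tensB_eqf (C : zmodType) (f g : {additive tensor B B -> C}) :
    (forall (N M : finType) (F : colour N) (G : colour M),
       f (piB F ⊗ piB G) = g (piB F ⊗ piB G)) ->
  f =1 g.
Proof.
move=> e; apply: tens_eqf => x y; move: x.
apply: (@B_eqf _ (f \o tensl y) (g \o tensl y)) => N F /=; rewrite /tensl.
by move: y; apply: (@B_eqf _ (f \o tens (piB F)) (g \o tens (piB F))) => M G /=.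
Qed.

End Colourings.

(** * The graded algebra B *)

Section AlgebraB.
Variables (k : closedFieldType) (k0 : [pchar k] =i pred0).
Variables (H : finGroupType) (X : irr_reps k H) (Y : young_set).
Local Notation colour N := {ffun Y N -> X}.
Local Notation B := (Bcar k H Y).
Local Notation triv := (htriv X).
Local Notation iso F F' w := (forall y, F' (ymap Y (fwd w) y) = F y).
Local Notation mul := (@mulB k H X Y).
Local Notation piB := (@piB k H X Y _).

Definition piR (N : finType) (F : colour N) (K : {set N}) : B := piB (frestr F K).

Lemma piB_pull (N M : finType) (j : finj M N) (F : colour N) :
  piB (pullF j F) = piR F (j @: setT).
Proof.
have [w wE] := im_fiso j; apply/esym/(piB_iso k0 (w := w)) => y.
rewrite !ffunE -ymapM; congr (F (ymap Y _ y)).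
by apply: finj_eq => x; rewrite finj_compE mk_finjE.
Qed.

Lemma piR_pull (N M : finType) (j : finj M N) (F : colour N) (A : {set M}) :
  piR (pullF j F) A = piR F (j @: A).
Proof.
have e : finj_comp j (incl A) @: setT = j @: A.
  apply/setP => x; apply/imsetP/imsetP => [[y _ ->]|[y yA ->]].
    by exists (val y); rewrite ?(valP y) // finj_compE mk_finjE.
  by exists (Sub y yA) => //; rewrite finj_compE mk_finjE.
rewrite -e -piB_pull; congr piB; apply/ffunP => y.
by rewrite !ffunE ymapM.
Qed.

Lemma pullF_id (N : finType) (F : colour N) : pullF (finj_id N) F = F.
Proof. by apply/ffunP => y; rewrite ffunE ymap1. Qed.

Lemma piR_T (N : finType) (F : colour N) : piR F setT = piB F.
Proof.
rewrite -{2}(pullF_id F) piB_pull; congr piR.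
by apply/setP => x; rewrite !inE; apply/esym/imsetP; exists x; rewrite ?finj_idE.
Qed.

(** How a product is recognized: the embeddings i and j glue to a bijection of K + L
    with N that carries the join of F and G to T. *)
Lemma piB_join (N K L : finType) (i : finj K N) (j : finj L N)
    (T : colour N) (F : colour K) (G : colour L) :
    j @: setT = ~: (i @: setT) ->
    (forall u, T (ymap Y i u) = F u) -> (forall v, T (ymap Y j v) = G v) ->
    (forall y, y \notin yset2 Y (i @: setT) -> T y = triv) ->
  piB (fjoin triv F G) = piB T.
Proof.
move=> ij TF TG Tout.
pose f (s : K + L) : N := match s with inl x => i x | inr y => j y end.
have disj x y : i x <> j y.
  move=> e; have : j y \in ~: (i @: setT) by rewrite -ij imset_f.
  by rewrite inE -e imset_f.
have f_inj : injective f.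
  case=> x [] y //= e; first by rewrite (finjP e).
  - by case: (disj _ _ e).
  - by case: (disj _ _ (esym e)).
  by rewrite (finjP e).
have [|w wE] := bij_fiso (f := mk_finj f_inj).
  move=> x; have [/imsetP[y _ ->]|] := boolP (x \in i @: setT).
    by exists (inl y); rewrite mk_finjE.
  by rewrite -in_setC -ij => /imsetP[y _ ->]; exists (inr y); rewrite mk_finjE.
have wl u : ymap Y (fwd w) (ymap Y (inlj K L) u) = ymap Y i u.
  by rewrite -ymapM; congr (ymap Y _ u); apply: finj_eq => x; rewrite finj_compE wE !mk_finjE.
have wr v : ymap Y (fwd w) (ymap Y (inrj K L) v) = ymap Y j v.
  by rewrite -ymapM; congr (ymap Y _ v); apply: finj_eq => x; rewrite finj_compE wE !mk_finjE.
apply/esym/(piB_iso k0 (w := w)) => y.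
have [/mem_yset_im[u ->]|nl] := boolP (y \in yset Y (inlj K L @: setT)).
  by rewrite wl fjoin_inl.
have [/mem_yset_im[v ->]|nr] := boolP (y \in yset Y (inrj K L @: setT)).
  by rewrite wr fjoin_inr.
have nJ : y \notin yset2 Y (inlj K L @: setT).
  by rewrite inE negb_or nl -imset_inr.
rewrite fjoin_supp // Tout // (_ : i @: setT = fwd w @: (inlj K L @: setT)).
  by rewrite mem_yset2_fwd.
rewrite wE; apply/setP => x; apply/imsetP/imsetP => [[u _ ->]|[_ /imsetP[u _ ->] ->]].
  by exists (inlj K L u); rewrite ?imset_f // !mk_finjE.
by exists u; rewrite // !mk_finjE.
Qed.

Lemma mulBE (K L : finType) (F : colour K) (G : colour L) :
  mul (piB F ⊗ piB G) = piB (fjoin triv F G).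
Proof.
move: K L F G; pose P (f : tensor B B -> B) := forall (K L : finType)
  (F : colour K) (G : colour L), f (piB F ⊗ piB G) = piB (fjoin triv F G).
apply: (@the_additiveP _ _ P).
have im_inv (N M L : finType) (w : fiso N M) (i : finj N L) : finj_comp i (bwd w) @: setT = i @: setT.
  apply/setP => x; apply/imsetP/imsetP => -[y _ ->].
    by exists (bwd w y); rewrite ?finj_compE.
  by exists (fwd w y); rewrite ?finj_compE ?fwdK.
apply: (B_lift2 k0) => [N N' M w F F' G e|N M M' w F G G' e].
  apply: (piB_join (i := finj_comp (inlj N M) (bwd w)) (j := inrj N M)).
  - by rewrite im_inv imset_inr.
  - by move=> u; rewrite ymapM fjoin_inl -e ymap_bwdK.
  - by move=> v; rewrite fjoin_inr.
  by move=> y; rewrite im_inv; apply: fjoin_supp.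
apply: (piB_join (i := inlj N M) (j := finj_comp (inrj N M) (bwd w))).
- by rewrite im_inv imset_inr.
- by move=> u; rewrite fjoin_inl.
- by move=> v; rewrite ymapM fjoin_inr -e ymap_bwdK.
by move=> y; apply: fjoin_supp.
Qed.

Lemma imset_incl (N : finType) (K : {set N}) : incl K @: setT = K.
Proof.
apply/setP => x; apply/imsetP/idP => [[y _ ->]|xK]; first by rewrite mk_finjE (valP y).
by exists (Sub x xK); rewrite // mk_finjE.
Qed.

(** The two ways in which products arise in proofs: cutting the set N on which a
    colouring lives, here, and cutting a subset of N, in mul_disjoint. *)
Lemma mul_split (N : finType) (T : colour N) (A : {set N}) :
    (forall y, y \notin yset2 Y A -> T y = triv) ->
  mul (piR T A ⊗ piR T (~: A)) = piB T.
Proof.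
move=> Tout; rewrite mulBE; apply: (piB_join (i := incl A) (j := incl (~: A))).
- by rewrite !imset_incl.
- by move=> u; rewrite ffunE.
- by move=> v; rewrite ffunE.
by rewrite imset_incl.
Qed.

Lemma mul_disjoint (N : finType) (T : colour N) (C A : {set N}) : A \subset C ->
    (forall y, y \in yset Y C -> T y != triv -> (y \in yset Y A) || (y \in yset Y (C :\: A))) ->
  mul (piR T A ⊗ piR T (C :\: A)) = piR T C.
Proof.
move=> AC TC; pose A' : {set subft C} := incl C @^-1: A.
have im_pre (D : {set N}) : D \subset C -> incl C @: (incl C @^-1: D) = D.
  move=> DC; apply/setP => x; apply/imsetP/idP => [[y]|xD]; first by rewrite inE => h ->.
  by exists (Sub x (subsetP DC _ xD)); rewrite ?inE !mk_finjE.
have eA : incl C @: A' = A by apply: im_pre.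
have eA' : incl C @: (~: A') = C :\: A.
  have -> : ~: A' = incl C @^-1: (C :\: A); last by rewrite im_pre ?subsetDl.
  by apply/setP => x; rewrite !inE mk_finjE (valP x) andbT.
rewrite -{1}eA -eA' -!piR_pull mul_split // => y.
rewrite inE negb_or -(mem_yset_map (incl C) A') -(mem_yset_map (incl C) (~: A')) eA eA'.
rewrite ffunE => /andP[n1 n2]; apply/eqP; apply: contraNT n1 => /TC.
by rewrite (negPf n2) orbF; apply; apply: imset_f.
Qed.

Lemma piR_inl (K L : finType) (F : colour K) (G : colour L) (A : {set K}) :
  piR (fjoin triv F G) (inlj K L @: A) = piR F A.
Proof.
rewrite -piR_pull; congr piR; apply/ffunP => u.
by rewrite ffunE fjoin_inl.
Qed.

Lemma piR_inr (K L : finType) (F : colour K) (G : colour L) (A : {set L}) :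
  piR (fjoin triv F G) (inrj K L @: A) = piR G A.
Proof.
rewrite -piR_pull; congr piR; apply/ffunP => u.
by rewrite ffunE fjoin_inr.
Qed.

Lemma mulBC x y : mul (x ⊗ y) = mul (y ⊗ x).
Proof.
suff e : mul =1 mul \o tensor_swap B B by rewrite e /= tensor_swapE.
apply: (tensB_eqf (X := X) k0) => N M F G /=; rewrite tensor_swapE. rewrite !mulBE.
pose T := fjoin triv F G; pose A := inlj N M @: setT.
rewrite -[LHS](@mul_split _ T (~: A)) => [|u]; last by rewrite yset2C; apply: fjoin_supp.
rewrite setCK -mulBE /A -imset_inr piR_inl piR_inr.
by rewrite !piR_T mulBE.
Qed.

Let mul_subl x y z : mul ((x - y) ⊗ z) = mul (x ⊗ z) - mul (y ⊗ z).
Proof. by rewrite tensBl raddfB. Qed.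

Let mul_subr x y z : mul (z ⊗ (x - y)) = mul (z ⊗ x) - mul (z ⊗ y).
Proof. by rewrite !raddfB. Qed.

(** Both triple products are the class of the colouring T of N + (M + L), whose support
    lies in Y_a, Y_b and Y_c for the three pieces a, b, c. *)
Lemma mulBA x y z : mul (mul (x ⊗ y) ⊗ z) = mul (x ⊗ mul (y ⊗ z)).
Proof.
elim/(B_ind (X := X) k0): x => [|x x' ex ex'|N F].
- by rewrite !(tens0l, raddf0).
- by rewrite !mul_subl ex ex'.
elim/(B_ind (X := X) k0): y => [|y y' ey ey'|M G].
- by rewrite !(tens0l, tens0r, raddf0, tens0l, tens0r).
- by rewrite mul_subr !mul_subl mul_subr ey ey'.
elim/(B_ind (X := X) k0): z => [|z z' ez ez'|L E].
- by rewrite !(tens0r, raddf0).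
- by rewrite !mul_subr ez ez'.
rewrite [mul (piB G ⊗ _)]mulBE [RHS]mulBE.
set J := fjoin triv G E; set T := fjoin triv F J.
pose a := inlj N (M + L)%type @: setT; pose b := inrj N (M + L)%type @: (inlj M L @: setT).
pose c := inrj N (M + L)%type @: (inrj M L @: setT).
have aE : piR T a = piB F by rewrite /a piR_inl piR_T.
have bE : piR T b = piB G by rewrite /b piR_inr piR_inl piR_T.
have cE : piR T c = piB E by rewrite /c piR_inr piR_inr piR_T.
have inj : injective (inrj N (M + L)%type) by apply: finjP.
have aM s : (s \in a) = if s is inl _ then true else false by rewrite mem_imset_inl.
have bM s : (s \in b) = if s is inr (inl _) then true else false.
  case: s => [x|s]; first by apply/imsetP => -[t _]; rewrite mk_finjE.
  by rewrite -[inr s](mk_finjE (@inr_inj N (M + L))) mem_imset // mem_imset_inl.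
have cM s : (s \in c) = if s is inr (inr _) then true else false.
  case: s => [x|s]; first by apply/imsetP => -[t _]; rewrite mk_finjE.
  by rewrite -[inr s](mk_finjE (@inr_inj N (M + L))) mem_imset // mem_imset_inr.
have Tsupp y : T y != triv -> [|| y \in yset Y a, y \in yset Y b | y \in yset Y c].
  have [//|na] := boolP (y \in yset Y a); have [|nJ Ty] := boolP (y \in yset Y (~: a)).
    rewrite -imset_inr => /mem_yset_im[v ->]; rewrite fjoin_inr !mem_yset_map.
    apply: contraR; rewrite /= imset_inr => nv; apply/eqP/fjoin_supp.
    by rewrite inE.
  by rewrite /T fjoin_supp ?eqxx // inE negb_or in Ty *; apply/andP.
have ab : a :|: b = ~: c.
  by apply/setP => s; rewrite !inE aM bM cM; case: s => // -[].
have aab : (a :|: b) :\: a = b.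
  by apply/setP => s; rewrite !inE aM bM; case: s => // -[].
rewrite -aE -bE -cE -aab mul_disjoint ?subsetUl ?aab //.
  rewrite ab -{2}[c]setCK mul_split // => y; rewrite inE setCK negb_or -ab => /andP[nab nc].
  apply/eqP; apply: contraNT nab => /Tsupp; rewrite (negPf nc) orbF.
  by case/orP; apply: (subsetP (ysetS _ _)); rewrite ?subsetUl ?subsetUr.
move=> y yab /Tsupp => /or3P[->|->|yc]; rewrite ?orbT //.
have : y \in yset Y (a :|: b) :&: yset Y c by rewrite inE yab.
by rewrite -ysetI ab setIC setICr yset0 inE.
Qed.

Lemma piB_void (N : finType) (F : colour N) : #|N| = 0%N -> piB F = piB (empty_fun X Y).
Proof.
move=> N0; have no (x : N) : False by move/card0_eq: N0 => /(_ x).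
pose f (x : N) : void := match no x with end.
have fK : cancel f (of_void N) by move=> x; case: (no x).
have gK : cancel (of_void N) f by case.
apply/esym/(piB_iso k0 (w := mk_fiso fK gK)) => y.
by case: (young_void N0 y).
Qed.

Lemma mulB1l x : mul (piB (empty_fun X Y) ⊗ x) = x.
Proof.
elim/(B_ind (X := X) k0): x => [|x y ex ey|N F]; first by rewrite !raddf0.
  by rewrite !raddfB /= ex ey.
have i0 : injective (of_void N) by case.
have e0 : mk_finj i0 @: setT = set0 by apply/setP => x; rewrite inE; apply/imsetP => -[[]].
rewrite mulBE; apply: (piB_join (i := mk_finj i0) (j := finj_id N)).
- apply/setP => x; rewrite e0 !inE; apply/imsetP; exists x; rewrite // finj_idE.
  by [].
- by move=> u; case: (@young_void Y void _ u); rewrite card_void.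
- by move=> v; rewrite ymap1.
by move=> y; rewrite e0 /yset2 setC0 ysetT !inE orbT.
Qed.

Lemma mulB1r x : mul (x ⊗ piB (empty_fun X Y)) = x.
Proof. by rewrite mulBC mulB1l. Qed.

(** ** Grading *)

Lemma degB_piB (N : finType) (F : colour N) : degB #|N| (piB F).
Proof. by apply: zspan_base; exists N, (clsR (pi_repr F)). Qed.

Lemma degB_ind d (P : B -> Prop) :
    P 0 -> (forall x y, P x -> P y -> P (x - y)) ->
    (forall (N : finType) (F : colour N), #|N| = d -> P (piB F)) ->
  forall x, degB d x -> P x.
Proof.
move=> P0 PB PF; apply: zspan_ind => // _ [N [y [Nd ->]]].
elim/(RFun_ind (X := X) k0): y => [|y z Py Pz|F]; [by rewrite raddf0| |exact: PF].
by rewrite raddfB; apply: PB.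
Qed.

Lemma degB_mul i j x y : degB i x -> degB j y -> degB (i + j) (mul (x ⊗ y)).
Proof.
move: x; apply: degB_ind => [_|x x' hx hx' yj|N F <-].
- by rewrite tens0l raddf0; apply: zspan0.
- by rewrite tensBl raddfB; apply: zspanB; [apply: hx|apply: hx'].
move: y; apply: degB_ind => [|y y' hy hy'|M G <-].
- by rewrite tens0r raddf0; apply: zspan0.
- by rewrite !raddfB; apply: zspanB.
by rewrite mulBE -card_sum; apply: degB_piB.
Qed.

(** The projections to the homogeneous parts, from which directness of the sum
    follows. *)
Lemma degB_proj : exists p : nat -> {additive B -> B},
  forall d (N : finType) (F : colour N), p d (piB F) = piB F *+ (#|N| == d).
Proof.
have /choice : forall d, exists p : {additive B -> B},
  forall (N : finType) (F : colour N), p (piB F) = piB F *+ (#|N| == d).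
  move=> d; apply: (B_lift k0) => N M w F F' e; rewrite (piB_iso k0 e).
  by rewrite (bij_eq_card (Bijective (fwdK w) (bwdK w))).
by case=> p pE; exists p.
Qed.

Lemma gradingB : is_grading (algB X Y).
Proof.
have [p pE] := degB_proj.
have p_deg d x : degB d (p d x).
  elim/(B_ind (X := X) k0): x => [|x y hx hy|N F]; first by rewrite raddf0; apply: zspan0.
    by rewrite raddfB; apply: zspanB.
  by rewrite pE; case: eqP => [<-|_]; [apply: degB_piB|apply: zspan0].
have p_on d e x : degB d x -> p e x = x *+ (d == e).
  move: x; apply: degB_ind => [|x y hx hy|N F <-]; last exact: pE.
    by rewrite raddf0 mul0rn.
  by rewrite raddfB hx hy mulrnBl.
split=> [d|x|n c cdeg c0 i ltin].
- split; first exact: zspan0.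
  by move=> x y; apply: zspanB.
- suff [n /(_ _ (leqnn n)) xE] : exists n, forall m, (n <= m)%N -> x = \sum_(i < m) p i x.
    by exists n, (fun i => p i x); split=> // i; apply: p_deg.
  elim/(B_ind (X := X) k0): x => [|x y [n1 h1] [n2 h2]|N F].
  + by exists 0%N => m _; rewrite big1 // => i _; rewrite raddf0.
  + exists (maxn n1 n2) => m; rewrite geq_max => /andP[/h1 h1' /h2 h2'].
    by rewrite {1}h1' {1}h2' -sumrB; apply: eq_bigr => i _; rewrite raddfB.
  exists #|N|.+1 => m Nm; rewrite (bigD1 (Ordinal Nm)) //= pE eqxx big1 ?addr0 // => i iN.
  by rewrite pE; case: eqP => // e; case/eqP: iN; apply: val_inj.
have := congr1 (p i) c0; rewrite raddf_sum raddf0 (bigD1 (Ordinal ltin)) //=.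
rewrite (p_on _ i _ (cdeg i)) eqxx big1 ?addr0 // => j ji.
by rewrite (p_on _ i _ (cdeg j)); case: eqP => // e; case/eqP: ji; apply: val_inj.
Qed.

Lemma graded_algebraB : is_graded_algebra (algB X Y).
Proof.
split; first exact: gradingB.
- split; last exact: degB_mul.
  by rewrite /= -(card_void); apply: degB_piB.
- exact: mulBA.
by move=> x; split; [apply: mulB1l|apply: mulB1r].
Qed.

Lemma epsBE (N : finType) (F : colour N) : epsB X Y (piB F) = (#|N| == 0)%N%:R.
Proof.
pose P (f : B -> int) := f (piB (empty_fun X Y)) = 1 /\
    forall (N : finType) (F : {ffun Y N -> X}), #|N| != 0%N -> f (piB F) = 0.
have [e1 e0] : P (epsB X Y).
  apply: (@the_additiveP _ _ P).
  have [|f fE] := B_lift k0 (f := fun (N : finType) (F : colour N) => (#|N| == 0)%N%:R : int).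
    by move=> N' M w F' F'' _; rewrite (bij_eq_card (Bijective (fwdK w) (bwdK w))).
  by exists f; split=> [|N' F' /negPf n0]; rewrite fE ?card_void ?n0.
by have [/piB_void ->|/e0 ->] := eqVneq.
Qed.

Lemma connectedB : connected_algebra (algB X Y).
Proof.
split=> [m n /(congr1 (epsB X Y))|x]; first by rewrite !raddfMz epsBE card_void !intz.
split; last first.
  by case=> n ->; apply: zspanMz; rewrite -card_void; apply: degB_piB.
move: x; apply: degB_ind => [|x y [m ->] [n ->]|N F /piB_void ->].
- by exists 0; rewrite mulr0z.
- by exists (m - n); rewrite mulrzBr.
by exists 1.
Qed.

End AlgebraB.

(** * Weighted coproducts on B *)

(** Coassociativity of the coproducts comes down to this: both sides are the sum over
    the ordered partitions of N into three subsets, cut off in two different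
    orders. *)
Lemma sum_ordered_partitions (V : nmodType) (N : finType) (f : {set N} -> {set N} -> {set N} -> V) :
  \sum_(C : {set N}) \sum_(A : {set N} | A \subset C) f A (C :\: A) (~: C)
  = \sum_(C : {set N}) \sum_(A : {set N} | A \subset ~: C) f C A (~: C :\: A).
Proof.
rewrite !pair_big_dep /=.
rewrite (reindex_onto (fun p : {set N} * {set N} => (p.1 :|: p.2, p.1))
                      (fun p => (p.2, p.1 :\: p.2))) /=; last first.
  by move=> [C A] /= sAC; rewrite -{1}(setIidPr sAC) setID.
apply: eq_big => [[C A]|[C A]] /=.
  rewrite subsetUl xpair_eqE eqxx /= setDUl setDv set0U -disjoints_subset.
  by apply/eqP/setDidPl.
move=> /andP[_ /eqP[e]]; rewrite e setCU setDE; congr (f _ _ _).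
Qed.

Section Coproduct.
Variables (k : closedFieldType) (k0 : [pchar k] =i pred0).
Variables (H : finGroupType) (X : irr_reps k H) (Y : young_set).
Local Notation colour N := {ffun Y N -> X}.
Local Notation B := (Bcar k H Y).
Local Notation triv := (htriv X).
Local Notation iso F F' w := (forall y, F' (ymap Y (fwd w) y) = F y).
Local Notation mul := (@mulB k H X Y).
Local Notation piB := (@piB k H X Y _).
Local Notation one := (piB (empty_fun X Y)).

(** DeltaB is the case where phi is the dimension, and deltaB the case where phi is the
    indicator function of the trivial representation, for which the weight of K
    is 1 if the support of F lies in Y_{K, K^c} and 0 otherwise. *)
Variables (phi : X -> nat) (phi1 : phi triv = 1%N).

Definition weight (N : finType) (F : colour N) (K : {set N}) : nat :=
  \prod_(y in ~: yset2 Y K) phi (F y).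

Lemma card_subft (N : finType) (K : {set N}) : #|subft K| = #|K|.
Proof. by rewrite card_sig; apply: eq_card => x; rewrite !inE. Qed.

Lemma degB_piR (N : finType) (F : colour N) (K : {set N}) : degB #|K| (piR F K).
Proof. by rewrite -card_subft; apply: degB_piB. Qed.

Lemma weight_iso (N M : finType) (w : fiso N M) (F : colour N) (F' : colour M) (K : {set N}) :
  iso F F' w -> weight F' (fwd w @: K) = weight F K.
Proof.
move=> e; rewrite /weight (reindex (ymap Y (fwd w))) /=.
  by apply: eq_big => y; rewrite ?e // !in_setC mem_yset2_fwd.
by exists (ymap Y (bwd w)) => y _; rewrite ?ymap_fwdK ?ymap_bwdK.
Qed.

Lemma piR_iso (N M : finType) (w : fiso N M) (F : colour N) (F' : colour M) (K : {set N}) :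
  iso F F' w -> piR F' (fwd w @: K) = piR F K.
Proof.
move=> e; rewrite -(piR_pull k0); congr piR; apply/ffunP => y.
by rewrite ffunE e.
Qed.

Lemma imset_fwdC (N M : finType) (w : fiso N M) (K : {set N}) :
  ~: (fwd w @: K) = fwd w @: (~: K).
Proof.
by apply/setP => y; rewrite -[y](bwdK w) inE !mem_imset ?inE //; apply: finjP.
Qed.

Lemma coproduct_exists : exists D : {additive B -> tensor B B},
  forall (N : finType) (F : colour N),
    D (piB F) = \sum_(K : {set N}) (piR F K ⊗ piR F (~: K)) *+ weight F K.
Proof.
apply: (B_lift k0 (f := fun N F => \sum_(K : {set N}) (piR F K ⊗ piR F (~: K)) *+ weight F K)).
move=> N M w F F' e; rewrite (reindex (fun K : {set N} => fwd w @: K)) /=.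
  by apply: eq_bigr => K _; rewrite imset_fwdC !(piR_iso _ e) (weight_iso _ e).
exists (fun K : {set M} => bwd w @: K) => K _.
  by rewrite -imset_comp (eq_imset (g := id)) ?imset_id // => x /=; rewrite fwdK.
by rewrite -imset_comp (eq_imset (g := id)) ?imset_id // => x /=; rewrite bwdK.
Qed.

Variable D : {additive B -> tensor B B}.
Hypothesis DE : forall (N : finType) (F : colour N),
  D (piB F) = \sum_(K : {set N}) (piR F K ⊗ piR F (~: K)) *+ weight F K.

Lemma coproduct_map (C : zmodType) (f : {additive tensor B B -> C}) (N : finType) (F : colour N) :
  f (D (piB F)) = \sum_(K : {set N}) f (piR F K ⊗ piR F (~: K)) *+ weight F K.
Proof. by rewrite DE raddf_sum; apply: eq_bigr => K _; apply: raddfMn. Qed.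

Lemma coproduct_map2 (C C' : zmodType) (f : {additive C -> C'})
    (g : {additive tensor B B -> C}) (N : finType) (F : colour N) :
  f (g (D (piB F))) = \sum_(K : {set N}) f (g (piR F K ⊗ piR F (~: K))) *+ weight F K.
Proof. by rewrite coproduct_map raddf_sum; apply: eq_bigr => K _; apply: raddfMn. Qed.

Lemma weight_out (N : finType) (F : colour N) (K : {set N}) :
  yset2 Y K = setT -> weight F K = 1%N.
Proof. by move=> e; rewrite /weight e setCT big_set0. Qed.

Lemma weight0 (N : finType) (F : colour N) : weight F set0 = 1%N.
Proof. by apply: weight_out; rewrite /yset2 setC0 ysetT setUT. Qed.

Lemma weightC (N : finType) (F : colour N) (K : {set N}) : weight F (~: K) = weight F K.
Proof. by rewrite /weight yset2C. Qed.

Lemma weightT (N : finType) (F : colour N) : weight F setT = 1%N.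
Proof. by rewrite -weightC setCT weight0. Qed.

Lemma piR_0 (N : finType) (F : colour N) : piR F set0 = one.
Proof. by apply: piB_void; rewrite // card_subft cards0. Qed.

(** ** Coassociativity *)

(** The weight of A as a subset of C, for the restriction of F to C. *)
Definition rweight (N : finType) (F : colour N) (C A : {set N}) : nat :=
  \prod_(y in yset Y C :\: (yset Y A :|: yset Y (C :\: A))) phi (F y).

Lemma coproduct_restr (N : finType) (F : colour N) (C : {set N}) :
  D (piR F C) = \sum_(A : {set N} | A \subset C)
                  (piR F A ⊗ piR F (C :\: A)) *+ rweight F C A.
Proof.
have incl_inj : injective (incl C) by apply: finjP.
have im_pre (A : {set N}) : A \subset C -> incl C @: (incl C @^-1: A) = A.
  move=> sAC; apply/setP => x; apply/imsetP/idP => [[y]|xA]; first by rewrite inE => h ->.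
  by exists (Sub x (subsetP sAC _ xA)); rewrite ?inE !mk_finjE.
have pre_im (L : {set subft C}) : incl C @^-1: (incl C @: L) = L.
  by apply/setP => x; rewrite inE mem_imset.
have imC (L : {set subft C}) : incl C @: (~: L) = C :\: (incl C @: L).
  have -> : ~: L = incl C @^-1: (C :\: incl C @: L); last by rewrite im_pre ?subsetDl.
  by apply/setP => x; rewrite !inE mem_imset // mk_finjE (valP x) andbT.
have subC (L : {set subft C}) : incl C @: L \subset C.
  by apply/subsetP => _ /imsetP[y _ ->]; rewrite mk_finjE (valP y).
rewrite [in LHS]/piR DE (reindex_onto (fun L : {set subft C} => incl C @: L)
                          (fun A : {set N} => incl C @^-1: A)) /=; last first.
  by move=> A; apply: im_pre.
apply: eq_big => [L|L _]; first by rewrite subC pre_im eqxx.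
rewrite !(piR_pull k0) imC; congr (_ *+ _).
rewrite /rweight -imC /weight.
rewrite [RHS](eq_bigl (fun z => z \in ymap Y (incl C) @: (~: yset2 Y L))) => [|z].
  rewrite big_imset /=; last by move=> y z _ _ /finjP.
  by apply: eq_bigr => y _; rewrite ffunE.
rewrite inE; apply/andP/imsetP => [[nz /imsetP[y _ e]]|[y]].
  by exists y => //; move: nz; rewrite e !inE !mem_yset_map.
by rewrite !inE => ny ->; rewrite !mem_yset_map ny; split=> //; apply: imset_f.
Qed.

(** The two weights met when N is cut twice multiply to an expression that is symmetric
    in the three pieces A, C - A and ~: C. *)
Lemma weight_triple (N : finType) (F : colour N) (C A : {set N}) : A \subset C ->
  (rweight F C A * weight F C)%N
  = (\prod_(y in ~: (yset Y A :|: yset Y (C :\: A) :|: yset Y (~: C))) phi (F y))%N.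
Proof.
move=> sAC; rewrite [RHS](bigID (fun y => y \in yset Y C)) /=; congr (_ * _)%N.
  apply: eq_bigl => y; rewrite !inE !negb_or -!andbA.
  have [yC|] := boolP (y \in yset Y C); last by rewrite !andbF.
  have -> : y \notin yset Y (~: C).
    apply/negP => yC'; have : y \in yset Y C :&: yset Y (~: C) by rewrite inE yC.
    by rewrite -ysetI setICr yset0 inE.
  by rewrite !andbT.
apply: eq_bigl => y; rewrite !inE !negb_or andbC -!andbA.
have [yC|nC] := boolP (y \in yset Y C); first by rewrite !andbF.
rewrite andbT [y \notin yset Y A](contra _ nC) ?[y \notin yset Y (C :\: A)](contra _ nC) //.
  exact: (subsetP (ysetS _ (subsetDl _ _))).
exact: (subsetP (ysetS _ sAC)).
Qed.

Lemma coproduct_coassoc x :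
  tensor_assoc B B B (tensor_map D idfun (D x)) = tensor_map idfun D (D x).
Proof.
elim/(B_ind (X := X) k0): x => [|x y ex ey|N F]; first by rewrite !raddf0.
  by rewrite !raddfB ex ey.
pose t (A E Z : {set N}) := piR F A ⊗ (piR F E ⊗ piR F Z).
pose c (A E Z : {set N}) := (\prod_(y in ~: (yset Y A :|: yset Y E :|: yset Y Z)) phi (F y))%N.
transitivity (\sum_(C : {set N}) \sum_(A : {set N} | A \subset C)
                t A (C :\: A) (~: C) *+ c A (C :\: A) (~: C)).
  rewrite coproduct_map2; apply: eq_bigr => C _.
  rewrite tensor_mapE coproduct_restr tens_suml raddf_sum -sumrMnl.
  apply: eq_bigr => A sAC; rewrite tensMnl raddfMn tensor_assocE.
  by rewrite -mulrnA weight_triple.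
transitivity (\sum_(C : {set N}) \sum_(A : {set N} | A \subset ~: C)
                t C A (~: C :\: A) *+ c C A (~: C :\: A)); last first.
  rewrite coproduct_map; apply: eq_bigr => C _.
  rewrite tensor_mapE coproduct_restr tens_sumr -sumrMnl.
  apply: eq_bigr => A sAC; rewrite tensMnr -mulrnA -weightC weight_triple //.
  rewrite setCK; congr (_ *+ _); apply: eq_bigl => y; rewrite !inE.
  by rewrite -orbA orbC.
exact: (sum_ordered_partitions (fun A E Z => t A E Z *+ c A E Z)).
Qed.

Lemma coproduct_counit x :
  tensor_map (epsB X Y) idfun (D x) = 1 ⊗ x /\ tensor_map idfun (epsB X Y) (D x) = x ⊗ 1.
Proof.
elim/(B_ind (X := X) k0): x => [|x y [ex ex'] [ey ey']|N F].
- by rewrite !raddf0 !tens0l.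
- by rewrite !raddfB !tensBl ex ex' ey ey'.
have eps0 (K : {set N}) : K != set0 -> epsB X Y (piR F K) = 0.
  by rewrite /piR epsBE // card_subft cards_eq0 => /negPf ->.
split; rewrite coproduct_map.
  rewrite (bigD1 set0) // big1 => [|K /andP[_ K0]]; last first.
    by rewrite tensor_mapE eps0 // tens0l mul0rn.
  rewrite -[LHS]/(_ + 0) addr0 weight0 tensor_mapE setC0 (piR_T k0) piR_0 (epsBE k0).
  by rewrite card_void.
rewrite (bigD1 setT) // big1 => [|K /andP[_ KT]]; last first.
  rewrite tensor_mapE eps0 ?tens0r ?mul0rn //; apply: contra KT => /eqP e.
  by rewrite -[K]setCK e setC0.
rewrite -[LHS]/(_ + 0) addr0 weightT tensor_mapE setCT (piR_T k0) piR_0 (epsBE k0).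
by rewrite card_void.
Qed.

Lemma coproduct_cocomm x : tensor_swap B B (D x) = D x.
Proof.
elim/(B_ind (X := X) k0): x => [|x y ex ey|N F]; first by rewrite !raddf0.
  by rewrite !raddfB ex ey.
rewrite coproduct_map DE (reindex_inj (inv_inj (@setCK N))).
by apply: eq_bigr => K _; rewrite tensor_swapE setCK weightC.
Qed.

Lemma coproduct_deg d x : degB d x -> tensor_deg (A := algB X Y) d (D x).
Proof.
move: x; apply: (degB_ind (X := X) k0) => [|x y hx hy|N F <-].
- by rewrite raddf0; apply: zspan0.
- by rewrite raddfB; apply: zspanB.
rewrite DE /tensor_deg; apply: zspan_sum => K _; apply: zspanMn; apply: zspan_base.
by exists #|K|, #|~: K|, (piR F K), (piR F (~: K)); split; rewrite ?cardsC //; apply: degB_piR.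
Qed.

(** ** Compatibility with the product *)

Lemma coproduct_one : D one = one ⊗ one.
Proof.
rewrite DE (bigD1 set0) // big1 => [|K /andP[_ /set0Pn[[]]] //].
by rewrite -[LHS]/(_ + 0) addr0 weight0 setC0 piR_0 (piR_T k0).
Qed.

Section JoinSets.
Variables (K L : finType) (F : colour K) (G : colour L).
Let T := fjoin triv F G.

Definition set_join (A : {set K}) (E : {set L}) : {set K + L} :=
  inlj K L @: A :|: inrj K L @: E.

Lemma mem_set_join (A : {set K}) (E : {set L}) s :
  (s \in set_join A E) = match s with inl x => x \in A | inr y => y \in E end.
Proof.
rewrite inE; case: s => x.
  rewrite -[inl x](mk_finjE (@inl_inj K L)) mem_imset; last exact: finjP.
  rewrite orbC; case: imsetP => // -[y _].
  by rewrite !mk_finjE.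
rewrite -[inr x](mk_finjE (@inr_inj K L)) [X in _ || X]mem_imset; last exact: finjP.
by case: imsetP => // -[y _]; rewrite !mk_finjE.
Qed.

Lemma set_joinC (A : {set K}) (E : {set L}) : ~: set_join A E = set_join (~: A) (~: E).
Proof. by apply/setP => s; rewrite inE !mem_set_join; case: s => x; rewrite inE. Qed.

Lemma inl_mem_join (A : {set K}) (E : {set L}) u :
  (ymap Y (inlj K L) u \in yset Y (set_join A E)) = (u \in yset Y A).
Proof.
rewrite -(mem_yset_map (inlj K L)).
have -> : inlj K L @: A = set_join A E :&: inlj K L @: setT.
  apply/setP => s; rewrite inE mem_set_join mem_imset_inl.
  case: s => x; last by rewrite andbF; apply/imsetP => -[y _]; rewrite mk_finjE.
  by rewrite andbT -[inl x](mk_finjE (@inl_inj K L)) mem_imset //; apply: finjP.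
rewrite ysetI inE [X in _ && X](_ : _ = true) ?andbT //.
by apply/mem_yset_im; exists u.
Qed.

Lemma inr_mem_join (A : {set K}) (E : {set L}) v :
  (ymap Y (inrj K L) v \in yset Y (set_join A E)) = (v \in yset Y E).
Proof.
rewrite -(mem_yset_map (inrj K L)).
have -> : inrj K L @: E = set_join A E :&: inrj K L @: setT.
  apply/setP => s; rewrite inE mem_set_join mem_imset_inr.
  case: s => x; first by rewrite andbF; apply/imsetP => -[y _]; rewrite mk_finjE.
  by rewrite andbT -[inr x](mk_finjE (@inr_inj K L)) mem_imset //; apply: finjP.
rewrite ysetI inE [X in _ && X](_ : _ = true) ?andbT //.
by apply/mem_yset_im; exists v.
Qed.

Lemma fjoin_case y : T y != triv ->
  (exists u, y = ymap Y (inlj K L) u) \/ (exists v, y = ymap Y (inrj K L) v).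
Proof.
move=> Ty; have [/mem_yset_im|nl] := boolP (y \in yset Y (inlj K L @: setT)); first by left.
have [/mem_yset_im|nr] := boolP (y \in yset Y (inrj K L @: setT)); first by right.
by case/eqP: Ty; apply: fjoin_supp; rewrite inE negb_or nl -imset_inr.
Qed.

Lemma piR_set_join (A : {set K}) (E : {set L}) : piR T (set_join A E) = mul (piR F A ⊗ piR G E).
Proof.
have eE : set_join A E :\: inlj K L @: A = inrj K L @: E.
  have -> : inlj K L @: A = set_join A set0 by rewrite /set_join imset0 setU0.
  have -> : inrj K L @: E = set_join set0 E by rewrite /set_join imset0 set0U.
  by apply/setP => s; rewrite in_setD !mem_set_join; case: s => x; rewrite inE ?andNb.
rewrite -(piR_inl k0 F G A) -(piR_inr k0 F G E) -eE (mul_disjoint k0) ?subsetUl // eE.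
move=> y yJ /fjoin_case[[u e]|[v e]]; move: yJ; rewrite e.
  by rewrite inl_mem_join mem_yset_map => ->.
by rewrite inr_mem_join orbC mem_yset_map => ->.
Qed.

(** Where y lies neither in Y_K nor in Y_L, the join is trivial and phi is 1. *)
Lemma weight_set_join (A : {set K}) (E : {set L}) : weight T (set_join A E) = (weight F A * weight G E)%N.
Proof.
rewrite /weight (bigID (fun y => y \in yset Y (inlj K L @: setT))).
rewrite -[LHS]/(_ * _)%N; congr (_ * _)%N.
  rewrite (eq_bigl (fun z => z \in ymap Y (inlj K L) @: (~: yset2 Y A))) => [|z].
    rewrite big_imset; last by move=> y z _ _ /finjP.
    by apply: eq_bigr => u _; rewrite fjoin_inl.
  apply/andP/imsetP => [[nz /mem_yset_im[u e]]|[u]].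
    by exists u => //; move: nz; rewrite e !inE set_joinC !inl_mem_join.
  rewrite !inE => nu ->; rewrite set_joinC !inl_mem_join; split=> //.
  by apply/mem_yset_im; exists u.
rewrite (bigID (fun y => y \in yset Y (inrj K L @: setT))).
rewrite -[LHS]/(_ * _)%N [X in (_ * X)%N]big1 ?muln1.
  rewrite (eq_bigl (fun z => z \in ymap Y (inrj K L) @: (~: yset2 Y E))) => [|z].
    rewrite big_imset; last by move=> y z _ _ /finjP.
    by apply: eq_bigr => u _; rewrite fjoin_inr.
  apply/andP/imsetP => [[/andP[nz _] /mem_yset_im[v e]]|[v]].
    by exists v => //; move: nz; rewrite e !inE set_joinC !inr_mem_join.
  rewrite !inE => nv ->; rewrite set_joinC !inr_mem_join nv; split.
    by apply/mem_yset_im => -[u /esym]; apply: young_disjoint => x y; rewrite !mk_finjE.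
  by apply/mem_yset_im; exists v.
move=> y /andP[/andP[_ nl] nr]; have [->//|/fjoin_case[]] := eqVneq (T y) triv.
  by move=> h; case/negP: nl; apply/mem_yset_im.
by move=> h; case/negP: nr; apply/mem_yset_im.
Qed.

Lemma sum_set_join (V : nmodType) (f : {set K + L} -> V) :
  \sum_S f S = \sum_A \sum_E f (set_join A E).
Proof.
rewrite pair_bigA (reindex (fun p : {set K} * {set L} => set_join p.1 p.2)) //.
exists (fun S : {set K + L} => (inlj K L @^-1: S, inrj K L @^-1: S)) => [[A E] _|S _].
  by congr pair; apply/setP => x; rewrite inE mk_finjE mem_set_join.
by apply/setP => s; rewrite mem_set_join; case: s => x; rewrite inE mk_finjE.
Qed.

End JoinSets.

Lemma coproduct_mul x y :
  D (mul (x ⊗ y)) = tensor_mul (algB X Y) (D x ⊗ D y).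
Proof.
elim/(B_ind (X := X) k0): x => [|x x' ex ex'|K F].
- by rewrite tens0l !raddf0 tens0l raddf0.
- by rewrite tensBl !raddfB ex ex' /= tensBl raddfB.
elim/(B_ind (X := X) k0): y => [|y y' ey ey'|L G].
- by rewrite tens0r !raddf0.
- by rewrite !raddfB ey ey'.
rewrite (mulBE k0) !DE tens_suml raddf_sum.
rewrite sum_set_join.
apply: eq_bigr => A _; rewrite tens_sumr raddf_sum; apply: eq_bigr => E _.
rewrite tensMnl tensMnr !raddfMn tensor_mulE -mulrnA mulnC -weight_set_join.
by rewrite set_joinC !piR_set_join.
Qed.

(** ** The antipode *)

Let eta (z : int) : B := one *~ z.
Fact eta_zmod : zmod_morphism eta.
Proof. by move=> x y; rewrite /eta mulrzBr. Qed.
Let etaA : {additive int -> B} := HB.pack eta (GRing.isZmodMorphism.Build _ _ _ eta_zmod).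
Let eps_eta : {additive B -> B} := etaA \o epsB X Y.
Let aug : {additive B -> B} := idfun \- eps_eta.

Let eps_etaE (N : finType) (F : colour N) : eps_eta (piB F) = one *+ (#|N| == 0)%N.
Proof. by rewrite /= epsBE // /eta; case: eqP. Qed.

Let aug_piR0 (N : finType) (F : colour N) (K : {set N}) : #|K| = 0%N -> aug (piR F K) = 0.
Proof.
move=> K0; rewrite /= epsBE // card_subft K0 /eta /piR.
by rewrite (piB_void k0) ?card_subft // subrr.
Qed.

(** A left convolution inverse S of id is a fixed point of
    S |-> eta eps - S . (id - eta eps), where . is the convolution. The iterates of
    this map are stationary in each degree, because id - eta eps vanishes in
    degree 0 and the value on pi_F therefore involves the previous iterate on
    proper subsets only. *)
Fixpoint antipode_iter (n : nat) : {additive B -> B} :=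
  if n is n'.+1 then eps_eta \- (mul \o (tensor_map (antipode_iter n') aug \o D))
  else eps_eta.

Let iterS n (N : finType) (F : colour N) :
  antipode_iter n.+1 (piB F) = eps_eta (piB F) -
    \sum_(K : {set N}) mul (antipode_iter n (piR F K) ⊗ aug (piR F (~: K))) *+ weight F K.
Proof.
rewrite -[LHS]/(_ - mul (tensor_map (antipode_iter n) aug (D (piB F)))) coproduct_map2.
by congr (_ - _); apply: eq_bigr => K _; rewrite tensor_mapE.
Qed.

Let iter_stable n (N : finType) (F : colour N) : (#|N| <= n)%N ->
  antipode_iter n.+1 (piB F) = antipode_iter n (piB F).
Proof.
elim: n => [|n IH] in N F *.
  rewrite leqn0 => /eqP N0; rewrite iterS big1 ?subr0 // => K _.
  rewrite aug_piR0 ?tens0r ?raddf0 ?mul0rn //.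
  by apply/eqP; rewrite -leqn0 -N0 max_card.
move=> Nn; rewrite 2!iterS; congr (_ - _); apply: eq_bigr => K _; congr (_ *+ _).
have [->|KT] := eqVneq K setT; first by rewrite setCT aug_piR0 ?cards0 // !tens0r.
rewrite IH // card_subft -ltnS (leq_trans _ Nn) // -cardsT proper_card //.
by rewrite properT.
Qed.

Let iter_le m n (N : finType) (F : colour N) : (#|N| <= m)%N -> (m <= n)%N ->
  antipode_iter n (piB F) = antipode_iter m (piB F).
Proof.
move=> Nm /subnK <-; elim: (n - m)%N => // d IH.
by rewrite addSn iter_stable ?(leq_trans Nm) ?leq_addl.
Qed.

Let iter_deg n d x : degB d x -> degB d (antipode_iter n x).
Proof.
elim: n d x => [|n IH] d x; move: x; apply: (degB_ind (X := X) k0);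
  try by [rewrite raddf0; apply: zspan0|move=> x y hx hy; rewrite raddfB; apply: zspanB].
  move=> N F <-; rewrite [antipode_iter 0]/= eps_etaE; case: eqP => [->|_]; last exact: zspan0.
  by rewrite -card_void; apply: degB_piB.
have aug_deg e z : degB e z -> degB e (aug z).
  move=> ez; apply: zspanB => //; move: z ez; apply: (degB_ind (X := X) k0).
  - by rewrite raddf0; apply: zspan0.
  - by move=> z z' hz hz'; rewrite raddfB; apply: zspanB.
  move=> N F <-; rewrite eps_etaE; case: eqP => [->|_]; last exact: zspan0.
  by rewrite -card_void; apply: degB_piB.
move=> N F <-; rewrite iterS; apply: zspanB.
  rewrite eps_etaE; case: eqP => [->|_]; last exact: zspan0.
  by rewrite -card_void; apply: degB_piB.
apply: zspan_sum => K _; apply: zspanMn; rewrite -(cardsC K).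
apply: (degB_mul k0); first by apply/IH/degB_piR.
exact/aug_deg/degB_piR.
Qed.

(** On a set of size n the n-th iterate is final, so S pi_F is its value there. It is
    also a right inverse, since D is cocommutative and the product commutative. *)
Lemma antipode_exists : has_antipode (A := algB X Y) D (epsB X Y).
Proof.
have [|S SE] := B_lift k0 (f := fun N (F : colour N) => antipode_iter #|N| (piB F)).
  move=> N M w F F' e; rewrite (piB_iso k0 e).
  by rewrite (bij_eq_card (Bijective (fwdK w) (bwdK w))).
have Sl x : mul (tensor_map S idfun (D x)) = one *~ epsB X Y x.
  rewrite -[RHS]/(eps_eta x).
  elim/(B_ind (X := X) k0): x => [|x y ex ey|N F]; first by rewrite !raddf0.
    by rewrite !raddfB ex ey.
  have := iter_stable F (leqnn #|N|); rewrite iterS => /eqP.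
  rewrite subr_eq addrC => /eqP ->; rewrite coproduct_map2.
  have -> : antipode_iter #|N| (piB F) = \sum_(K : {set N})
      mul (antipode_iter #|N| (piR F K) ⊗ eps_eta (piR F (~: K))) *+ weight F K.
    rewrite (bigD1 setT) // big1 => [|K /andP[_ KT]]; last first.
      have -> : eps_eta (piR F (~: K)) = 0.
        rewrite /piR eps_etaE card_subft cards_eq0; case: eqP => // e.
        by case/eqP: KT; rewrite -[K]setCK e setC0.
      by rewrite tens0r raddf0 mul0rn.
    rewrite -[RHS]/(_ + 0) addr0 weightT setCT (piR_T k0) piR_0 eps_etaE card_void.
    by rewrite (mulB1r k0).
  rewrite -big_split; apply: eq_bigr => K _ /=; rewrite tensor_mapE -mulrnDl.
  rewrite -raddfD -tensDr /= subrK SE; congr (mul (_ ⊗ _) *+ _).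
  by apply/esym/iter_le; rewrite // card_subft max_card.
exists S; split=> [d x|x|x]; [|exact: Sl|].
  move: x; apply: (degB_ind (X := X) k0) => [|x y hx hy|N F <-].
  - by rewrite raddf0; apply: zspan0.
  - by rewrite raddfB; apply: zspanB.
  by rewrite SE; apply/iter_deg/degB_piB.
rewrite -Sl -{2}(coproduct_cocomm x); move: (D x).
apply: (@tens_eqf _ _ _ (mul \o tensor_map idfun S) (mul \o (tensor_map S idfun \o tensor_swap B B))).
by move=> a b /=; rewrite tensor_swapE !tensor_mapE mulBC.
Qed.

Theorem coproduct_hopf :
  is_graded_hopf_algebra (A := algB X Y) D (epsB X Y)
  /\ cocommutative_coalgebra (A := algB X Y) D.
Proof.
split; last exact: coproduct_cocomm.
split; [exact: graded_algebraB| | |exact: antipode_exists].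
  split; [exact: coproduct_deg| |exact: coproduct_coassoc|exact: coproduct_counit].
  move=> d x dx d0; move: x dx; apply: (degB_ind (X := X) k0) => [|x y ex ey|N F Nd].
  - by rewrite raddf0.
  - by rewrite raddfB ex ey subrr.
  by rewrite epsBE // Nd (negPf d0).
split; [exact: coproduct_one|exact: coproduct_mul|by rewrite epsBE // card_void|].
move=> x y; elim/(B_ind (X := X) k0): x => [|x x' ex ex'|K F].
- by rewrite tens0l !raddf0 mul0r.
- by rewrite tensBl !raddfB /= ex ex' mulrBl.
elim/(B_ind (X := X) k0): y => [|y y' ey ey'|L G].
- by rewrite tens0r !raddf0 mulr0.
- by rewrite !raddfB /= ey ey' mulrBr.
by rewrite /= mulBE // !epsBE // card_sum addn_eq0 -mulnb natrM.
Qed.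

End Coproduct.

(** * Sums over orbit representatives *)

Section OrbitSums.
Variables (aT : finGroupType) (T : finType) (to : {action aT &-> T}) (A : {group aT}).
Local Notation reps := (orbit_transversal to A setT).

Let reps_props : [/\ {in reps &, injective (orbit to A)}
  & orbit to A @: reps = orbit to A @: setT].
Proof.
have aS : [acts A, on [set: T] | to] by apply/actsP => a _ x; rewrite !inE.
have [_ _ inj surj] := orbit_transversalP aS; split.
  move=> x y xr yr e; apply/eqP; rewrite -inj // e; exact: orbit_refl.
apply/eqP; rewrite eqEsubset imsetS ?subsetT //=.
apply/subsetP => _ /imsetP[x _ ->]; have [a aA xa] := surj x (in_setT x).
by apply/imsetP; exists (to x a) => //; apply/esym/orbit_eqP; rewrite mem_orbit.
Qed.

Variables (V : nmodType) (h : T -> V).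
Hypothesis h_inv : forall a x, a \in A -> h (to x a) = h x.

(** This turns the sums over orbit representatives in the coproducts of M into the sums
    over all subsets in those of B. *)
Lemma sum_orbit_reps : \sum_(x in reps) h x *+ #|orbit to A x| = \sum_x h x.
Proof.
have [inj e] := reps_props.
rewrite [RHS](partition_big_imset (orbit to A)).
transitivity (\sum_(O in orbit to A @: reps) \sum_(y | orbit to A y == O) h y); last first.
  apply: eq_big => [O|//]; rewrite e; apply/imsetP/imsetP => -[x _ ->]; exists x => //.
rewrite [RHS]big_imset //; apply: eq_bigr => x _ /=.
rewrite (eq_bigl (fun y => y \in orbit to A x)) => [|y]; last by rewrite orbit_eq_mem.
rewrite (eq_bigr (fun=> h x)) => [|_ /orbitP[a aA <-]]; last exact: h_inv.
by rewrite sumr_const.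
Qed.

(** The right hand side does not involve the chosen representatives, so it can be
    transported along maps that respect orbits. *)
Lemma sum_reps_orbits :
  \sum_(x in reps) h x
  = \sum_(O in orbit to A @: setT) (if [pick x in O] is Some x then h x else 0).
Proof.
have [inj <-] := reps_props; rewrite [RHS]big_imset //; apply: eq_bigr => x _.
case: pickP => [_ /orbitP[a aA <-]|/(_ x)]; first by rewrite h_inv.
by rewrite orbit_refl.
Qed.

End OrbitSums.

Lemma sum_reps_transport (aT aT' : finGroupType) (T T' : finType)
    (to : {action aT &-> T}) (to' : {action aT' &-> T'}) (A : {group aT}) (A' : {group aT'})
    (V : nmodType) (h : T -> V) (h' : T' -> V) (b : T -> T') :
    injective b -> b @: setT = setT ->
    (forall x, orbit to' A' (b x) = b @: orbit to A x) ->
    (forall a x, a \in A -> h (to x a) = h x) -> (forall a x, a \in A' -> h' (to' x a) = h' x) ->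
    (forall x, h' (b x) = h x) ->
  \sum_(x in orbit_transversal to' A' setT) h' x = \sum_(x in orbit_transversal to A setT) h x.
Proof.
move=> b_inj bT b_orb h_inv h'_inv hb.
rewrite !sum_reps_orbits // -bT -imset_comp.
rewrite (eq_imset (g := (fun O : {set T} => b @: O) \o orbit to A)) => [|x]; last exact: b_orb.
rewrite imset_comp big_imset; last by move=> O O' _ _; apply: imset_inj.
apply: eq_bigr => _ /imsetP[x _ ->].
case: pickP => [_ /imsetP[_ /orbitP[a aA <-] ->]|/(_ (b x))]; last first.
  by rewrite imset_f ?orbit_refl.
case: pickP => [_ /orbitP[a' aA' <-]|/(_ x)]; last by rewrite orbit_refl.
by rewrite hb !h_inv.
Qed.

(** * The group M *)

Section AlgebraM.
Variables (k : closedFieldType) (k0 : [pchar k] =i pred0).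
Variables (H : finGroupType) (X : irr_reps k H) (Y : young_set).
Local Notation colour N := {ffun Y N -> X}.
Local Notation M := (Mcar X Y).
Local Notation triv := (htriv X).
Local Notation iso F F' w := (forall y, F' (ymap Y (fwd w) y) = F y).
Local Notation chR G := (charR k G).

Definition fiso_id (N : finType) : fiso N N :=
  FIso (fun x => etrans (finj_idE (finj_id N x)) (finj_idE x))
       (fun x => etrans (finj_idE (finj_id N x)) (finj_idE x)).

Lemma iso_id (N : finType) (F : colour N) : iso F F (fiso_id N).
Proof. by move=> y; rewrite ymap1. Qed.

Lemma iso_inv (N N' : finType) (w : fiso N N') (F : colour N) (F' : colour N') :
  iso F F' w -> iso F' F (fiso_inv w).
Proof. by move=> e y; rewrite -e ymap_bwdK. Qed.

Lemma conj_permE (N N' : finType) (w : fiso N N') g x :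
  conj_perm w g x = bwd w (g (fwd w x)).
Proof. by rewrite permE !finj_compE pinjE. Qed.

Lemma conj_perm_id (N : finType) g : conj_perm (fiso_id N) g = g.
Proof. by apply/permP => x; rewrite conj_permE !finj_idE. Qed.

Lemma conj_permK (N N' : finType) (w : fiso N N') :
  cancel (conj_perm w) (conj_perm (fiso_inv w)).
Proof. by move=> g; apply/permP => x; rewrite !conj_permE /= !bwdK. Qed.

Lemma conj_permKV (N N' : finType) (w : fiso N N') :
  cancel (conj_perm (fiso_inv w)) (conj_perm w).
Proof. by move=> g; apply/permP => x; rewrite !conj_permE /= !fwdK. Qed.

Lemma conj_permM (N N' : finType) (w : fiso N N') : {morph conj_perm w : g h / (g * h)%g}.
Proof. by move=> g h; apply/permP => x; rewrite permM !conj_permE bwdK permM. Qed.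

Section Iso.
Variables (N N' : finType) (w : fiso N N') (F : colour N) (F' : colour N').
Hypothesis e : iso F F' w.

Fact conj_aut_in : {in AutF F', forall g, conj_perm w g \in AutF F}.
Proof.
move=> g /aut_setP hg; apply/aut_setP => y.
by rewrite -e conj_pinj !ymapM ymap_bwdK hg e.
Qed.

Fact conj_aut_morph : {in AutF F' &, {morph conj_perm w : g h / (g * h)%g}}.
Proof. by move=> g h _ _; apply: conj_permM. Qed.

Definition conj_aut : ghom (AutF F') (AutF F) := GHom conj_aut_morph conj_aut_in.

End Iso.

Lemma conj_aut_im (N N' : finType) (w : fiso N N') (F : colour N) (F' : colour N') :
  iso F F' w -> conj_perm w @: AutF F' = AutF F.
Proof.
move=> e; apply/setP => g; apply/imsetP/idP => [[g' g'F ->]|gF]; first exact: (conj_aut_in e).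
by exists (conj_perm (fiso_inv w) g); rewrite ?conj_permKV // (conj_aut_in (iso_inv e)).
Qed.

(** The relation x' = Ad_w x. It is expressed through characters, which makes sense
    for any F' isomorphic to F by w, whereas Ad_w takes values in R(Aut wF), a
    type that is only propositionally equal to R(Aut F'). *)
Definition chiso (N N' : finType) (w : fiso N N') (F : colour N) (F' : colour N')
    (x : RAut F) (x' : RAut F') : Prop :=
  forall g, g \in AutF F' -> chR (AutF F') g x' = chR (AutF F) (conj_perm w g) x.

Local Notation genM F x := (gen (@M_rel k H X Y) (@mk_Mgen k H X Y _ F x)).

Lemma genM_zmod n (F : colour 'I_n) : zmod_morphism (fun x : RAut F => genM F x).
Proof.
move=> x y; apply/(canRL (addrK _)).
have := gen_rel (MAdd (x - y) y); rewrite !raddfB subrK.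
by move/subr0_eq/(canRL (subrK _)) => e; rewrite addrC; exact: esym e.
Qed.

Lemma genM_iso n m (w : fiso 'I_n 'I_m) (F : colour 'I_n) (F' : colour 'I_m)
    (x : RAut F) (x' : RAut F') :
  iso F F' w -> chiso w x x' -> genM F' x' = genM F x.
Proof.
move=> /iso_transp eF; subst F' => xx'.
have -> : x' = pullR k (aut_ad w F) x.
  by apply: (charR_inj k0) => g gF; rewrite charR_pull // xx'.
by have := gen_rel (MAd w x); rewrite raddfB /= => /subr0_eq.
Qed.

Fact clsM_zmod (N : finType) (F : colour N) : zmod_morphism (@clsM k H X Y N F).
Proof. by move=> x y; rewrite /clsM raddfB genM_zmod. Qed.
HB.instance Definition _ N F := GRing.isZmodMorphism.Build _ _ (@clsM k H X Y N F) (@clsM_zmod N F).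

(** The identification gamma = Ad_w gamma, for arbitrary finite sets. *)
Lemma clsM_iso (N N' : finType) (w : fiso N N') (F : colour N) (F' : colour N')
    (x : RAut F) (x' : RAut F') :
  iso F F' w -> chiso w x x' -> clsM x' = clsM x.
Proof.
move=> e xx'.
have vK : cancel (enum_rank \o fwd w \o @enum_val N N) (enum_rank \o bwd w \o @enum_val N' N').
  by move=> i; rewrite /= enum_rankK fwdK enum_valK.
have vK' : cancel (enum_rank \o bwd w \o @enum_val N' N') (enum_rank \o fwd w \o @enum_val N N).
  by move=> i; rewrite /= enum_rankK bwdK enum_valK.
have e' : iso (transp (enum_iso N) F) (transp (enum_iso N') F') (mk_fiso vK vK').
  move=> y; rewrite !ffunE -e -!ymapM; congr (F' (ymap Y _ y)); apply: finj_eq => i.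
  by rewrite !finj_compE !mk_finjE /= enum_rankK.
apply: (genM_iso e') => g gF.
rewrite charR_pull // xx'; last exact: (ghom_in (aut_ad (enum_iso N') F')).
have eg : conj_perm w (conj_perm (enum_iso N') g)
    = conj_perm (enum_iso N) (conj_perm (mk_fiso vK vK') g).
  by apply/permP => i; rewrite !conj_permE !mk_finjE /= !enum_rankK.
rewrite charR_pull; last exact: conj_aut_in e' _ gF.
by rewrite -[aut_ad _ _ g]/(conj_perm _ g) eg.
Qed.

Lemma clsM_span (x : M) :
  zspan (fun y => exists (N : finType) (F : colour N) (z : RAut F), y = clsM z) x.
Proof.
apply: zspan_mono (pres_span x) => _ [[[n F] z] ->]; apply: zspan_base.
exists 'I_n, F, z; apply/esym; apply: (genM_iso (w := enum_iso 'I_n)).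
  exact: transp_iso.
by move=> g gF; rewrite charR_pull.
Qed.

Lemma M_ind (P : M -> Prop) :
    P 0 -> (forall x y, P x -> P y -> P (x - y)) ->
    (forall (N : finType) (F : colour N) (z : RAut F), P (clsM z)) ->
  forall x, P x.
Proof.
move=> P0 PB PF x; apply: zspan_ind (clsM_span x) => // _ [N [F [z ->]]].
exact: PF.
Qed.

Lemma M_lift (C : zmodType) (f : forall (N : finType) (F : colour N), RAut F -> C) :
    (forall (N : finType) (F : colour N) x y, @f N F (x - y) = f N F x - f N F y) ->
    (forall (N N' : finType) (w : fiso N N') (F : colour N) (F' : colour N')
       (x : RAut F) (x' : RAut F'), iso F F' w -> chiso w x x' -> f N' F' x' = f N F x) ->
  exists phi : {additive M -> C},
    forall (N : finType) (F : colour N) (x : RAut F), phi (clsM x) = f N F x.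
Proof.
move=> fB f_iso.
have f0 N F : f N F 0 = 0 by rewrite -(subrr 0) fB subrr.
have fD N F x y : f N F (x + y) = f N F x + f N F y.
  by rewrite -{1}[y]opprK -[- y]sub0r !fB f0 sub0r opprK.
have [|phi phiE] := @pres_lift _ (@M_rel k H X Y) C
  (fun t => f 'I_(tag (tag t)) (tagged (tag t)) (tagged t)).
  move=> g gE r [n F x y|n m w F x]; rewrite !raddfB !gE /=.
    by rewrite fD addrAC addrK subrr.
  apply/eqP; rewrite subr_eq0; apply/eqP; apply: f_iso; first exact: transp_iso.
  by move=> a aF; rewrite charR_pull.
exists phi => N F x; rewrite /clsM phiE /=; apply: f_iso; first exact: transp_iso.
by move=> a aF; rewrite charR_pull.
Qed.

Lemma chiso_id (N : finType) (F : colour N) (x : RAut F) : chiso (fiso_id N) x x.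
Proof. by move=> g _; rewrite conj_perm_id. Qed.

(** f is asked to be additive on the tensor product of the two Grothendieck groups, so
    only its compatibility with isomorphisms has to be verified. *)
Lemma M_lift2 (C : zmodType) (f : forall (N L : finType) (F : colour N) (G : colour L),
      {additive tensor (RAut F) (RAut G) -> C}) :
    (forall (N N' L L' : finType) (w : fiso N N') (v : fiso L L')
       (F : colour N) (F' : colour N') (G : colour L) (G' : colour L')
       (x : RAut F) (x' : RAut F') (y : RAut G) (y' : RAut G'),
       iso F F' w -> iso G G' v -> chiso w x x' -> chiso v y y' ->
       f N' L' F' G' (x' ⊗ y') = f N L F G (x ⊗ y)) ->
  exists phi : {additive tensor M M -> C},
    forall (N L : finType) (F : colour N) (G : colour L) (x : RAut F) (y : RAut G),
      phi (clsM x ⊗ clsM y) = f N L F G (x ⊗ y).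
Proof.
move=> f_iso.
have exL (L : finType) (G : colour L) (y : RAut G) : exists phi : {additive M -> C},
    forall (N : finType) (F : colour N) (x : RAut F), phi (clsM x) = f N L F G (x ⊗ y).
  apply: M_lift => [N F x x'|N N' w F F' x x' e xx']; first by rewrite tensBl raddfB.
  exact: (f_iso _ _ _ _ w (fiso_id L) _ _ _ _ _ _ _ _ e (@iso_id _ _) xx' (@chiso_id _ _ _)).
pose P L G y := projT1 (cid (@exL L G y)).
have PE L G y N F x : P L G y (clsM x) = f N L F G (x ⊗ y) by apply: (projT2 (cid (@exL L G y))).
have exM (x : M) : exists phi : {additive M -> C},
    forall (L : finType) (G : colour L) (y : RAut G), phi (clsM y) = P L G y x.
  apply: M_lift => [L G y y'|L L' v G G' y y' e yy'].
    elim/M_ind: x => [|x x' ex ex'|N F x]; first by rewrite !raddf0 addr0.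
      by rewrite !raddfB ex ex' !opprD addrACA.
    by rewrite !PE -raddfB; congr (f _ _ _ _ _); rewrite raddfB.
  elim/M_ind: x => [|x x' ex ex'|N F x]; first by rewrite !raddf0.
    by rewrite !raddfB ex ex'.
  by rewrite !PE (f_iso _ _ _ _ (fiso_id N) v _ _ _ _ _ _ _ _ (@iso_id _ _) e (@chiso_id _ _ _) yy').
have [Q QE] := choice exM.
have [x x' y|x y y'|phi phiE] := @tensor_lift M M C (fun x y => Q x y).
- elim/M_ind: y => [|y y' ey ey'|L G y]; first by rewrite !raddf0 addr0.
    by rewrite !raddfB ey ey' opprD addrACA.
  by rewrite !QE raddfD.
- by rewrite raddfD.
by exists phi => N L F G x y; rewrite phiE QE PE.
Qed.

End AlgebraM.

(** * The product and the coproducts of M *)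

Section RegularEmbedding.
Variables (k : closedFieldType) (k0 : [pchar k] =i pred0).
Variables (H : finGroupType) (X : irr_reps k H) (Y : young_set).
Local Notation colour N := {ffun Y N -> X}.
Local Notation M := (Mcar X Y).
Local Notation triv := (htriv X).
Local Notation iso F F' w := (forall y, F' (ymap Y (fwd w) y) = F y).
Local Notation chR G := (charR k G).
Local Notation reg F := (clsR (regular_repr k (AutF F))).

(** ** The product *)

Section JoinIso.
Variables (N N' L L' : finType) (w : fiso N N') (v : fiso L L').
Variables (F : colour N) (F' : colour N') (G : colour L) (G' : colour L').
Hypotheses (eF : iso F F' w) (eG : iso G G' v).

Definition sum_map (A A' B B' : Type) (f : A -> A') (g : B -> B') (s : A + B) : A' + B' :=
  match s with inl x => inl (f x) | inr y => inr (g y) end.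

Fact sum_fwdK : cancel (sum_map (fwd w) (fwd v)) (sum_map (bwd w) (bwd v)).
Proof. by case=> x /=; rewrite fwdK. Qed.
Fact sum_bwdK : cancel (sum_map (bwd w) (bwd v)) (sum_map (fwd w) (fwd v)).
Proof. by case=> x /=; rewrite bwdK. Qed.
Definition fiso_sum : fiso (N + L)%type (N' + L')%type := mk_fiso sum_fwdK sum_bwdK.

Lemma fjoin_iso : iso (fjoin triv F G) (fjoin triv F' G') fiso_sum.
Proof.
move=> y.
have wl u : ymap Y (fwd fiso_sum) (ymap Y (inlj N L) u) = ymap Y (inlj N' L') (ymap Y (fwd w) u).
  by rewrite -!ymapM; congr (ymap Y _ u); apply: finj_eq => x; rewrite !finj_compE !mk_finjE.
have wr u : ymap Y (fwd fiso_sum) (ymap Y (inrj N L) u) = ymap Y (inrj N' L') (ymap Y (fwd v) u).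
  by rewrite -!ymapM; congr (ymap Y _ u); apply: finj_eq => x; rewrite !finj_compE !mk_finjE.
have [/mem_yset_im[u ->]|nl] := boolP (y \in yset Y (inlj N L @: setT)).
  by rewrite wl !fjoin_inl.
have [/mem_yset_im[u ->]|nr] := boolP (y \in yset Y (inrj N L @: setT)).
  by rewrite wr !fjoin_inr.
have ny : y \notin yset2 Y (inlj N L @: setT) by rewrite inE negb_or nl -imset_inr.
rewrite [RHS]fjoin_supp // fjoin_supp //.
have -> : inlj N' L' @: setT = fwd fiso_sum @: (inlj N L @: setT).
  apply/setP => s; apply/imsetP/imsetP => [[x _ ->]|[_ /imsetP[x _ ->] ->]].
    exists (inlj N L (bwd w x)); first exact: imset_f.
    by rewrite !mk_finjE /= bwdK.
  by exists (fwd w x); rewrite // !mk_finjE.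
by rewrite mem_yset2_fwd.
Qed.

Definition pair_conj (p : {perm N'} * {perm L'}) := (conj_perm w p.1, conj_perm v p.2).

Fact pair_conj_morph : {in setX_group (AutF F') (AutF G') &, {morph pair_conj : p q / (p * q)%g}}.
Proof. by move=> p q _ _; rewrite /pair_conj !conj_permM. Qed.
Fact pair_conj_in :
  {in setX_group (AutF F') (AutF G'), forall p, pair_conj p \in setX_group (AutF F) (AutF G)}.
Proof.
by case=> g h /setXP[gF hG]; apply/setXP; split; [apply: (conj_aut_in eF)|apply: (conj_aut_in eG)].
Qed.
Definition pair_conj_ghom := GHom pair_conj_morph pair_conj_in.

Lemma pair_conj_inj : injective pair_conj.
Proof.
case=> g h [g' h'] [eg eh].
by rewrite (can_inj (conj_permK w) eg) (can_inj (conj_permK v) eh).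
Qed.

Lemma pair_conj_im : pair_conj @: setX_group (AutF F') (AutF G') = setX_group (AutF F) (AutF G).
Proof.
apply/setP => -[g h]; apply/imsetP/setXP => [[p pG e]|[gF hG]].
  by apply/setXP; rewrite e; apply: pair_conj_in.
exists (conj_perm (fiso_inv w) g, conj_perm (fiso_inv v) h).
  by apply/setXP; split; [apply: (conj_aut_in (iso_inv eF))|apply: (conj_aut_in (iso_inv eG))].
by rewrite /pair_conj /= !conj_permKV.
Qed.

(** Stated for all t rather than for t = x ⊗ y, since values of unboxR need not be
    pure tensors. *)
Lemma charR_box_conj (t : tensor (RAut F) (RAut G)) (t' : tensor (RAut F') (RAut G')) :
    t' = tensor_map (pullR k (conj_aut eF)) (pullR k (conj_aut eG)) t ->
  forall p, p \in setX_group (AutF F') (AutF G') ->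
    chR _ p (boxR k _ _ t') = chR (setX_group (AutF F) (AutF G)) (pair_conj p) (boxR k _ _ t).
Proof.
move=> -> {t'} [g h] /setXP[gF hG]; rewrite /pair_conj /=.
move: t (tens_span t); apply: zspan_ind => [|t t' et et'|_ [x [y ->]]].
- by rewrite !raddf0.
- by rewrite !raddfB et et'.
rewrite tensor_mapE !(charR_box k0) // ?charR_pull //; first exact: (conj_aut_in eF).
exact: (conj_aut_in eG).
Qed.

End JoinIso.

Definition mul_box (N L : finType) (F : colour N) (G : colour L) :
    {additive tensor (RAut F) (RAut G) -> M} :=
  @clsM k H X Y _ (fjoin triv F G) \o
    (indR k (@aut_sum_inj Y X triv N L F G) \o boxR k (AutF F) (AutF G)).

Lemma mul_box_iso (N N' L L' : finType) (w : fiso N N') (v : fiso L L')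
   (F : colour N) (F' : colour N') (G : colour L) (G' : colour L')
   (x : RAut F) (x' : RAut F') (y : RAut G) (y' : RAut G') :
   iso F F' w -> iso G G' v -> chiso w x x' -> chiso v y y' ->
   mul_box F' G' (x' ⊗ y') = mul_box F G (x ⊗ y).
Proof.
move=> eF eG xx' yy'; apply: (clsM_iso k0 (fjoin_iso eF eG)) => g gJ.
apply: (ind_transport k0 _ _ (a := pair_conj_ghom eF eG) (b := conj_aut (fjoin_iso eF eG))) gJ.
- by move=> p q _ _; apply: pair_conj_inj.
- exact: pair_conj_im.
- by move=> p q _ _; apply: (can_inj (conj_permK _)).
- exact: conj_aut_im (fjoin_iso eF eG).
- by move=> p _; apply/permP => s; rewrite conj_permE !permE !mk_finjE; case: s => z /=; rewrite conj_permE.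
case=> g1 g2 gG; have [g1F g2G] := setXP gG.
have g1F' := conj_aut_in eF g1F; have g2G' := conj_aut_in eG g2G.
by rewrite !(charR_box k0) // xx' ?yy'.
Qed.

Lemma mulME (N L : finType) (F : colour N) (G : colour L) (x : RAut F) (y : RAut G) :
  mulM X Y (clsM x ⊗ clsM y) = mul_box F G (x ⊗ y).
Proof.
pose P (f : tensor M M -> M) :=
  forall (K L : finType) (FK : {ffun Y K -> X}) (FL : {ffun Y L -> X})
      m (V : mx_representation k (AutF FK) m)
      n (W : mx_representation k (AutF FL) n),
    f (clsM (clsR V) ⊗ clsM (clsR W)) =
    @clsM k H X Y _ (fjoin (htriv X) FK FL)
      (clsR (ind_repr (@aut_sum_inj _ _ (htriv X) _ _ FK FL) (box_repr V W))).
have mE : P (mulM X Y).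
  apply: (@the_additiveP _ _ P).
  have [phi phiE] := M_lift2 k0 mul_box_iso.
  exists phi => K K' FK FL m V n W; rewrite phiE -(indRE k0) -(boxRE k0) //.
have : forall t, mul_box F G t = (mulM X Y \o tensor_map (@clsM k H X Y N F) (@clsM k H X Y L G)) t.
  apply: tens_eqf => a b; rewrite -[RHS]/(mulM X Y (tensor_map _ _ (a ⊗ b))) tensor_mapE.
  elim/R_ind: a => [|a a' ea ea'|m V]; first by rewrite raddf0 !tens0l !raddf0.
    by rewrite raddfB !tensBl !raddfB ea ea'.
  elim/R_ind: b => [|b b' eb eb'|n W]; first by rewrite !(raddf0, tens0r).
    by rewrite !raddfB eb eb'.
  by rewrite mE /mul_box /= (boxRE k0) (indRE k0).
by move=> /(_ (x ⊗ y)) -> /=; rewrite tensor_mapE.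
Qed.

(** ** The coproducts *)

Lemma conj_norm (N N' : finType) (w : fiso N N') (K : {set N}) g :
  (g \in 'N(fwd w @: K | 'P))%g -> (conj_perm w g \in 'N(K | 'P))%g.
Proof.
move=> /astabsP hg; apply/astabsP => x.
have im z : (fwd w z \in fwd w @: K) = (z \in K) by apply: mem_imset; apply: finjP.
by rewrite -[RHS]im -hg -[LHS]im /= /aperm conj_permE bwdK.
Qed.

Lemma imset_fwd_bwd (N N' : finType) (w : fiso N N') (K : {set N}) :
  bwd w @: (fwd w @: K) = K.
Proof. by rewrite -imset_comp (eq_imset (g := id)) ?imset_id // => x /=; rewrite fwdK. Qed.

Section StabIso.
Variables (N N' : finType) (w : fiso N N') (F : colour N) (F' : colour N').
Hypothesis e : iso F F' w.
Variable K : {set N}.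
Local Notation K' := (fwd w @: K).

Fact conj_stab_in : {in aut_stab F' K', forall g, conj_perm w g \in aut_stab F K}.
Proof.
move=> g /setIP[gF gK]; apply/setIP; split; first exact: (conj_aut_in e).
exact: conj_norm.
Qed.
Fact conj_stab_morph : {in aut_stab F' K' &, {morph conj_perm w : g h / (g * h)%g}}.
Proof. by move=> g h _ _; apply: conj_permM. Qed.
Definition conj_stab : ghom (aut_stab F' K') (aut_stab F K) := GHom conj_stab_morph conj_stab_in.

End StabIso.

Lemma conj_stab_im (N N' : finType) (w : fiso N N') (F : colour N) (F' : colour N') (K : {set N}) :
  iso F F' w -> conj_perm w @: aut_stab F' (fwd w @: K) = aut_stab F K.
Proof.
move=> e; apply/setP => g; apply/imsetP/idP => [[g' g'F ->]|gF]; first exact: (conj_stab_in e).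
exists (conj_perm (fiso_inv w) g); rewrite ?conj_permKV //.
by apply: (conj_stab_in (iso_inv e)); rewrite /= imset_fwd_bwd.
Qed.

Lemma restr_fiso (N N' : finType) (w : fiso N N') (K : {set N}) (K' : {set N'}) :
  K' = fwd w @: K -> exists v : fiso (subft K) (subft K'), forall x, val (fwd v x) = fwd w (val x).
Proof.
move=> ->; have hK (x : subft K) : fwd w (val x) \in fwd w @: K by rewrite imset_f ?(valP x).
pose f (x : subft K) : subft (fwd w @: K) := Sub (fwd w (val x)) (hK x).
have f_inj : injective f by move=> x y /(congr1 val) /= /finjP /val_inj.
have [|v vE] := bij_fiso (f := mk_finj f_inj).
  case=> y yK; have /imsetP[x xK ex] := yK; exists (Sub x xK).
  by rewrite mk_finjE; apply: val_inj => /=.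
by exists v => x; rewrite vE mk_finjE.
Qed.

Definition ind_restr (N : finType) (F : colour N) (K : {set N}) :
    {additive Rgrp k (aut_stab F K)
              -> Rgrp k (setX_group (AutF (frestr F K)) (AutF (frestr F (~: K))))} :=
  indR k (@aut_restr_inj Y X N F K).

Definition indstab (N : finType) (F : colour N) (K : {set N}) :
    {additive Rgrp k (aut_stab F K) -> tensor M M} :=
  tensor_map (@clsM k H X Y _ (frestr F K)) (@clsM k H X Y _ (frestr F (~: K)))
    \o (unboxR k _ _ \o ind_restr F K).

Lemma ind_stabE (N : finType) (F : colour N) (K : {set N}) n
    (W : mx_representation k (aut_stab F K) n) : ind_stab W = indstab F K (clsR W).
Proof. by rewrite /ind_stab -(indRE k0). Qed.

(** Under transport by w the induced class, seen as an external product via boxR_surj,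
    is transported by the restrictions w1 and w2 of w to K and to its complement. *)
Lemma indstab_iso (N N' : finType) (w : fiso N N') (F : colour N) (F' : colour N')
    (K : {set N}) (z : Rgrp k (aut_stab F K)) (z' : Rgrp k (aut_stab F' (fwd w @: K))) :
    iso F F' w ->
    (forall g, g \in aut_stab F' (fwd w @: K) -> chR _ g z' = chR _ (conj_perm w g) z) ->
  indstab F' (fwd w @: K) z' = indstab F K z.
Proof.
move=> e zz'; set K' := fwd w @: K.
have [w1 w1E] := restr_fiso (erefl K').
have [w2 w2E] := restr_fiso (imset_fwdC w K).
have e1 : iso (frestr F K) (frestr F' K') w1.
  move=> y; rewrite !ffunE -e -!ymapM; congr (F' (ymap Y _ y)); apply: finj_eq => x.
  by rewrite !finj_compE !mk_finjE w1E.
have e2 : iso (frestr F (~: K)) (frestr F' (~: K')) w2.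
  move=> y; rewrite !ffunE -e -!ymapM; congr (F' (ymap Y _ y)); apply: finj_eq => x.
  by rewrite !finj_compE !mk_finjE w2E.
have b1E x : val (bwd w1 x) = bwd w (val x) by rewrite -{2}[x](bwdK w1) w1E fwdK.
have b2E x : val (bwd w2 x) = bwd w (val x) by rewrite -{2}[x](bwdK w2) w2E fwdK.
have [t tE] := boxR_surj k0 (ind_restr F K z).
pose t' := tensor_map (pullR k (conj_aut e1)) (pullR k (conj_aut e2)) t.
have t'E : ind_restr F' K' z' = boxR k _ _ t'.
  apply: (charR_inj k0) => g gA; rewrite (charR_box_conj (t := t) (erefl t')) // -tE.
  apply: (ind_transport k0 _ _ (a := conj_stab e K) (b := pair_conj_ghom e1 e2)) gA => //.
  - by move=> p q _ _; apply: (can_inj (conj_permK _)).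
  - exact: conj_stab_im.
  - by move=> p q _ _; apply: pair_conj_inj.
  - exact: pair_conj_im.
  move=> d dS; have [_ dK dK'] := aut_stab_setC dS.
  have [_ cK cK'] := aut_stab_setC (conj_stab_in e dS).
  congr pair; apply/permP => x; apply: val_inj.
    by rewrite conj_permE b1E !perm_restrE // conj_permE w1E.
  by rewrite conj_permE b2E !perm_restrE // conj_permE w2E.
rewrite -[LHS]/(tensor_map _ _ (unboxR _ _ _ (ind_restr F' K' z'))).
rewrite -[RHS]/(tensor_map _ _ (unboxR _ _ _ (ind_restr F K z))).
rewrite t'E tE !(unboxRE k0) /t'.
move: t {tE t'E t'}.
apply: (@tens_eqf _ _ _ (tensor_map (@clsM k H X Y _ (frestr F' K')) (@clsM k H X Y _ (frestr F' (~: K')))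
   \o tensor_map (pullR k (conj_aut e1)) (pullR k (conj_aut e2))) (tensor_map _ _)) => a b.
rewrite -[LHS]/(tensor_map _ _ (tensor_map _ _ (a ⊗ b))) !tensor_mapE.
have ea : clsM (pullR k (conj_aut e1) a) = clsM a.
  by apply: (clsM_iso k0 e1) => g gF; rewrite charR_pull.
have eb : clsM (pullR k (conj_aut e2) b) = clsM b.
  by apply: (clsM_iso k0 e2) => g gF; rewrite charR_pull.
exact: (congr2 (@tens M M) ea eb).
Qed.

Section CoproductM.
(** The two coproducts differ by the subsets K that contribute (those with c F K)
    and by the character q F K of (Aut F)_K by which the restriction is twisted. *)
Variable c : forall N : finType, colour N -> {set N} -> bool.
Variable q : forall N : finType, colour N -> {set N} -> {perm N} -> k.
Variable t : forall (N : finType) (F : colour N) (K : {set N}),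
  {additive RAut F -> Rgrp k (aut_stab F K)}.
Hypothesis c_iso : forall (N N' : finType) (w : fiso N N') (F : colour N) (F' : colour N')
  (K : {set N}), iso F F' w -> c F' (fwd w @: K) = c F K.
Hypothesis q_iso : forall (N N' : finType) (w : fiso N N') (F : colour N) (F' : colour N')
  (K : {set N}) g, iso F F' w -> g \in aut_stab F' (fwd w @: K) ->
  q F' (fwd w @: K) g = q F K (conj_perm w g).
Hypothesis tE : forall (N : finType) (F : colour N) (K : {set N}) x g, g \in aut_stab F K ->
  chR (aut_stab F K) g (t F K x) = chR (AutF F) g x * q F K g.

Let term (N : finType) (F : colour N) (K : {set N}) (x : RAut F) : tensor M M :=
  if c F K then indstab F K (t F K x) else 0.

Let term_iso (N N' : finType) (w : fiso N N') (F : colour N) (F' : colour N')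
    (K : {set N}) (x : RAut F) (x' : RAut F') :
  iso F F' w -> chiso w x x' -> term (fwd w @: K) x' = term K x.
Proof.
move=> e xx'; rewrite /term (c_iso _ e); case: ifP => // _.
apply: (indstab_iso e) => g gS; rewrite !tE //; last exact: (conj_stab_in e).
by rewrite (q_iso e) // xx' //; case/setIP: gS.
Qed.

Let aut_iso (N : finType) (F : colour N) g : g \in AutF F -> iso F F (perm_iso g).
Proof. by move/aut_setP. Qed.

Let term_aut (N : finType) (F : colour N) (K : {set N}) (x : RAut F) g :
  g \in AutF F -> term (('P^*)%act K g) x = term K x.
Proof.
move=> gF; have -> : ('P^*)%act K g = fwd (perm_iso g) @: K.
  by apply: eq_imset => y; rewrite mk_finjE.
apply: term_iso (aut_iso gF) _ => h hF.
have -> : conj_perm (perm_iso g) h = (g * h * g^-1)%g.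
  by apply/permP => y; rewrite conj_permE !mk_finjE !permM.
by rewrite charRJ.
Qed.

(** The sum over representatives is well defined because the term of K depends only on
    its orbit: an element of Aut F is an isomorphism from F to itself, for which
    term_iso applies. *)
Lemma coproductM_exists : exists phi : {additive M -> tensor M M},
  forall (N : finType) (F : colour N) (x : RAut F),
    phi (clsM x) = \sum_(K in orbit_reps F | c F K) indstab F K (t F K x).
Proof.
have [|N N' w F F' x x' e xx'|phi phiE] := @M_lift k H X Y (tensor M M)
   (fun N F x => \sum_(K in orbit_reps F) term K x).
- move=> N F x y; rewrite -sumrB; apply: eq_bigr => K _.
  by rewrite /term; case: ifP => _; rewrite ?subr0 // !raddfB.
- apply: (sum_reps_transport (b := fun K : {set N} => fwd w @: K)).
  + exact/imset_inj/finjP.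
  + apply/setP => K; rewrite inE; apply/imsetP; exists (bwd w @: K) => //.
    exact: esym (imset_fwd_bwd (fiso_inv w) K).
  + move=> K; apply/setP => O; apply/orbitP/imsetP => [[g gF <-]|[_ /orbitP[g gF <-] ->]].
      exists (('P^*)%act K (conj_perm w g)).
        by rewrite mem_orbit // (conj_aut_in e).
      rewrite /= /setact -!imset_comp; apply: eq_imset => y /=.
      by rewrite /aperm conj_permE bwdK.
    exists (conj_perm (fiso_inv w) g); first exact: (conj_aut_in (iso_inv e)).
    rewrite /= /setact -!imset_comp; apply: eq_imset => y /=.
    by rewrite /aperm conj_permE /= fwdK.
  + by move=> g K gF; apply: term_aut.
  + by move=> g K gF; apply: term_aut.
  by move=> K; apply: term_iso e xx'.
exists phi => N F x; rewrite phiE big_mkcondr; apply: eq_bigr => K _.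
by rewrite /term.
Qed.

(** All characters involved are supported at the identity, so only degrees matter.
    Inducing the restriction of reg from (Aut F)_K multiplies reg ⊗ reg by the
    index of (Aut F)_K in Aut F, which is the number of conjugates of K. *)
Lemma indstab_regular (N : finType) (F : colour N) (K : {set N}) (m : nat) :
    q F K 1%g = m%:R ->
  indstab F K (t F K (reg F))
  = (clsM (reg (frestr F K)) ⊗ clsM (reg (frestr F (~: K))))
      *+ (m * #|orbit ('P^*)%act (AutF F) K|).
Proof.
move=> q1; set A := AutF F; set S := aut_stab F K.
set A1 := AutF (frestr F K); set A2 := AutF (frestr F (~: K)).
have cA : (#|orbit ('P^*)%act A K| * #|S|)%N = #|A|.
  by rewrite -(card_orbit_stab ('P^*)%act A K) astab1_set.
have -> : indstab F K (t F K (reg F)) = tensor_map (@clsM k H X Y _ (frestr F K))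
    (@clsM k H X Y _ (frestr F (~: K)))
    ((reg (frestr F K) ⊗ reg (frestr F (~: K))) *+ (m * #|orbit ('P^*)%act A K|)).
  rewrite -[LHS]/(tensor_map _ _ (unboxR _ _ _ (ind_restr F K (t F K (reg F))))).
  rewrite -[X in _ = tensor_map _ _ X](unboxRE k0).
  suff -> : ind_restr F K (t F K (reg F)) = boxR k A1 A2
    ((reg (frestr F K) ⊗ reg (frestr F (~: K))) *+ (m * #|orbit ('P^*)%act A K|)) by [].
  apply: (charR_inj k0) => g gA; apply: (mulfI (cardG_neq0 k0 S)).
  have t1 : chR S 1%g (t F K (reg F)) = #|A|%:R * m%:R.
    by rewrite tE ?group1 // charR_regular ?group1 // eqxx q1.
  rewrite (charR_ind_regular k0 _ t1) //; last first.
    move=> d dS d1; rewrite tE // charR_regular ?(negPf d1) ?mul0r //.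
    by case/setIP: dS.
  rewrite raddfMn raddfMn; case: g gA => g1 g2 /setXP[g1A g2A].
  rewrite (charR_box k0) // !charR_regular // -[1%g]/(1%g, 1%g) xpair_eqE.
  case: eqP => _ /=; last by rewrite mul0r mul0rn mulr0.
  case: eqP => _ /=; last by rewrite mulr0 mul0rn mulr0.
  by rewrite cardsX -[in LHS]cA -mulr_natr !natrM; ring.
by rewrite raddfMn tensor_mapE.
Qed.

End CoproductM.
End RegularEmbedding.

(** * The character of the permutation of tensor factors *)

Section TensorTrace.
Variable k : closedFieldType.
Variables (H : finGroupType) (X : irr_reps k H) (Y : young_set).
Local Notation colour N := {ffun Y N -> X}.
Local Notation iso F F' w := (forall y, F' (ymap Y (fwd w) y) = F y).

(** The bases of the two tensor products correspond by relabelling the factors; the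
    index types 'I_(hdim _) of corresponding factors are equal only
    propositionally, so the correspondence is stated on values. *)
Lemma sum_tens_idx (Z Z' : finType) (F : {ffun Z -> X}) (F' : {ffun Z' -> X})
    (s : Z -> Z') (s' : Z' -> Z) (P : tens_idx F -> k) (P' : tens_idx F' -> k) :
    cancel s s' -> cancel s' s -> (forall z, F' (s z) = F z) ->
    (forall (f : tens_idx F) (f' : tens_idx F'),
       (forall z, f z = f' (s z) :> nat) -> P f = P' f') ->
  \sum_f P f = \sum_f P' f.
Proof.
move=> sK s'K e PP'.
have e' z : hdim (F (s' z)) = hdim (F' z) by rewrite -e s'K.
pose th (f : tens_idx F') : tens_idx F :=
  finfun (fun z => cast_ord (congr1 (@hdim k H X) (e z)) (f (s z))).
pose th' (f : tens_idx F) : tens_idx F' := finfun (fun z => cast_ord (e' z) (f (s' z))).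
have thE f z : th f z = f (s z) :> nat by rewrite ffunE.
have thE' f z : th' f z = f (s' z) :> nat by rewrite ffunE.
rewrite (reindex th); first by apply: eq_bigr => f _; apply: PP'.
exists th' => f _; apply/ffunP => z; apply: val_inj; rewrite /= ?thE' ?thE ?thE'.
  by rewrite s'K.
by rewrite sK.
Qed.

(** The trace of a permutation matrix counts fixed basis tensors. *)
Lemma tr_tperm (N : finType) (F : colour N) (K : {set N}) g :
  \tr (tperm_mx F K g) = \sum_(f : tens_idx (restr_out F K))
    [forall y, forall z, (val z == ymap Y (pinj g) (val y)) ==> (f z == f y :> nat)]%:R.
Proof.
rewrite [RHS](big_enum_val (fun f : tens_idx (restr_out F K) => [forall y, forall z,
  (val z == ymap Y (pinj g) (val y)) ==> (f z == f y :> nat)]%:R)).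
by apply: eq_bigr => i _; rewrite mxE.
Qed.

Lemma tr_tperm_iso (N N' : finType) (w : fiso N N') (F : colour N) (F' : colour N')
    (K : {set N}) g : iso F F' w ->
  \tr (tperm_mx F' (fwd w @: K) g) = \tr (tperm_mx F K (conj_perm w g)).
Proof.
move=> e; rewrite !tr_tperm; set K' := fwd w @: K.
have inZ (z : subft (~: yset2 Y K)) : ymap Y (fwd w) (val z) \in ~: yset2 Y K'.
  by rewrite in_setC mem_yset2_fwd -in_setC (valP z).
have inZ' (z : subft (~: yset2 Y K')) : ymap Y (bwd w) (val z) \in ~: yset2 Y K.
  by rewrite in_setC -(mem_yset2_fwd w) ymap_bwdK -in_setC (valP z).
pose s (z : subft (~: yset2 Y K)) : subft (~: yset2 Y K') :=
  exist (fun x => x \in ~: yset2 Y K') _ (inZ z).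
pose s' (z : subft (~: yset2 Y K')) : subft (~: yset2 Y K) :=
  exist (fun x => x \in ~: yset2 Y K) _ (inZ' z).
have sK : cancel s s' by move=> z; apply: val_inj; rewrite /= ymap_fwdK.
have s'K : cancel s' s by move=> z; apply: val_inj; rewrite /= ymap_bwdK.
apply/esym/(sum_tens_idx sK s'K) => [z|f f' ff']; first by rewrite !ffunE /= e.
have cond y z : (val (s z) == ymap Y (pinj g) (val (s y)))
    = (val z == ymap Y (pinj (conj_perm w g)) (val y)).
  rewrite conj_pinj !ymapM /=; apply/eqP/eqP => [<-|->]; first by rewrite ymap_fwdK.
  by rewrite ymap_bwdK.
congr (nat_of_bool _)%:R; apply/forallP/forallP => h y; apply/forallP => z.
  rewrite -[y]s'K -[z]s'K cond -!ff'.
  by move/forallP: (h (s' y)) => /(_ (s' z)).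
by rewrite -cond !ff'; move/forallP: (h (s y)) => /(_ (s z)).
Qed.

Lemma tr_tperm1 (N : finType) (F : colour N) (K : {set N}) :
  \tr (tperm_mx F K 1%g) = (\prod_(y in ~: yset2 Y K) hdim (F y))%:R.
Proof.
rewrite -[tperm_mx F K 1%g]/(tperm_repr F K 1%g) repr_mx1 mxtrace1.
transitivity (\prod_z (hdim (restr_out F K z))%:R : k).
  transitivity (\prod_(z : subft (~: yset2 Y K)) \sum_(i < hdim (restr_out F K z)) (1 : k)).
    by rewrite -big_tens -{1}[#|_|]card_ord -sumr_const; apply: eq_bigr => p _; rewrite big1.
  by apply: eq_bigr => z _; rewrite sumr_const card_ord.
rewrite natr_prod -[in RHS](imset_incl (~: yset2 Y K)) big_imset; last first.
  by move=> y z _ _; apply: finjP.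
by apply: eq_big => [z|z _]; rewrite ?inE // !ffunE.
Qed.

End TensorTrace.

(** * The map reg *)

Section Main.
Variables (k : closedFieldType) (k0 : [pchar k] =i pred0).
Variables (H : finGroupType) (X : irr_reps k H) (Y : young_set).
Local Notation colour N := {ffun Y N -> X}.
Local Notation B := (Bcar k H Y).
Local Notation M := (Mcar X Y).
Local Notation triv := (htriv X).
Local Notation iso F F' w := (forall y, F' (ymap Y (fwd w) y) = F y).
Local Notation chR G := (charR k G).
Local Notation reg F := (clsR (regular_repr k (AutF F))).
Local Notation piB := (@piB k H X Y _).

Lemma card_AutF_iso (N N' : finType) (w : fiso N N') (F : colour N) (F' : colour N') :
  iso F F' w -> #|AutF F'| = #|AutF F|.
Proof.
move=> e; rewrite -(conj_aut_im e) card_in_imset // => g h _ _.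
exact: (can_inj (conj_permK w)).
Qed.

Lemma regBME (N : finType) (F : colour N) : regBM X Y (piB F) = clsM (reg F).
Proof.
move: N F; pose P (f : B -> M) := forall (N : finType) (F : colour N), f (piB F) = clsM (reg F).
apply: (@the_additiveP _ _ P).
apply: (B_lift k0 (f := fun N F => clsM (reg F))) => N N' w F F' e.
apply: (clsM_iso k0 e) => g gF; rewrite !charR_regular // ?(conj_aut_in e) //.
rewrite (card_AutF_iso e) -(inj_eq (can_inj (conj_permK w)) g 1%g).
suff -> : conj_perm w 1%g = 1%g by [].
by apply/permP => x; rewrite conj_permE !perm1 fwdK.
Qed.

(** ** Compatibility with the structure maps *)

Lemma AutF_void (N : finType) (F : colour N) : #|N| = 0%N -> AutF F = 1%g :> {set _}.
Proof.
move=> N0; apply/setP => g; rewrite [RHS]inE.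
have -> : g = 1%g by apply/permP => x; move/card0_eq: N0 => /(_ x).
by rewrite eqxx (group1 (AutF F)).
Qed.

Lemma regBM_one : regBM X Y (piB (empty_fun X Y))
  = @clsM k H X Y _ (empty_fun X Y) (clsR (triv_repr k (AutF (empty_fun X Y)))).
Proof.
rewrite regBME; congr clsM; apply: (charR_inj k0) => g gF.
have A1 := AutF_void (empty_fun X Y) card_void.
rewrite charR_regular // charRE //= mxtrace1.
by move: gF; rewrite A1 inE => ->; rewrite [#|_|](congr1 (fun S : {set _} => #|S|) A1) cards1.
Qed.

(** The induced character of the regular character of Aut F x Aut G is the regular
    character. *)
Lemma regBM_mul (x y : B) :
  regBM X Y (mulB X Y (x ⊗ y)) = mulM X Y (regBM X Y x ⊗ regBM X Y y).
Proof.
elim/(B_ind (X := X) k0): x => [|x x' ex ex'|N F].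
- by rewrite tens0l !raddf0 tens0l raddf0.
- by rewrite tensBl !raddfB ex ex' tensBl raddfB.
elim/(B_ind (X := X) k0): y => [|y y' ey ey'|L G].
- by rewrite tens0r !raddf0.
- by rewrite !raddfB ey ey'.
rewrite (mulBE k0) !regBME (mulME k0); congr clsM; apply: (charR_inj k0) => g gJ.
set A := setX_group (AutF F) (AutF G).
have t1 : chR A 1%g (boxR k _ _ (reg F ⊗ reg G)) = #|A|%:R.
  by rewrite -[1%g]/(1%g, 1%g) (charR_box k0) ?group1 // !charR_regular ?group1 // !eqxx cardsX natrM.
apply: (mulfI (cardG_neq0 k0 A)); rewrite (charR_ind_regular k0 _ t1) //.
  by rewrite charR_regular //; case: eqP => _; rewrite ?mulr0 // mulrC.
case=> a b /setXP[aF bG]; rewrite -[1%g]/(1%g, 1%g) xpair_eqE negb_and => ab.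
rewrite (charR_box k0) // !charR_regular //.
by case/orP: ab => /negPf ->; rewrite ?mul0r ?mulr0.
Qed.

Lemma regBM_deg d (x : B) : degB d x -> degM d (regBM X Y x).
Proof.
move: x; apply: (degB_ind (X := X) k0) => [|x y hx hy|N F Nd].
- by rewrite raddf0; apply: zspan0.
- by rewrite raddfB; apply: zspanB.
by rewrite regBME; apply: zspan_base; exists N, F, (reg F).
Qed.

Lemma dimR_exists (gT : finGroupType) (G : {group gT}) : exists d : {additive Rgrp k G -> int},
  (forall n (V : mx_representation k G n), d (clsR V) = n%:R)
  /\ forall x, (d x)%:~R = chR G 1%g x.
Proof.
have [n V m W [_ nm _ _]|n V U Umod|d dE] := @R_lift k gT G int (fun n _ => n%:R).
- by rewrite nm.
- by rewrite -natrD mxrank_coker subnKC ?rank_leq_row.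
exists d; split=> //; elim/R_ind=> [|x y ex ey|n V].
- by rewrite !raddf0.
- by rewrite !raddfB /= ex ey.
by rewrite dE charRE // repr_mx1 mxtrace1 rmorph_nat.
Qed.

Definition dimR (gT : finGroupType) (G : {group gT}) : {additive Rgrp k G -> int} :=
  projT1 (cid (dimR_exists G)).

Lemma dimRE (gT : finGroupType) (G : {group gT}) n (V : mx_representation k G n) :
  dimR G (clsR V) = n%:R.
Proof. by rewrite /dimR; case: (cid _) => d [/= ->]. Qed.

Lemma dimR_char (gT : finGroupType) (G : {group gT}) x : (dimR G x)%:~R = chR G 1%g x.
Proof. by rewrite /dimR; case: (cid _) => d [_ /= ->]. Qed.

Lemma dimR_iso (N N' : finType) (w : fiso N N') (F : colour N) (F' : colour N')
    (x : RAut F) (x' : RAut F') : chiso w x x' -> dimR (AutF F') x' = dimR (AutF F) x.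
Proof.
move=> xx'; apply/eqP; rewrite -subr_eq0 -(char0_intr_eq0 k0) rmorphB /= !dimR_char.
rewrite xx' ?group1 // subr_eq0; apply/eqP; congr (charR _ _ _ _).
by apply/permP => y; rewrite conj_permE !perm1 fwdK.
Qed.

Lemma epsM_spec : epsM X Y (@clsM k H X Y _ (empty_fun X Y)
    (clsR (triv_repr k (AutF (empty_fun X Y))))) = 1 /\
  forall (N : finType) (F : colour N) (x : RAut F), #|N| != 0%N -> epsM X Y (clsM x) = 0.
Proof.
pose P (f : M -> int) := f (@clsM k H X Y _ (empty_fun X Y)
    (clsR (triv_repr k (AutF (empty_fun X Y))))) = 1 /\
  forall (N : finType) (F : colour N) (x : RAut F), #|N| != 0%N -> f (clsM x) = 0.
apply: (@the_additiveP _ _ P).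
have [N F x y|N N' w F F' x x' e xx'|f fE] := @M_lift k H X Y int
  (fun N F x => dimR (AutF F) x *+ (#|N| == 0)%N).
- by rewrite raddfB mulrnBl.
- by rewrite (dimR_iso xx') (bij_eq_card (Bijective (fwdK w) (bwdK w))).
exists f; split=> [|N F x /negPf N0]; rewrite fE ?N0 //.
by rewrite dimRE card_void.
Qed.

Lemma regBM_eps x : epsM X Y (regBM X Y x) = epsB X Y x.
Proof.
have [e1 e0] := epsM_spec.
elim/(B_ind (X := X) k0): x => [|x y ex ey|N F]; first by rewrite !raddf0.
  by rewrite !raddfB ex ey.
have [N0|N0] := eqVneq #|N| 0%N; last by rewrite regBME e0 // (epsBE k0) (negPf N0).
by rewrite (piB_void k0 F N0) regBM_one e1 (epsBE k0) card_void.
Qed.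

(** The argument for both coproducts: D is a weighted coproduct of B, and E is given on
    regular representations by the matching formula in M. *)
Section Coproducts.
Variable phi : X -> nat.
Variable D : {additive B -> tensor B B}.
Hypothesis DE : forall (N : finType) (F : colour N),
  D (piB F) = \sum_(K : {set N}) (piR F K ⊗ piR F (~: K)) *+ weight phi F K.
Variable c : forall N : finType, colour N -> {set N} -> bool.
Variable q : forall N : finType, colour N -> {set N} -> {perm N} -> k.
Variable t : forall (N : finType) (F : colour N) (K : {set N}),
  {additive RAut F -> Rgrp k (aut_stab F K)}.
Hypothesis tE : forall (N : finType) (F : colour N) (K : {set N}) x g, g \in aut_stab F K ->
  chR (aut_stab F K) g (t F K x) = chR (AutF F) g x * q F K g.
Hypothesis qE : forall (N : finType) (F : colour N) (K : {set N}),
  c F K -> q F K 1%g = (weight phi F K)%:R.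
Hypothesis cE : forall (N : finType) (F : colour N) (K : {set N}),
  ~~ c F K -> weight phi F K = 0%N.
Variable E : {additive M -> tensor M M}.
Hypothesis EE : forall (N : finType) (F : colour N),
  E (clsM (reg F)) = \sum_(K in orbit_reps F | c F K) indstab F K (t F K (reg F)).

Lemma regBM_coproduct x : E (regBM X Y x) = tensor_map (regBM X Y) (regBM X Y) (D x).
Proof.
elim/(B_ind (X := X) k0): x => [|x y ex ey|N F]; first by rewrite !raddf0.
  by rewrite !raddfB ex ey.
rewrite regBME EE (coproduct_map DE).
pose h (K : {set N}) := tensor_map (regBM X Y) (regBM X Y)
  (piR F K ⊗ piR F (~: K)) *+ weight phi F K.
have h_inv g (K : {set N}) : g \in AutF F -> h (('P^*)%act K g) = h K.
  move=> gF; have e : iso F F (perm_iso g) by apply/aut_setP.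
  have -> : ('P^*)%act K g = fwd (perm_iso g) @: K.
    by apply: eq_imset => y; rewrite mk_finjE.
  by rewrite /h imset_fwdC !(piR_iso k0 _ e) (weight_iso _ _ e).
rewrite -[RHS]/(\sum_K h K) -(sum_orbit_reps h_inv) big_mkcondr; apply: eq_bigr => K _.
case: ifPn => [cK|/cE w0]; last by rewrite /h w0 mulr0n mul0rn.
rewrite (indstab_regular k0 tE (qE cK)) mulrnA /h tensor_mapE.
by rewrite -!regBME.
Qed.

End Coproducts.

Lemma DeltaBE (N : finType) (F : colour N) :
  DeltaB X Y (piB F) = \sum_(K : {set N}) (piR F K ⊗ piR F (~: K)) *+ weight (@hdim k H X) F K.
Proof.
move: N F; pose P (f : B -> tensor B B) := forall (N : finType) (F : colour N),
  f (piB F) = \sum_(K : {set N}) (piR F K ⊗ piR F (~: K)) *+ weight (@hdim k H X) F K.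
apply: (@the_additiveP _ _ P); exact: coproduct_exists.
Qed.

Definition is_triv (s : X) : nat := s == triv.

Lemma weight_triv (N : finType) (F : colour N) (K : {set N}) :
  weight is_triv F K = (supp F \subset yset2 Y K).
Proof.
rewrite /weight; have [/subsetP sK|/subsetPn[y ys yK]] := boolP (_ \subset _).
  rewrite big1 // => y; rewrite in_setC => yK; rewrite /is_triv.
  by case: eqP => // /eqP Fy; case/negP: yK; apply: sK; rewrite inE.
rewrite (bigD1 y) ?in_setC //= /is_triv.
by move: ys; rewrite inE => /negPf ->.
Qed.

Lemma deltaBE (N : finType) (F : colour N) :
  deltaB X Y (piB F) = \sum_(K : {set N}) (piR F K ⊗ piR F (~: K)) *+ weight is_triv F K.
Proof.
have sumE (N' : finType) (F' : colour N') :
    \sum_(K : {set N'} | supp F' \subset yset2 Y K) piR F' K ⊗ piR F' (~: K)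
    = \sum_(K : {set N'}) (piR F' K ⊗ piR F' (~: K)) *+ weight is_triv F' K.
  rewrite big_mkcond; apply: eq_bigr => K _; rewrite weight_triv.
  by case: ifP.
rewrite -sumE; move: N F; pose P (f : B -> tensor B B) := forall (N : finType) (F : colour N),
  f (piB F) = \sum_(K : {set N} | supp F \subset yset2 Y K) piR F K ⊗ piR F (~: K).
apply: (@the_additiveP _ _ P); have [D DE] := coproduct_exists k0 Y is_triv.
by exists D => N F; rewrite DE sumE.
Qed.

Let res_t (N : finType) (F : colour N) (K : {set N}) :
    {additive RAut F -> Rgrp k (aut_stab F K)} :=
  projT1 (cid (charR_subg k0 (subsetIl (AutF F) ('N(K | 'P))%g))).

Let res_tE (N : finType) (F : colour N) (K : {set N}) n (V : mx_representation k (AutF F) n) :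
  res_t F K (clsR V) = clsR (res_stab K V).
Proof. by rewrite /res_t; case: (cid _) => f [/= ->]. Qed.

Let res_t_char (N : finType) (F : colour N) (K : {set N}) x g : g \in aut_stab F K ->
  chR (aut_stab F K) g (res_t F K x) = chR (AutF F) g x.
Proof. by move=> gS; rewrite /res_t; case: (cid _) => f [_ /= ->]. Qed.

Lemma regBM_delta x :
  deltaM X Y (regBM X Y x) = tensor_map (regBM X Y) (regBM X Y) (deltaB X Y x).
Proof.
pose c (N : finType) (F : colour N) (K : {set N}) := supp F \subset yset2 Y K.
pose q (N : finType) (F : colour N) (K : {set N}) (g : {perm N}) : k := 1.
pose P (f : M -> tensor M M) := forall (N : finType) (F : colour N) n
  (V : mx_representation k (AutF F) n), f (clsM (clsR V)) =
    \sum_(K in orbit_reps F | supp F \subset yset2 Y K) ind_stab (res_stab K V).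
have c_iso (N N' : finType) (w : fiso N N') (F : colour N) (F' : colour N') (K : {set N}) :
    iso F F' w -> c N' F' (fwd w @: K) = c N F K.
  move=> e; apply/subsetP/subsetP => h y; rewrite inE => Fy.
    by rewrite -(mem_yset2_fwd w) h // inE e.
  by rewrite -[y](ymap_bwdK w) mem_yset2_fwd h // inE -e ymap_bwdK.
have tE (N : finType) (F : colour N) (K : {set N}) z g : g \in aut_stab F K ->
  chR (aut_stab F K) g (res_t F K z) = chR (AutF F) g z * q N F K g.
  by move=> gS; rewrite res_t_char // mulr1.
have mE : P (deltaM X Y).
  apply: (@the_additiveP _ _ P).
  have [//|phi phiE] := coproductM_exists k0 c_iso (q := q) _ tE.
  by exists phi => N F n V; rewrite phiE; apply: eq_bigr => K _; rewrite res_tE (ind_stabE k0).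
apply: (regBM_coproduct deltaBE tE (c := c)) => [N F K cK|N F K|N F].
- by rewrite weight_triv -/(c N F K) cK.
- by rewrite weight_triv -/(c N F K) => /negPf ->.
by rewrite mE; apply: eq_bigr => K _; rewrite (ind_stabE k0) res_tE.
Qed.

Let twist_t (N : finType) (F : colour N) (K : {set N}) :
    {additive RAut F -> Rgrp k (aut_stab F K)} :=
  projT1 (cid (charR_prod k0 (tperm_repr F K))) \o res_t F K.

Let twist_tE (N : finType) (F : colour N) (K : {set N}) n (V : mx_representation k (AutF F) n) :
  twist_t F K (clsR V) = clsR (prod_repr (res_stab K V) (tperm_repr F K)).
Proof. by rewrite /twist_t /=; case: (cid _) => f [/= fE _]; rewrite res_tE fE. Qed.

Lemma regBM_Delta x :
  DeltaM X Y (regBM X Y x) = tensor_map (regBM X Y) (regBM X Y) (DeltaB X Y x).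
Proof.
pose c (N : finType) (F : colour N) (K : {set N}) := true.
pose q (N : finType) (F : colour N) (K : {set N}) (g : {perm N}) : k := \tr (tperm_mx F K g).
pose P (f : M -> tensor M M) := forall (N : finType) (F : colour N) n
  (V : mx_representation k (AutF F) n), f (clsM (clsR V)) =
    \sum_(K in orbit_reps F) ind_stab (prod_repr (res_stab K V) (tperm_repr F K)).
have tE (N : finType) (F : colour N) (K : {set N}) z g : g \in aut_stab F K ->
  chR (aut_stab F K) g (twist_t F K z) = chR (AutF F) g z * q N F K g.
  move=> gS; rewrite /twist_t /=; case: (cid _) => f [/= _ ->] //.
  by rewrite res_t_char.
have sumE (N : finType) (F : colour N) (f : {set N} -> tensor M M) :
    \sum_(K in orbit_reps F | c N F K) f K = \sum_(K in orbit_reps F) f K.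
  by apply: eq_bigl => K; rewrite andbT.
have mE : P (DeltaM X Y).
  apply: (@the_additiveP _ _ P).
  have [//|N N' w F F' K g e _|phi phiE] := coproductM_exists k0 (c := c) _ (q := q) _ tE.
    exact: tr_tperm_iso.
  by exists phi => N F n V; rewrite phiE sumE; apply: eq_bigr => K _; rewrite twist_tE (ind_stabE k0).
apply: (regBM_coproduct DeltaBE tE (c := c)) => // [N F K _|N F].
  exact: tr_tperm1.
by rewrite mE sumE; apply: eq_bigr => K _; rewrite (ind_stabE k0) twist_tE.
Qed.

(** ** Injectivity *)

Lemma freeg_lift (T : choiceType) (C : zmodType) (f : T -> C) :
  exists g : {additive {freeg T} -> C}, forall t, g (fgen t) = f t.
Proof.
pose g0 : {freeg T} -> C := fglift (f : T -> zmodule C).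
have g0B : zmod_morphism g0 by exact: (@lift_is_additive _ T (zmodule C) f).
pose g : {additive {freeg T} -> C} := HB.pack g0 (GRing.isZmodMorphism.Build _ _ _ g0B).
by exists g => t; rewrite /= /g0 /fgen liftU scale1r.
Qed.

Definition fiso_comp (N L P : finType) (v : fiso L P) (w : fiso N L) : fiso N P :=
  mk_fiso (can_comp (fwdK v) (fwdK w)) (can_comp (bwdK w) (bwdK v)).

Lemma iso_comp (N L P : finType) (w : fiso N L) (v : fiso L P)
    (F : colour N) (G : colour L) (E : colour P) :
  iso F G w -> iso G E v -> iso F E (fiso_comp v w).
Proof.
move=> e e' y; rewrite -e -e' -ymapM; congr (E (ymap Y _ y)).
by apply: finj_eq => x; rewrite finj_compE.
Qed.

Local Notation coloring := (coloring X Y).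

Definition isoc (c c' : coloring) : Prop :=
  exists w : fiso 'I_(tag c) 'I_(tag c'), iso (tagged c) (tagged c') w.

Lemma isoc_sym c c' : isoc c c' -> isoc c' c.
Proof. by case=> w e; exists (fiso_inv w); apply: iso_inv. Qed.

Lemma isoc_trans c c' c'' : isoc c c' -> isoc c' c'' -> isoc c c''.
Proof. by case=> w e [v e']; exists (fiso_comp v w); apply: iso_comp. Qed.

Definition canon (c : coloring) : coloring := choose (fun c' => `[< isoc c c' >]) c.

Lemma canonP c : isoc c (canon c).
Proof.
apply/asboolP; apply: (@chooseP _ (fun c' => `[< isoc c c' >])); apply/asboolP.
by exists (fiso_id _); apply: iso_id.
Qed.

Lemma canon_iso c c' : isoc c c' -> canon c' = canon c.
Proof.
move=> cc'; rewrite /canon; transitivity (choose (fun d => `[< isoc c d >]) c').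
  apply: eq_choose => d; apply/asboolP/asboolP => h; first exact: isoc_trans cc' h.
  exact: isoc_trans (isoc_sym cc') h.
apply: choose_id; apply/asboolP => //.
by exists (fiso_id _); apply: iso_id.
Qed.

Definition code (N : finType) (F : colour N) : coloring :=
  existT (fun n => {ffun Y 'I_n -> X}) #|N| (transp (enum_iso N) F).

(** Sending the class of F to the chosen representative of its isomorphism class has
    the obvious retraction, so it embeds B in a free abelian group, where
    coefficients can be compared. *)
Lemma B_free : exists phi : {additive B -> {freeg coloring}},
  injective phi /\ forall (N : finType) (F : colour N), phi (piB F) = fgen (canon (code F)).
Proof.
have [|phi phiE] := B_lift k0 (f := fun N (F : colour N) => fgen (canon (code F))).
  move=> N N' w F F' e; congr fgen; apply: canon_iso.
  exists (fiso_comp (fiso_comp (enum_iso N') w) (fiso_inv (enum_iso N))).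
  apply: (iso_comp (iso_inv (transp_iso _ _))).
  by apply: (iso_comp e); apply: transp_iso.
have [psi psiE] := freeg_lift (fun c : coloring => piB (tagged c)).
exists phi; split=> //; apply: (can_inj (g := psi)) => x.
elim/(B_ind (X := X) k0): x => [|x y ex ey|N F]; first by rewrite !raddf0.
  by rewrite !raddfB ex ey.
rewrite phiE psiE; have [w e] := canonP (code F).
by rewrite (piB_iso k0 e) (piB_iso k0 (transp_iso (enum_iso N) F)).
Qed.

(** The map d from M to B that sends a representation of Aut F to its dimension times
    pi_F satisfies d (reg pi_F) = #|Aut F| pi_F. The composite d reg thus acts on
    the basis of B by nonzero integers, so it is injective. *)
Lemma regBM_inj : injective (regBM X Y).
Proof.
have [N F x y|N N' w F F' x x' e xx'|d dE] := @M_lift k H X Y B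
  (fun N F x => piB F *~ dimR (AutF F) x).
- by rewrite raddfB mulrzBr.
- by rewrite (dimR_iso xx') (piB_iso k0 e).
have [phi [phi_inj phiE]] := B_free.
have main z c : coeff c (phi (d (regBM X Y z)))
    = #|AutF (tagged c)|%:R * coeff c (phi z).
  elim/(B_ind (X := X) k0): z => [|x y ex ey|N F]; first by rewrite !raddf0 mulr0.
    by rewrite (raddfB (regBM X Y)) (raddfB d) !(raddfB phi) !coeffB ex ey mulrBr.
  rewrite regBME dE dimRE !raddfMz /= phiE coeffU mul1r.
  case: eqP => [<-|_]; last by rewrite mulr0 mul0rz.
  have [w e] := canonP (code F).
  by rewrite (card_AutF_iso e) (card_AutF_iso (transp_iso (enum_iso N) F)) mulr1 -mulrzr intz mul1r.
apply: raddf_inj => z rz; apply: phi_inj; rewrite raddf0; apply/eqP/freeg_eqP => c.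
have := main z c; rewrite rz !raddf0 => /esym/eqP.
rewrite mulf_eq0 Num.Theory.pnatr_eq0 eqn0Ngt cardG_gt0 /= => /eqP e.
by rewrite /= e.
Qed.

Lemma regBM_embedding : graded_algebra_embedding (A := algB X Y) (A' := algM X Y) (regBM X Y).
Proof.
split; [exact: regBM_inj|exact: regBM_one|exact: regBM_mul|exact: regBM_deg].
Qed.

Lemma hdim_triv : hdim triv = 1%N.
Proof. by case: (htrivP X). Qed.

End Main.

Theorem proposition3p25 (k : closedFieldType) (k_char0 : [pchar k] =i pred0)
    (H : finGroupType) (X : irr_reps k H) (Y : young_set) :
  [/\ forall (N : finType) (F : {ffun Y N -> X}),
        regBM X Y (piB F) = clsM (F := F) (clsR (regular_repr k (AutF F))),
      graded_algebra_embedding (regBM X Y),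
      [/\ forall x, DeltaM X Y (regBM X Y x)
                    = tensor_map (regBM X Y) (regBM X Y) (DeltaB X Y x),
          forall x, deltaM X Y (regBM X Y x)
                    = tensor_map (regBM X Y) (regBM X Y) (deltaB X Y x)
        & forall x, epsM X Y (regBM X Y x) = epsB X Y x]
    & [/\ connected_algebra (algB X Y),
          commutative_algebra (algB X Y),
          is_graded_hopf_algebra (DeltaB X Y) (epsB X Y)
            /\ cocommutative_coalgebra (DeltaB X Y)
        & is_graded_hopf_algebra (deltaB X Y) (epsB X Y)
            /\ cocommutative_coalgebra (deltaB X Y)]].
Proof.
split; first exact: regBME.
- exact: regBM_embedding.
- by split; [apply: regBM_Delta|apply: regBM_delta|apply: regBM_eps].
split; [exact: connectedB|exact: mulBC| |].
  by apply: (coproduct_hopf k_char0 (hdim_triv X)); apply: DeltaBE.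
by apply: (coproduct_hopf k_char0 (phi := @is_triv k H X)); [rewrite /is_triv eqxx|apply: deltaBE].
Qed.
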